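(* Let $\mathcal X=C([-1,0];\mathbb R^2)$, and let $V:\mathcal X\to\mathbb R$ and $f:\mathcal X\times\mathbb R^2\to\mathbb R^2$ be the explicit functional and vector field defined in the context. Consider the time-delay system $\dot x(t)=f(x_t,u(t))$, $x_0=\phi\in\mathcal X$, that is, with $x=[p\ \ q]^\top$ and $u=[a\ \ b]^\top$, $$\dot p(t)=-p(t)-p(t)^5+16\big(1+V(x_t)\big)^3\,b(t)\,E(x_t),\qquad \dot q(t)=-q(t)+a(t).$$ Then the following hold. (i) $V$ and $f$ are Lipschitz on bounded sets, $f(0,0)=0$, and for all $\phi\in\mathcal X$, $$\tfrac12|\phi(0)|^2\le V(\phi)\le\tfrac32\|\phi\|^2 .$$ (ii) The system is robustly forward complete and, for every $\phi\in\mathcal X$ with $\phi(0)=[p\ \ q]^\top$ and every $[a\ \ b]^\top\in\mathbb R^2$, $$D^+V\big(\phi,f(\phi,[a\ \ b]^\top)\big)\le-p^2-\tfrac12q^2+a^2\le-\tfrac12|\phi(0)|^2+\big|[a\ \ b]^\top\big|^2 .$$ (iii) For integers $n\ge0$ set $\varepsilon_n=(-1)^n$, $\tau_n=\frac n4+\frac1{64}\sum_{j=1}^n\frac1j$ (the sum being $0$ for $n=0$), $\rho_n=\tau_n+\frac14$, $\delta_n=\frac1{64(n+1)}$, so that $\tau_{n+1}=\rho_n+\delta_n$. Let $u:\mathbb R_{\ge0}\to\mathbb R^2$ be the input $$u(t)=\begin{bmatrix}a(t)\\ b(t)\end{bmatrix}=\begin{cases}\begin{bmatrix}\varepsilon_n[28+32(t-\tau_n)]\\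 0\end{bmatrix},&\tau_n\le t<\rho_n,\\[3mm] \begin{bmatrix}4\varepsilon_n\\ -\varepsilon_n\end{bmatrix},&\rho_n\le t<\tau_{n+1},\end{cases}\qquad n\ge0 .$$ This input is bounded, piecewise continuous and right-continuous, with $\|u\|_\infty=36$. The solution $x=[p\ \ q]^\top$ of the system with this input, starting from the constant history $\phi(\theta)=[2\ \ -4]^\top$ for $-1\le\theta\le0$, satisfies, for every $n\ge0$, $$\varepsilon_n\,p(\tau_n)>0,\qquad \sqrt{20+12n}\le|x(\tau_n)|\le\sqrt{20+16n}.$$ Consequently, the following conjecture is false, since this system and this $V$ satisfy its hypotheses but the system is not ISS: ''If $f$ is Lipschitz on bounded sets with $f(0,0)=0$, and $V:\mathcal X\to\mathbb R_{\ge0}$ is Lipschitz on bounded sets, satisfies $\underline\alpha(|\phi(0)|)\le V(\phi)\le\overline\alpha(\|\phi\|)$ for all $\phi\in\mathcal X$ for some $\underline\alpha,\overline\alpha\in\mathcal K_\infty$, and satisfies $D^+V(\phi,f(\phi,u))\le-\alpha(|\phi(0)|)+\gamma(|u|)$ for all $\phi\in\mathcal X$, $u\in\mathbb R^2$ for some $\alpha\in\mathcal K_\infty$ and $\gamma\in\mathcal N$, then the system $\dot x(t)=f(x_t,u(t))$ is ISS.''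
   Context: Notation. $|\cdot|$ is the Euclidean norm on $\mathbb R^2$; $\mathcal X=C([-1,0];\mathbb R^2)$ has norm $\|\phi\|=\max_{-1\le\theta\le0}|\phi(\theta)|$. For $x:[-1,T)\to\mathbb R^2$ and $t\in[0,T)$, $x_t\in\mathcal X$ is $x_t(\theta)=x(t+\theta)$. Inputs are Lebesgue-measurable, locally essentially bounded functions $u:\mathbb R_{\ge0}\to\mathbb R^2$; $\|u\|_\infty$ is the essential supremum of $|u|$, and $\|u_{[0,t]}\|_\infty$ is the essential supremum of $|u|$ on $[0,t]$. Solutions $x(t,\phi,u)$ of $\dot x(t)=f(x_t,u(t))$, $x_0=\phi$, are in the Carathéodory sense: continuous on $[-1,T)$, locally absolutely continuous on $[0,T)$, satisfying the equation for almost every $t$. When $f$ is Lipschitz on bounded sets, they exist locally, are unique, and can be continued as long as they are bounded. A map is Lipschitz on bounded sets if its restriction to each bounded set is Lipschitz. Definition of $V$ and $f$. For $\phi=[\pi\ \ \zeta]^\top\in\mathcal X$ write $p=\pi(0)$, $q=\zeta(0)$. For $\sigma\in\{+1,-1\}$ let $g_\sigma(v)=\tfrac12\max\{\sigma v,0\}^2$ for $v\in\mathbb R$. For $\theta\in[-1,0]$ define $$F_\sigma(\phi,\theta)=g_\sigma(\pi(\theta))+\tfrac12q^2+g_\sigma(q)-g_\sigma(\zeta(\theta))-\int_\theta^0\pi(s)^2\,ds,$$ $$V(\phi)=\max_{\sigma\in\{+1,-1\},\ \theta\in[-1,0]}F_\sigma(\phi,\theta),\qquad C(\phi)=\tfrac12(p^2+q^2),\qquad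 E(\phi)=V(\phi)-C(\phi).$$ For $u=[a\ \ b]^\top\in\mathbb R^2$, $$f(\phi,u)=\begin{bmatrix}-p-p^5+16(1+V(\phi))^3\,b\,E(\phi)\\ -q+a\end{bmatrix}.$$ Driver derivative. For $\phi\in\mathcal X$, $w\in\mathbb R^2$, $0<h<1$, let $\phi_{h,w}\in\mathcal X$ be given by $\phi_{h,w}(\theta)=\phi(\theta+h)$ for $-1\le\theta<-h$ and $\phi_{h,w}(\theta)=\phi(0)+(\theta+h)w$ for $-h\le\theta\le0$, and let $$D^+V(\phi,w)=\limsup_{h\downarrow0}\frac{V(\phi_{h,w})-V(\phi)}{h}.$$ Comparison functions. $\mathcal K$: continuous strictly increasing maps $\mathbb R_{\ge0}\to\mathbb R_{\ge0}$ vanishing at $0$; $\mathcal K_\infty$: unbounded elements of $\mathcal K$; $\mathcal N$: continuous nondecreasing maps $\mathbb R_{\ge0}\to\mathbb R_{\ge0}$ vanishing at $0$; $\mathcal{KL}$: continuous $\beta:\mathbb R_{\ge0}\times\mathbb R_{\ge0}\to\mathbb R_{\ge0}$ with $\beta(\cdot,t)\in\mathcal K$ for each $t$ and $\beta(s,\cdot)$ decreasing to zero for each $s$. ISS. The system is ISS if there exist $\beta\in\mathcal{KL}$ and $\mu\in\mathcal N$ such that, for every $\phi\in\mathcal X$ and every input $u$, the solution exists for all $t\ge0$ and $|x(t,\phi,u)|\le\beta(\|\phi\|,t)+\mu(\|u_{[0,t]}\|_\infty)$ for all $t\ge0$. Robust forward completeness. For every $\phi\in\mathcal X$ and every input $u$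 the solution exists for all $t\ge0$, and for all $r,T>0$, $\sup\{|x(t,\phi,u)|:\ \|\phi\|\le r,\ \|u\|_\infty\le r,\ t\in[0,T]\}<\infty$. *)

(* Defs.v *)
From HB Require Import structures.
From mathcomp Require Import all_boot all_order all_algebra.
From mathcomp Require Import all_classical all_reals all_analysis.
From mathcomp Require Import ess_sup_inf.
From mathcomp Require Import ring lra.

Set Implicit Arguments.
Unset Strict Implicit.
Unset Printing Implicit Defensive.

Import Order.TTheory GRing.Theory Num.Theory.
Import numFieldNormedType.Exports.

Local Open Scope classical_set_scope.
Local Open Scope ring_scope.

Notation plane R := (R * R)%type.

(* The norm that the library puts on a product is the sup norm, which induces
   the same topology, but the estimates below are about this one. *)
Definition enorm {R : realType} (v : plane R) : R :=
  Num.sqrt (v.1 ^+ 2 + v.2 ^+ 2).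

(* A history is represented by a total function on R of which only the
   restriction to [-1, 0] matters; functionals on histories are total functions
   on R -> R^2 and their properties are asserted on [history] only. *)
Definition history {R : realType} : set (R -> plane R) :=
  [set phi | {within `[(-1 : R), 0], continuous phi}].

(* For a continuous phi the supremum is attained. *)
Definition hnorm {R : realType} (phi : R -> plane R) : R :=
  sup [set enorm (phi th) | th in `[(-1 : R), 0]].

Definition segment {R : realType} (x : R -> plane R) (t : R) : R -> plane R :=
  fun th => x (t + th).

(* [nT] and [nS] are the norms under consideration on T and S. *)
Definition lipschitz_on_bounded {R : realType} {T S : zmodType}
    (nT : T -> R) (nS : S -> R) (D : set T) (g : T -> S) : Prop :=
  forall B : set T, B `<=` D -> (exists r, forall z, B z -> nT z <= r) ->
    exists L, forall y z, B y -> B z -> nS (g y - g z) <= L * nT (y - z).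

Definition lipschitz_functional {R : realType} (V : (R -> plane R) -> R) :
    Prop :=
  lipschitz_on_bounded (@hnorm R) (fun r : R => `|r|) history V.

Definition lipschitz_field {R : realType}
    (f : (R -> plane R) -> plane R -> plane R) : Prop :=
  lipschitz_on_bounded
    (fun z : (R -> plane R) * plane R => hnorm z.1 + enorm z.2) (@enorm R)
    [set z | history z.1] (fun z => f z.1 z.2).

(* Extension by 0 outside D makes this 0 when D is negligible. *)
Definition ess_norm {R : realType} (D : set R) (u : R -> plane R) : \bar R :=
  ess_sup lebesgue_measure ((fun t => (enorm (u t))%:E) \_ D).

(* The source carries the Lebesgue (Caratheodory) sigma-algebra, not the Borel
   one; only the values on [0, +oo[ matter. *)
Definition is_input {R : realType} (u : R -> plane R) : Prop :=
  @measurable_fun _ _ (caratheodory_type (@wlength R idfun)^*%mu) (plane R)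
    `[0, +oo[ u /\
  forall T : R, 0 <= T -> (ess_norm `[0%R, T] u < +oo)%E.

Definition abs_continuous_on {R : realType} (a b : R) (x : R -> plane R) :
    Prop :=
  forall e, 0 < e -> exists2 d, 0 < d &
    forall (n : nat) (I : 'I_n -> R * R),
      (forall i, [/\ a <= (I i).1, (I i).1 <= (I i).2 & (I i).2 <= b]) ->
      trivIset setT (fun i => `](I i).1, (I i).2[%classic) ->
      \sum_(i < n) ((I i).2 - (I i).1) < d ->
      \sum_(i < n) enorm (x (I i).2 - x (I i).1) < e.

(* Solutions on [-1, +oo[. *)
Definition is_solution {R : realType}
    (f : (R -> plane R) -> plane R -> plane R)
    (phi u x : R -> plane R) : Prop :=
  [/\ {in `[(-1 : R), 0], x =1 phi},
      {within `[(-1 : R), +oo[, continuous x},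
      forall b, 0 <= b -> abs_continuous_on 0 b x &
      {ae lebesgue_measure, forall t : R, 0 <= t ->
         is_derive t 1 x (f (segment x t) (u t))}].

Definition class_K {R : realType} (a : R -> R) : Prop :=
  [/\ a 0 = 0, {within `[(0 : R), +oo[, continuous a} &
      forall r s, 0 <= r -> r < s -> a r < a s].

Definition class_Koo {R : realType} (a : R -> R) : Prop :=
  class_K a /\ forall M, exists2 s, 0 <= s & M < a s.

Definition class_N {R : realType} (a : R -> R) : Prop :=
  [/\ a 0 = 0, {within `[(0 : R), +oo[, continuous a} &
      forall r s, 0 <= r -> r <= s -> a r <= a s].

Definition class_KL {R : realType} (beta : R -> R -> R) : Prop :=
  [/\ {within [set z : R * R | 0 <= z.1 /\ 0 <= z.2],
         continuous (fun z : R * R => beta z.1 z.2)},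
      forall t, 0 <= t -> class_K (beta ^~ t),
      forall s r t, 0 <= s -> 0 <= r -> r <= t -> beta s t <= beta s r &
      forall s, 0 <= s -> beta s t @[t --> +oo] --> (0 : R)].

Definition ISS {R : realType} (f : (R -> plane R) -> plane R -> plane R) :
    Prop :=
  exists (beta : R -> R -> R) (mu : R -> R),
    [/\ class_KL beta, class_N mu &
      forall phi u, history phi -> is_input u ->
        (exists x, is_solution f phi u x) /\
        forall x, is_solution f phi u x -> forall t, 0 <= t ->
          enorm (x t) <= beta (hnorm phi) t + mu (fine (ess_norm `[0, t] u))].

Definition robustly_forward_complete {R : realType}
    (f : (R -> plane R) -> plane R -> plane R) : Prop :=
  (forall phi u, history phi -> is_input u ->
     exists x, is_solution f phi u x) /\
  forall r T : R, 0 < r -> 0 < T ->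
    (ereal_sup [set z | exists phi u x t,
       [/\ history phi /\ (hnorm phi <= r)%R,
           is_input u /\ ess_norm `[0%R, +oo[ u <= r%:E,
           is_solution f phi u x,
           (0 <= t <= T)%R &
           z = (enorm (x t))%:E]] < +oo)%E.

Definition driver_shift {R : realType} (phi : R -> plane R) (h : R)
    (w : plane R) : R -> plane R :=
  fun th => if th < - h then phi (th + h) else phi 0 + (th + h) *: w.

Definition driver_derivative {R : realType} (V : (R -> plane R) -> R)
    (phi : R -> plane R) (w : plane R) : \bar R :=
  limf_esup (fun h : R => ((V (driver_shift phi h w) - V phi) / h)%:E)
    (0 : R)^'+.

Definition conjecture_hypotheses {R : realType}
    (f : (R -> plane R) -> plane R -> plane R) (V : (R -> plane R) -> R) :
    Prop :=
  [/\ lipschitz_field f,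
      f 0 0 = 0,
      (forall phi, history phi -> 0 <= V phi) /\ lipschitz_functional V,
      exists al au : R -> R, [/\ class_Koo al, class_Koo au &
        forall phi, history phi ->
          al (enorm (phi 0)) <= V phi <= au (hnorm phi)] &
      exists alpha gamma : R -> R, [/\ class_Koo alpha, class_N gamma &
        forall phi u, history phi ->
          (driver_derivative V phi (f phi u) <=
             (- alpha (enorm (phi 0%R)) + gamma (enorm u))%:E)%E]].

Definition conjecture (R : realType) : Prop :=
  forall (f : (R -> plane R) -> plane R -> plane R) (V : (R -> plane R) -> R),
    conjecture_hypotheses f V -> ISS f.

Definition g_ {R : realType} (s v : R) : R := Num.max (s * v) 0 ^+ 2 / 2.

Definition F_ {R : realType} (s : R) (phi : R -> plane R) (th : R) : R :=
  let q := (phi 0).2 in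
  g_ s (phi th).1 + q ^+ 2 / 2 + g_ s q - g_ s (phi th).2
  - \int[lebesgue_measure]_(r in `[th, 0]) ((phi r).1 ^+ 2).

(* For a continuous phi the supremum is attained. *)
Definition V_ {R : realType} (phi : R -> plane R) : R :=
  sup [set F_ s phi th | s in [set (1 : R); -1] & th in `[(-1 : R), 0]].

Definition E_ {R : realType} (phi : R -> plane R) : R :=
  V_ phi - ((phi 0).1 ^+ 2 + (phi 0).2 ^+ 2) / 2.

Definition f_ {R : realType} (phi : R -> plane R) (u : plane R) : plane R :=
  let p := (phi 0).1 in
  let q := (phi 0).2 in
  (- p - p ^+ 5 + 16 * (1 + V_ phi) ^+ 3 * u.2 * E_ phi, - q + u.1).

Definition eps_ {R : realType} (n : nat) : R := (-1) ^+ n.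

Definition tau {R : realType} (n : nat) : R :=
  n%:R / 4 + (\sum_(1 <= j < n.+1) j%:R^-1) / 64.

Definition rho {R : realType} (n : nat) : R := tau n + 1 / 4.

Definition delta {R : realType} (n : nat) : R := (64 * n.+1%:R)^-1.

(* On [0, +oo[ the index selected by [xget] exists and is unique, see
   [switching_inputE]. *)
Definition switching_input {R : realType} (t : R) : plane R :=
  let n := xget 0%N [set n : nat | tau n <= t < tau n.+1] in
  if t < rho n then (eps_ n * (28 + 32 * (t - tau n)), 0)
  else (4 * eps_ n, - eps_ n).

Lemma tauS (R : realType) n : tau n.+1 = rho n + delta n :> R.
Proof.
rewrite /rho /delta /tau big_nat_recr //= -natr1 invfM.
by field; rewrite natr1 !pnatr_eq0.
Qed.

Lemma delta_gt0 (R : realType) n : 0 < delta n :> R.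
Proof. by rewrite /delta invr_gt0 mulr_gt0 // ltr0n. Qed.

Lemma tau_lt_rho (R : realType) n : tau n < rho n :> R.
Proof. by rewrite /rho; lra. Qed.

Lemma rho_lt_tauS (R : realType) n : rho n < tau n.+1 :> R.
Proof. by rewrite tauS ltrDl delta_gt0. Qed.

Lemma tau_le (R : realType) m n : (m <= n)%N -> tau m <= tau n :> R.
Proof.
move=> mn; rewrite -(subnK mn); elim: (n - m)%N => [|k IH]; first by rewrite add0n.
by rewrite addSn (le_trans IH) // ltW // (lt_trans (tau_lt_rho _ _)) // rho_lt_tauS.
Qed.

Lemma tau_cover (R : realType) (t : R) : 0 <= t ->
  exists n : nat, tau n <= t < tau n.+1.
Proof.
move=> t0; have [m] : exists m, t < tau m.
  exists (Num.bound (4 * t)).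
  have := archi_boundP (mulr_ge0 (ler0n R 4) t0).
  have : 0 <= \sum_(1 <= j < (Num.bound (4 * t)).+1) (j%:R : R)^-1.
    by apply: sumr_ge0 => j _; rewrite invr_ge0 ler0n.
  by rewrite /tau; lra.
elim: m => [|m IH].
  by rewrite /tau big_geq //= !mul0r addr0 ltNge t0.
move=> tm; have [/IH //|mt] := ltP t (tau m).
by exists m; rewrite mt.
Qed.

Lemma tau_uniq (R : realType) (t : R) m n :
  tau m <= t < tau m.+1 -> tau n <= t < tau n.+1 -> m = n.
Proof.
move=> /andP[m1 m2] /andP[n1 n2]; apply/eqP; rewrite eqn_leq.
apply/andP; split; rewrite leqNgt; apply/negP => /(@tau_le R) h.
  by move: (lt_le_trans n2 (le_trans h m1)); rewrite ltxx.
by move: (lt_le_trans m2 (le_trans h n1)); rewrite ltxx.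
Qed.

Lemma switching_inputE (R : realType) (n : nat) (t : R) :
  (tau n <= t < rho n ->
     switching_input t = (eps_ n * (28 + 32 * (t - tau n)), 0)) /\
  (rho n <= t < tau n.+1 -> switching_input t = (4 * eps_ n, - eps_ n)).
Proof.
have key : tau n <= t < tau n.+1 ->
    xget 0%N [set n : nat | tau n <= t < tau n.+1] = n.
  move=> tn; apply: xget_unique => // m tm; exact: (tau_uniq tm tn).
rewrite /switching_input; split => /andP[h1 h2].
  by rewrite key ?h2 // h1 (lt_trans h2 (rho_lt_tauS _ _)).
by rewrite key ?ltNge ?h1 //= -?ltNge h2 (le_trans (ltW (tau_lt_rho _ _)) h1).
Qed.

Definition bounded_input {R : realType} (u : R -> plane R) : Prop :=
  exists M, forall t, 0 <= t -> enorm (u t) <= M.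

Definition right_continuous_input {R : realType} (u : R -> plane R) : Prop :=
  forall t : R, 0 <= t -> u s @[s --> t^'+] --> u t.

(* Finitely many discontinuities on each compact interval, with finite
   one-sided limits everywhere. *)
Definition piecewise_continuous_input {R : realType} (u : R -> plane R) : Prop :=
  [/\ forall T : R, finite_set [set t | 0 < t <= T /\ ~ {for t, continuous u}],
      forall t : R, 0 < t -> exists l : plane R, u s @[s --> t^'-] --> l &
      forall t : R, 0 <= t -> exists l : plane R, u s @[s --> t^'+] --> l].

(* Main.v *)
Require Import Defs.
From mathcomp Require Import all_boot all_order all_algebra.
From mathcomp Require Import all_classical all_reals all_analysis.
From mathcomp Require Import ess_sup_inf measurable_realfun ring lra.

(* Along a solution, V grows at most like the integral of a^2, because every
   term of V other than C = |x(t)|^2/2 does, and C can only overtake them when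
   E = V - C vanishes, that is when the input b is switched off. This gives the
   dissipation inequality, forward completeness, and, through Picard iteration
   on a truncated equation, existence.
   The point-wise dissipation nevertheless allows V to be pumped by a fixed
   amount per period. While q climbs from -4e to 4e, the term of V indexed by
   the time tau_n keeps p(tau_n)^2/2 in memory and gains g_e(4e) = 8, although p
   itself relaxes, losing only a bounded integral of p^2 since p^5 damps it
   quickly. During the following short pulse the factor (1 + V)^3 is strong
   enough to convert E back into p^2, with the opposite sign, so that |x|^2
   increases by at least 12 at each switching time while the input stays
   bounded. *)

Set Implicit Arguments.
Unset Strict Implicit.
Unset Printing Implicit Defensive.

Import Order.TTheory GRing.Theory Num.Theory.
Import numFieldNormedType.Exports.

Local Open Scope classical_set_scope.
Local Open Scope ring_scope.

(** * Derivatives and absolutely continuous functions *)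

Section derivatives.
Variable R : realType.

(** V(x_t) is a maximum over a sliding window and is never differentiated along a solution. Each
    term is written with a fixed past instant r = t + th, which makes it differentiable in t; a term
    enters the window only at r = t, with a value at most C. Inputs being merely measurable,
    derivatives exist only almost everywhere, so all comparisons rest on one monotonicity statement,
    applied to functions that a bounded right-hand side makes Lipschitz. The constants fit together
    as follows. The ramp 28 + 32 (t - tau_n) is q + q' for q affine from -4 to 4. In a pulse p^2 has
    size n, so the length must be of order 1/n for the integral of p^2 to stay bounded. In that time
    p must cross a distance of order sqrt n against a damping of order n^(5/2); a speed of order (1
    + V)^3, that is n^3, is enough for both. A ramp and a pulse last at most 1/4 + 1/64 < 1, so time
    tau_n is still in the window when its memory is used. By induction p(tau_n)^2 >= 4 + 12 n and V
    <= 10 + 8 n, which yield the two bounds on |x(tau_n)|. *)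

Lemma is_deriveP (W : normedModType R) (f : R -> W) (t : R) (d : W) :
  is_derive t 1 f d <->
  forall e, 0 < e -> exists2 eta, 0 < eta & forall s, `|s - t| < eta ->
    `|f s - f t - (s - t) *: d| <= e * `|s - t|.
Proof.
have -> : is_derive t 1 f d <-> h^-1 *: (f (h *: (1 : R) + t) - f t) @[h -->
  0^'] --> d.
  split=> [[df fd]|fd]; first by rewrite -fd.
  have cf : cvg (h^-1 *: (f (h *: (1 : R) + t) - f t) @[h --> 0^']).
    by apply/cvg_ex; exists d.
  by split=> //; exact: cvg_lim.
split=> [/cvgrPdist_le fd e e0|fd].
  have [eta /= eta0 H] := fd e e0.
  exists eta => // s st.
  have [->|nst] := eqVneq s t; first by rewrite !subrr scale0r subr0 !normr0
    mulr0.
  have st0 : s - t != 0 by rewrite subr_eq0.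
  have := H (s - t); rewrite /ball_ /= sub0r normrN => /(_ st st0).
  rewrite [_%:A]mulr1 subrK => Hd.
  have -> : f s - f t - (s - t) *: d = (s - t) *: ((s - t)^-1 *: (f s - f t) -
    d).
    by rewrite scalerBr scalerA divff // scale1r.
  by rewrite normrZ mulrC ler_wpM2r // distrC.
apply/cvgrPdist_le => e e0.
have [eta eta0 H] := fd e e0.
exists eta => //= h /=; rewrite sub0r normrN => hh h0.
have := H (h + t); rewrite addrK => /(_ hh) {}H.
rewrite [_%:A]mulr1 distrC.
have -> : h^-1 *: (f (h + t) - f t) - d = h^-1 *: (f (h + t) - f t - h *: d).
  by rewrite [RHS]scalerBr scalerA mulVf // scale1r.
rewrite normrZ normfV mulrC ler_pdivrMr ?normr_gt0 //.
Qed.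

Lemma is_derive_near (W : normedModType R) (f g : R ->
  W) (t : R) (d : W) (eta : R) :
  0 < eta -> (forall s, `|s - t| < eta -> f s = g s) ->
  is_derive t 1 f d -> is_derive t 1 g d.
Proof.
move=> eta0 fg /is_deriveP fd; apply/is_deriveP => e /fd[eta' eta'0 H].
exists (Num.min eta eta'); first by rewrite lt_min eta0.
move=> s; rewrite lt_min => /andP[s1 s2].
by rewrite -!fg ?subrr ?normr0 //; exact: H.
Qed.

Lemma is_derive_pair (f : R -> plane R) (t : R) (d : plane R) :
  is_derive t 1 f d <->
  is_derive t 1 (fun s => (f s).1) d.1 /\ is_derive t 1 (fun s => (f s).2) d.2.
Proof.
split=> [/is_deriveP fd|[/is_deriveP f1 /is_deriveP f2]].
  split; apply/is_deriveP => e /fd[eta eta0 H]; exists eta => // s /H;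
    rewrite {1}/Num.norm /= ge_max => /andP[]//.
apply/is_deriveP => e e0.
have [a a0 A] := f1 e e0; have [b b0 B] := f2 e e0.
exists (Num.min a b); first by rewrite lt_min a0.
move=> s; rewrite lt_min => /andP[s1 s2].
by rewrite {1}/Num.norm /= ge_max A // B.
Qed.

End derivatives.

(** * Increments controlled by a derivative bound almost everywhere *)

Section monotonicity.
Variable R : realType.
Notation mu := (@lebesgue_measure R).

(** Scalar form of [abs_continuous_on], inherited by each component of a solution because [enorm]
    dominates the coordinates. *)
Definition abs_cont (a b : R) (h : R -> R) := forall e, 0 < e -> exists2 d,
  0 < d &
    forall (n : nat) (I : 'I_n -> R * R),
      (forall i, [/\ a <= (I i).1, (I i).1 <= (I i).2 & (I i).2 <= b]) ->
      trivIset setT (fun i => `](I i).1, (I i).2[%classic) ->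
      \sum_(i < n) ((I i).2 - (I i).1) < d ->
      \sum_(i < n) `|h (I i).2 - h (I i).1| < e.

Lemma trivIset_ordered_itv (n : nat) (I : nat -> R * R) :
  (forall i j, (i < j < n)%N -> (I i).2 <= (I j).1) ->
  trivIset setT (fun i : 'I_n => `](I i).1, (I i).2[%classic).
Proof.
move=> HD; apply/trivIsetP => i j _ _.
wlog : i j / (i < j)%N => [H ij|ij _].
  have [lij|lji|e] := ltngtP i j; first exact: H.
    by rewrite setIC; apply: H; rewrite // eq_sym.
  by move: ij; rewrite -val_eqE /= e eqxx.
rewrite -subset0 => x [] /=; rewrite !in_itv /= => /andP[_ x2] /andP[x3 _].
have := HD i j; rewrite ij ltn_ord => /(_ isT) H.
by move: (lt_trans (lt_le_trans x2 H) x3); rewrite ltxx.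
Qed.

Lemma sum_disjoint_itv_le (U : set R) (n : nat) (I : nat -> R * R) (d : R) :
  (forall i, (i < n)%N -> (I i).1 <= (I i).2 /\ `](I i).1, (I i).2[ `<=` U) ->
  (forall i j, (i < j < n)%N -> (I i).2 <= (I j).1) ->
  open U -> (mu U < d%:E)%E ->
  \sum_(i < n) ((I i).2 - (I i).1) < d.
Proof.
move=> HI HD oU Ud; rewrite -lte_fin.
apply: le_lt_trans Ud.
have tI := trivIset_ordered_itv HD.
have -> : ((\sum_(i < n) ((I i).2 - (I i).1))%:E
   = mu (\big[setU/set0]_(i < n) `](I i).1, (I i).2[%classic))%E.
  rewrite measure_bigsetU_ord //.
  rewrite -sumEFin; apply: eq_bigr => i _.
  rewrite -[RHS]/(mu _) lebesgue_measure_itv /= lte_fin -EFinB.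
  have [|] := ltrP (I i).1 (I i).2 => // h2.
  have [h1 _] := HI i (ltn_ord i).
  by have -> : (I i).1 = (I i).2; [apply/eqP; rewrite eq_le h1 h2|
    rewrite subrr].
apply: le_measure; rewrite ?inE.
- by apply: bigsetU_measurable => i _; exact: measurable_itv.
- exact: measurable_realfun.open_measurable.
by elim/big_ind: _ => // [A B AU BU x [/AU|/BU] //|i _]; have [] :=
  HI i (ltn_ord i).
Qed.

(* A null set is covered by an open set of small measure, over which h varies
   little by absolute continuity; off this set h has slope at most c. *)
Lemma ac_slope_le (a b c : R) (h : R -> R) : a <= b -> 0 <= c ->
  abs_cont a b h ->
  {ae mu, forall t, a < t < b -> exists2 d, is_derive t 1 h d & d <= c} ->
  h b - h a <= c * (b - a).
Proof.
move=> ab c0 ach [N [mN N0 hN]].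
apply/ler_addgt0Pr => e e0.
pose e1 := e / (2 * (b - a + 1)).
have ba1 : 0 < b - a + 1 by rewrite ltr_wpDl // subr_ge0.
have e10 : 0 < e1 by rewrite divr_gt0 // mulr_gt0.
have [d d0 Hd] := ach _ (divr_gt0 e0 (@ltr0Sn R 1)).
(* The endpoints join the null set because the derivative hypothesis covers only the open
   interval. *)
pose N' := N `|` [set a; b].
have mN' : measurable N' by apply: measurableU => //; apply: measurableU;
  exact: measurable_set1.
have N'0 : mu N' = 0%E.
  apply/negligibleP => //; apply: negligibleU; first exact/negligibleP.
  by apply: negligibleU; apply/negligibleP => //; exact: lebesgue_measure_set1.
have [U [oU NU Ud]] : exists U : set R, [/\ open U,
  N' `<=` U & (mu U < d%:E)%E].
  have N'y : (mu N' < +oo)%E by rewrite N'0 ltry.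
  have [U [oU NU Ud]] := lebesgue_regularity_outer mN' N'y d0.
  exists U; split=> //.
  have UE : U = (U `\` N') `|` N' by rewrite setUC setDUK.
  have : (mu U <= mu (U `\` N') + mu N')%E.
    rewrite {1}UE; apply: measureU2 => //.
    by apply: measurableD => //; exact: measurable_realfun.open_measurable.
  by rewrite N'0 adde0 => /le_lt_trans; exact.
(* Continuous induction: [P t] controls the increment over [a, t] up to the variation of h on
   finitely many ordered intervals inside U. At t = b that variation is below e / 2, since U has
   measure below d. *)
pose P (t : R) := exists (n : nat) (I : nat -> R * R),
  [/\ forall i, (i < n)%N -> [/\ a <= (I i).1,
    (I i).1 <= (I i).2 & (I i).2 <= t],
      forall i, (i < n)%N -> `](I i).1, (I i).2[ `<=` U,
      forall i j, (i < j < n)%N -> (I i).2 <= (I j).1 &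
      h t - h a <= (c + e1) * (t - a) + \sum_(i < n) `|h (I i).2 - h (I i).1|].
have Pa : P a.
  by exists 0%N, (fun=> (0, 0)); split=> //; rewrite !subrr mulr0 big_ord0
    addr0.
have Pext t s : a <= t -> t <= s -> P t ->
    `]t, s[ `<=` U \/ h s - h t <= (c + e1) * (s - t) -> P s.
  move=> at_ ts [n [I [I1 I2 I3 I4]]] [tsU|hst]; last first.
    exists n, I; split=> //.
      by move=> i /I1[x y z]; split=> //; exact: le_trans z ts.
    by lra.
  pose J i := if (i == n)%N then (t, s) else I i.
  exists n.+1, J; split.
  - move=> i; rewrite ltnS leq_eqVlt /J; case: eqP => //= _ /I1[x y z].
    by split=> //; exact: le_trans z ts.
  - by move=> i; rewrite ltnS leq_eqVlt /J; case: eqP => //= _; exact: I2.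
  - move=> i j /andP[ij jn]; have i_n : (i < n)%N by exact: leq_trans ij jn.
    rewrite /J (ltn_eqF i_n); case: (eqVneq j n) => [_|nj] /=.
      by have [_ _] := I1 i i_n.
    by apply: I3; rewrite ij ltn_neqAle nj.
  rewrite big_ord_recr /= /J eqxx.
  have -> : \sum_(i < n) `|h (if i == n :> nat then (t, s) else I i).2 -
     h (if i == n :> nat then (t, s) else I i).1| = \sum_(i < n) `|h (I i).2 - h
       (I i).1|.
    by apply: eq_bigr => i _; rewrite ltn_eqF.
  have := ler_norm (h s - h t).
  have := mulr_ge0 (addr_ge0 c0 (ltW e10)) (_ : 0 <= s - t);
    rewrite subr_ge0 => /(_ ts).
  lra.
(* The derivative at x only controls increments that start or end at x, whence the condition on t
   and s. *)
have loc x : a <= x <= b -> exists2 eta, 0 < eta & forall t s,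
    x - eta < t -> t <= s -> s < x + eta -> (t = x \/ s = x) ->
    `]t, s[ `<=` U \/ h s - h t <= (c + e1) * (s - t).
  move=> axb; have [xU|xU] := pselect (U x).
    have [eta /= eta0 H] := (nbhs_ballP _ _).1 (open_nbhs_nbhs (conj oU xU)).
    exists eta => // t s xt ts sx _; left => y /=; rewrite in_itv /= =>
      /andP[ty ys].
    by apply: H; rewrite /ball /= ltr_distlC; apply/andP; split; lra.
  have xN' : ~ N' x by move=> /NU.
  have axb' : a < x < b.
    move/andP: axb => [+ +]; rewrite !le_eqVlt =>
      /predU1P[ax|->] /predU1P[xb|->] //; exfalso; apply: xN'; right;
      rewrite /=; by [left|right|left].
  have [d' Dd' d'c] : exists2 d, is_derive x 1 h d & d <= c.
    apply: contrapT => H; apply: xN'; left; apply: hN => /= /(_ axb') //.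
  have [eta eta0 H] := (is_deriveP _ _ _).1 Dd' e1 e10.
  exists eta => // t s xt ts sx txs; right.
  case: txs => ?; subst.
    have := H s; rewrite ger0_norm ?subr_ge0 // => /(_ (_ : _ < _)) H'.
    have := H' ltac:(lra); rewrite ler_norml => /andP[_].
    rewrite /GRing.scale /= => {}H.
    have := ler_wpM2r (_ : 0 <= s - x) d'c; rewrite subr_ge0 => /(_ ts); lra.
  have := H t; rewrite ler0_norm ?subr_le0 // => /(_ (_ : _ < _)) H'.
  have := H' ltac:(lra); rewrite ler_norml => /andP[+ _].
  rewrite /GRing.scale /= => {}H.
  have := ler_wpM2r (_ : 0 <= x - t) d'c; rewrite subr_ge0 => /(_ ts); lra.
pose S := [set t | a <= t <= b /\ P t].
have Sa : S a by split=> //; rewrite lexx.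
have supS : has_sup S.
  by split; [exists a|exists b => x [/andP[]]].
pose s := sup S.
have as_ : a <= s by apply: sup_upper_bound.
have sb : s <= b by apply: ge_sup; [exists a|move=> x [/andP[]]].
have [eta eta0 H] := loc s (introT andP (conj as_ sb)).
have Ps : P s.
  have [t [/andP[at_ tb] Pt] ts] := sup_adherent eta0 supS.
  have ts' : t <= s by apply: sup_upper_bound => //; split=> //; rewrite at_.
  apply: (Pext t s) => //; apply: H => //; [|by right].
  by rewrite ltrDl.
have sb' : s = b.
  apply/eqP; rewrite eq_le sb leNgt; apply/negP => lsb.
  pose s' := Num.min b (s + eta / 2).
  have ss' : s < s' by rewrite /s' lt_min lsb ltrDl divr_gt0.
  have Ps' : P s'.
    apply: (Pext s s') => //; first exact: ltW.
    apply: H => //; [by rewrite ltrBlDl ltrDr|exact: ltW| |by left].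
    rewrite /s' gt_min; apply/orP; right; rewrite ltrD2l ltr_pdivrMr //; lra.
  have : s' <= s.
    apply: sup_upper_bound => //; split=> //.
    by rewrite (le_trans as_ (ltW ss')) /s' ge_min lexx.
  by rewrite leNgt ss'.
move: Ps; rewrite sb' => -[n [I [I1 I2 I3 I4]]].
apply: (le_trans I4).
have sI : \sum_(i < n) ((I i).2 - (I i).1) < d.
  by apply: (@sum_disjoint_itv_le U) => // i /[dup] /I1[_ x _] /I2.
have := Hd n (fun i => I i) (fun i => I1 i (ltn_ord i)) (trivIset_ordered_itv
  I3) sI.
have : e1 * (b - a) <= e / 2.
  rewrite /e1 invfM mulrA -mulrA ler_piMr ?divr_ge0 ?(ltW e0) //.
  by rewrite mulrC ler_pdivrMr // mul1r; lra.
lra.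
Qed.

End monotonicity.

(** * Lipschitz functions on an interval *)

Section lipschitz_functions.
Variable R : realType.
Notation mu := (@lebesgue_measure R).
Implicit Types (a b c k : R) (h f g : R -> R).

Lemma ae_imp (P Q : R -> Prop) : {ae mu, forall t, P t} ->
  (forall t, P t -> Q t) -> {ae mu, forall t, Q t}.
Proof. by move=> aP PQ; apply: negligibleS aP => t /= nQ /PQ. Qed.

Lemma ae_imp2 (P P' Q : R -> Prop) :
  {ae mu, forall t, P t} -> {ae mu, forall t, P' t} ->
  (forall t, P t -> P' t -> Q t) -> {ae mu, forall t, Q t}.
Proof.
move=> aP aP' PQ; apply: negligibleS (negligibleU aP aP') => t /= nQ.
by apply: contrapT => /not_orP[/contrapT p /contrapT p']; apply: nQ; exact: PQ.
Qed.

Definition lip a b h := exists2 K, 0 <= K &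
  forall s t, a <= s <= b -> a <= t <= b -> `|h s - h t| <= K * `|s - t|.

Lemma lipS a b a' b' h : a <= a' -> b' <= b -> lip a b h -> lip a' b' h.
Proof.
move=> aa bb [K K0 H]; exists K => // s t /andP[s1 s2] /andP[t1 t2].
by apply: H; rewrite ?(le_trans aa) //= ?(le_trans _ bb).
Qed.

Lemma eq_lip a b f g : (forall t, a <= t <= b -> f t = g t) -> lip a b f ->
  lip a b g.
Proof. by move=> fg [K K0 H]; exists K => // s t sab tab; rewrite -!fg //;
  exact: H. Qed.

Lemma lip_bounded a b h : lip a b h -> exists2 M, 0 <= M & forall t,
  a <= t <= b -> `|h t| <= M.
Proof.
move=> [K K0 H]; exists (`|h a| + K * `|a - b|).
  by rewrite addr_ge0 // mulr_ge0.
move=> t /[dup] tab /andP[at_ tb].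
have := H t a tab; rewrite lexx (le_trans at_ tb) => /(_ isT) {}H.
have : K * `|t - a| <= K * `|a - b|.
  rewrite ler_wpM2l // ger0_norm ?subr_ge0 // ler0_norm; lra.
have := ler_normD (h t - h a) (h a); rewrite subrK.
lra.
Qed.

Lemma lip_cst a b c : lip a b (fun=> c).
Proof. by exists 0 => // s t _ _; rewrite subrr normr0 mul0r. Qed.

Lemma lip_id a b : lip a b id.
Proof. by exists 1 => // s t _ _; rewrite mul1r. Qed.

Lemma lipD a b f g : lip a b f -> lip a b g -> lip a b (fun t => f t + g t).
Proof.
move=> [K K0 H] [L L0 G]; exists (K + L); first exact: addr_ge0.
move=> s t sab tab; rewrite mulrDl opprD addrACA (le_trans (ler_normD _ _)) //.
by rewrite lerD // ?H ?G.
Qed.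

Lemma lipN a b f : lip a b f -> lip a b (fun t => - f t).
Proof.
move=> [K K0 H]; exists K => // s t sab tab.
by rewrite -opprD normrN H.
Qed.

Lemma lipB a b f g : lip a b f -> lip a b g -> lip a b (fun t => f t - g t).
Proof. by move=> lf lg; apply: lipD => //; exact: lipN. Qed.

Lemma lipM a b f g : lip a b f -> lip a b g -> lip a b (fun t => f t * g t).
Proof.
move=> lf lg; have [M M0 fM] := lip_bounded lf; have [N N0 gN] :=
  lip_bounded lg.
move: lf lg => [K K0 H] [L L0 G]; exists (M * L + N * K).
  by rewrite addr_ge0 // mulr_ge0.
move=> s t sab tab.
have -> : f s * g s - f t * g t = f s * (g s - g t) + g t * (f s - f t) by ring.
rewrite (le_trans (ler_normD _ _)) // !normrM mulrDl -!mulrA.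
by rewrite lerD // ler_pM // ?fM ?gN ?H ?G.
Qed.

Lemma lipX a b f n : lip a b f -> lip a b (fun t => f t ^+ n).
Proof.
move=> lf; elim: n => [|n IH]; first exact: lip_cst.
by apply: eq_lip (lipM lf IH) => t _; rewrite exprS.
Qed.

Lemma lip_max0 a b f : lip a b f -> lip a b (fun t => Num.max (f t) 0).
Proof.
move=> [K K0 H]; exists K => // s t sab tab; apply: le_trans (H s t sab tab).
have := ler_norm (f s - f t); have := ler_norm (f t - f s); rewrite distrC.
by rewrite /Num.max ler_norml; case: ltP => h1; case: ltP => h2; lra.
Qed.

Lemma lip_inv a b f : (forall t, a <= t <= b -> 1 <= f t) -> lip a b f ->
  lip a b (fun t => (f t)^-1).
Proof.
move=> f1 [K K0 H]; exists K => // s t sab tab; apply: le_trans (H s t sab tab).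
have s1 := f1 _ sab; have t1 := f1 _ tab.
have s0 : 0 < f s by lra. have t0 : 0 < f t by lra.
have -> : (f s)^-1 - (f t)^-1 = (f t - f s) * (f s * f t)^-1.
  by field; rewrite !gt_eqF.
rewrite normrM distrC ler_piMr // gtr0_norm ?invr_gt0 ?mulr_gt0 //.
by rewrite invf_le1 ?mulr_gt0 //; rewrite -[1]mulr1 ler_pM.
Qed.

Lemma lip_derive_bounded a b h (d : R -> R) K :
  (forall t, a <= t <= b -> is_derive t 1 h (d t)) ->
  (forall t, a <= t <= b -> `|d t| <= K) -> lip a b h.
Proof.
move=> hd dK; exists `|K| => // s t.
wlog st : s t / s <= t.
  move=> H sab tab; have [st|/ltW ts] := leP s t; first exact: H.
  by rewrite distrC [`|s - t|]distrC; exact: H.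
move=> /andP[s1 s2] /andP[t1 t2].
rewrite distrC; have [||c cst ->] := @MVT_segment R h d s t st.
- move=> x; rewrite in_itv /= => /andP[x1 x2]; apply: hd; apply/andP; split;
  lra.
- apply: derivable_within_continuous => x; rewrite in_itv /= => /andP[x1 x2].
  apply: ex_derive; apply: hd; apply/andP; split; lra.
move: cst; rewrite in_itv /= => /andP[c1 c2].
have := dK c; rewrite (le_trans s1 c1) (le_trans c2 t2) => /(_ isT) dc.
by rewrite normrM [`|s - t|]distrC ler_wpM2r // (le_trans dc) // ler_norm.
Qed.

Lemma lip_abs_cont a b h : lip a b h -> abs_cont a b h.
Proof.
move=> [K K0 H] e e0; exists (e / (K + 1)).
  by rewrite divr_gt0 // ltr_wpDl.
move=> n I HI _; rewrite ltr_pdivlMr ?ltr_wpDl // => sI.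
apply: le_lt_trans sI; rewrite mulr_suml; apply: ler_sum => i _.
have [x y z] := HI i.
rewrite (le_trans (H _ _ _ _)) ?y ?x ?z ?(le_trans y z) ?(le_trans x y) //.
by rewrite ger0_norm ?subr_ge0 // mulrC ler_wpM2l ?subr_ge0 // lerDl.
Qed.

(** Subtracting [c * t] reduces to slope 0, which frees c from the sign condition of
    [ac_slope_le]. *)
Lemma lip_slope_le a b c h : a <= b -> lip a b h ->
  {ae mu, forall t, a < t < b -> exists2 d, is_derive t 1 h d & d <= c} ->
  h b - h a <= c * (b - a).
Proof.
move=> ab lh dh.
have l' : lip a b (fun t => h t - c * t).
  by apply: lipB => //; apply: lipM; [exact: lip_cst|exact: lip_id].
have := @ac_slope_le R a b 0 _ ab (lexx 0) (lip_abs_cont l').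
rewrite mul0r => H.
have : h b - c * b - (h a - c * a) <= 0.
  apply: H; refine (ae_imp dh _) => t H /H[d hd dc]; exists (d - c); last
    by rewrite subr_le0.
  apply: (@is_deriveB _ _ _ h (fun t => c * t)) => //.
  have := @is_deriveZ _ _ _ id c t 1 1 (is_derive_id _ _).
  by rewrite [_%:A]mulr1.
lra.
Qed.

Lemma lip_slope_ge a b c h : a <= b -> lip a b h ->
  {ae mu, forall t, a < t < b -> exists2 d, is_derive t 1 h d & c <= d} ->
  c * (b - a) <= h b - h a.
Proof.
move=> ab lh dh.
have := @lip_slope_le a b (- c) (fun t => - h t) ab (lipN lh) => H.
suff : - h b - - h a <= - c * (b - a) by lra.
apply: H; refine (ae_imp dh _) => t H /H[d hd dc]; exists (- d); last
  by rewrite lerN2.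
exact: is_deriveN.
Qed.

Lemma abs_cont_sub a b a' b' h : a <= a' -> b' <= b -> abs_cont a b h ->
  abs_cont a' b' h.
Proof.
move=> aa bb ac e e0; have [d d0 H] := ac e e0; exists d => // n I HI tI sI.
by apply: H => // i; have [x y z] := HI i; split=> //; [exact: le_trans x|
  exact: le_trans bb].
Qed.

Lemma abs_contN a b h : abs_cont a b h -> abs_cont a b (fun t => - h t).
Proof.
move=> ac e e0; have [d d0 H] := ac e e0; exists d => // n I HI tI sI.
by under eq_bigr do rewrite -opprD normrN; exact: H.
Qed.

(** The passage from solutions, absolutely continuous by definition, to a class that is closed under
    the products, powers and positive parts occurring in V. The slope bound is applied to h and to -
    h. *)
Lemma abs_cont_lip a b h K : 0 <= K -> abs_cont a b h ->
  {ae mu, forall t, a < t < b -> exists2 d, is_derive t 1 h d & `|d| <= K} ->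
  lip a b h.
Proof.
move=> K0 ac dh; exists K => // s t.
wlog st : s t / s <= t.
  move=> H sab tab; have [st|/ltW ts] := leP s t; first exact: H.
  by rewrite distrC [`|s - t|]distrC; exact: H.
move=> /andP[s1 s2] /andP[t1 t2].
rewrite distrC [`|s - t|]distrC [`|t - s|]ger0_norm ?subr_ge0 // ler_norml.
have ac' := abs_cont_sub s1 t2 ac.
apply/andP; split.
  have := ac_slope_le st K0 (abs_contN ac'); rewrite -opprD -lerN2 opprK; apply.
  refine (ae_imp dh _) => x H /andP[x1 x2]; have [|d hd] := H; first
    by apply/andP; split; lra.
  rewrite ler_norml => /andP[dK _]; exists (- d); last by rewrite lerNl.
  exact: is_deriveN.
apply: ac_slope_le => //.
refine (ae_imp dh _) => x H /andP[x1 x2]; have [|d hd] := H; first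
  by apply/andP; split; lra.
by rewrite ler_norml => /andP[_ dK]; exists d.
Qed.

(** After the last instant at which h is at least c, its slope is at least k >= 0, so h cannot end
    below c; without such an instant h climbs at rate k all along. It serves with k = 0 to keep a
    quantity above a level, and with k > 0 to drive it up to one. *)
Lemma barrier a b c k h : a <= b -> 0 <= k -> lip a b h ->
  {ae mu, forall t, a < t < b -> exists2 d, is_derive t 1 h d & h t < c ->
    k <= d} ->
  Num.min c (h a + k * (b - a)) <= h b.
Proof.
move=> ab k0 lh dh; rewrite leNgt; apply/negP; rewrite lt_min => /andP[hbc hbk].
pose S := [set t | a <= t <= b /\ c <= h t].
have last t0 : a <= t0 <= b -> (forall t, t0 < t <= b -> h t < c) ->
    h t0 + k * (b - t0) <= h b.
  move=> /andP[at0 t0b] H; rewrite -lerBrDl.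
  apply: lip_slope_ge => //; first exact: lipS lh.
  refine (ae_imp dh _) => t G /andP[t1 t2]; have [|d hd dk] := G.
    by rewrite t2 (le_lt_trans at0 t1).
  by exists d => //; apply: dk; apply: H; rewrite t1 ltW.
have [S0|/set0P/negP/negPn/eqP S0] := pselect (S !=set0); last first.
  have := last a; rewrite lexx ab => /(_ isT) G.
  suff /G : forall t, a < t <= b -> h t < c by rewrite leNgt hbk.
  move=> t /andP[t1 t2]; rewrite ltNge; apply/negP => ct.
  by have : S t; [split=> //; rewrite (ltW t1)|rewrite S0].
have hS : has_sup S by split=> //; exists b => x [/andP[]].
pose s := sup S.
have as_ : a <= s.
  have [x [/andP[ax xb] cx]] := S0; apply: (le_trans ax).
  by apply: sup_upper_bound => //; split=> //; rewrite ax.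
have sb : s <= b by apply: ge_sup => // x [/andP[]].
have cs : c <= h s.
  have [K K0 H] := lh.
  apply/ler_addgt0Pr => e e0.
  have [|t [/andP[at_ tb] ct] ts] := @sup_adherent _ S (e / (K + 1)) _ hS.
    by rewrite divr_gt0 // ltr_wpDl.
  have ts' : t <= s by apply: sup_upper_bound => //; split=> //; rewrite at_.
  have := H t s; rewrite at_ tb as_ sb => /(_ isT isT).
  rewrite ler_norml => /andP[_]; rewrite ler0_norm ?subr_le0 // opprB => G.
  have : K * (s - t) <= e.
    apply: (@le_trans _ _ ((K + 1) * (s - t))).
      by rewrite ler_wpM2r ?subr_ge0 // lerDl.
    rewrite mulrC -ler_pdivlMr ?ltr_wpDl //.
    by move: ts; rewrite -/s; lra.
  lra.
have := last s; rewrite as_ sb => /(_ isT) G.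
have : h s + k * (b - s) <= h b.
  apply: G => t /andP[st tb]; rewrite ltNge; apply/negP => ct.
  have : t <= s by apply: sup_upper_bound => //; split=> //;
    rewrite tb andbT (le_trans as_) // ltW.
  by rewrite leNgt st.
have := mulr_ge0 k0 (_ : 0 <= b - s); rewrite subr_ge0 => /(_ sb).
lra.
Qed.

End lipschitz_functions.

(** * The functional V *)

Section functional.
Variable R : realType.
Notation mu := (@lebesgue_measure R).
Implicit Types (p q : R -> R) (phi psi : R -> plane R) (s t th r M : R).

Lemma enorm_ge0 (v : plane R) : 0 <= enorm v.
Proof. exact: sqrtr_ge0. Qed.

Lemma enorm_sq (v : plane R) : enorm v ^+ 2 = v.1 ^+ 2 + v.2 ^+ 2.
Proof. by rewrite sqr_sqrtr // addr_ge0 // sqr_ge0. Qed.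

Lemma enorm_ge1 (v : plane R) : `|v.1| <= enorm v.
Proof. by rewrite -sqrtr_sqr ler_wsqrtr // lerDl sqr_ge0. Qed.

Lemma enorm_ge2 (v : plane R) : `|v.2| <= enorm v.
Proof. by rewrite -sqrtr_sqr ler_wsqrtr // lerDr sqr_ge0. Qed.

Lemma enorm_le_sum (v : plane R) : enorm v <= `|v.1| + `|v.2|.
Proof.
rewrite -[leRHS]ger0_norm ?addr_ge0 // -sqrtr_sqr ler_wsqrtr //.
rewrite sqrrD !real_normK ?num_real // lerD2r lerDl.
by rewrite mulrn_wge0 // mulr_ge0.
Qed.

Lemma enorm_leP (v : plane R) M : 0 <= M -> v.1 ^+ 2 + v.2 ^+ 2 <= M ^+ 2 ->
  enorm v <= M.
Proof. by move=> M0 H; rewrite -(ger0_norm M0) -sqrtr_sqr ler_wsqrtr. Qed.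

Lemma hnorm_le phi M : (forall th, -1 <= th <= 0 -> enorm (phi th) <= M) ->
  hnorm phi <= M.
Proof.
move=> H; apply: ge_sup.
  by exists (enorm (phi 0)); exists 0 => //=;
    rewrite in_itv /= lexx oppr_le0 ler01.
by move=> _ [th /= + <-]; rewrite in_itv /=; exact: H.
Qed.

Lemma hnorm_ge phi M th : (forall th, -1 <= th <= 0 -> enorm (phi th) <= M) ->
  -1 <= th <= 0 -> enorm (phi th) <= hnorm phi.
Proof.
move=> H tht; apply: sup_upper_bound; last by exists th => //=; rewrite in_itv.
split; first by exists (enorm (phi th)); exists th => //=; rewrite in_itv.
by exists M => _ [x /= + <-]; rewrite in_itv /=; exact: H.
Qed.

(** Retraction of the line onto [-1, 0]; precomposing with it makes a history continuous on the
    whole line. *)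
Definition clamp t : R := Num.max (-1) (Num.min t 0).

Lemma clamp_in t : -1 <= clamp t <= 0.
Proof. by rewrite le_max lexx /= ge_max oppr_le0 ler01 ge_min lexx orbT. Qed.

Lemma clamp_id t : -1 <= t <= 0 -> clamp t = t.
Proof. by move=> /andP[t1 t0]; rewrite /clamp (min_idPl t0) (max_idPr t1). Qed.

Lemma within_comp_continuous (A : set R) phi (c : R -> R) : {within A,
  continuous phi} ->
  continuous c -> (forall t, A (c t)) -> continuous (phi \o c).
Proof.
move=> hphi cc At t.
have : phi x @[x --> within A (nbhs (c t))] --> phi (c t).
  have := hphi (c t).
  by rewrite /continuous_at /= /prop_for /= nbhs_subspace_in.
apply: cvg_trans => U HU.
have H : nbhs (c t) (fun x => A x -> U (phi x)) by exact: HU.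
have K : nbhs t (fun x => A (c x) -> U (phi (c x))) by exact: (cc t _ H).
have : nbhs t (fun x => U (phi (c x))) by apply: filterS K => x; apply.
exact.
Qed.

Lemma history_clamp phi : history phi -> continuous (phi \o clamp).
Proof.
move=> hphi; apply: within_comp_continuous hphi _ _ => [|t]; last first.
  by rewrite /= in_itv /= clamp_in.
have c0 : continuous ((id : R^o -> R^o) \min (cst 0 : R^o -> R^o)).
  by move=> x; apply: continuous_min => /=; [exact: cvg_id|exact: cvg_cst].
by move=> x; apply: (@continuous_max R R^o (cst (-1)) _ x); [exact: cvg_cst|
  exact: c0].
Qed.

Lemma continuous_shift t : continuous (fun s : R => t + s).
Proof. by move=> s; apply: continuousD; [exact: cvg_cst|exact: cvg_id]. Qed.

Definition trj p q : R -> plane R := fun t => (p t, q t).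

Lemma history_trj phi : history phi -> exists p q,
  [/\ continuous p, continuous q & forall th, -1 <= th <= 0 -> phi th = (p th,
    q th)].
Proof.
move=> /history_clamp c; exists (fun t => (phi (clamp t)).1), (fun t =>
  (phi (clamp t)).2).
split.
- by move=> t; apply: (@cvg_comp _ _ _ (phi \o clamp) fst _ _ _ (c t));
  exact: cvg_fst.
- by move=> t; apply: (@cvg_comp _ _ _ (phi \o clamp) snd _ _ _ (c t));
  exact: cvg_snd.
- by move=> th /clamp_id ->; case: (phi th).
Qed.

Lemma trj_continuous p q : continuous p -> continuous q -> continuous (trj p q).
Proof. by move=> cp cq t; exact: (cvg_pair (cp t) (cq t)). Qed.

Lemma segment_history p q t : continuous p -> continuous q ->
  history (segment (trj p q) t).
Proof.
move=> cp cq; apply: continuous_subspaceT => th.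
apply: (@continuous_comp _ _ _ (fun s => t + s) (trj p q)).
  exact: continuous_shift.
exact: trj_continuous.
Qed.

Lemma history_bounded phi : history phi ->
  exists2 M, 0 <= M & forall th, -1 <= th <= 0 -> enorm (phi th) <= M.
Proof.
move=> /history_trj[p [q [cp cq pq]]].
have bnd (h : R -> R) : continuous h -> exists2 M : R, 0 <= M & forall th,
  -1 <= th <= 0 -> `|h th| <= M.
  move=> ch; have [||c _ H] := @EVT_max R (fun x => `|h x|) (-1) 0.
  - by rewrite oppr_le0.
  - by apply: continuous_subspaceT => x; apply: continuous_comp; [exact: ch|
    exact: norm_continuous].
  by exists `|h c| => // th tht; apply: H; rewrite in_itv.
have [M M0 HM] := bnd p cp; have [N N0 HN] := bnd q cq.
exists (M + N); first exact: addr_ge0.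
by move=> th tht; rewrite pq // (le_trans (enorm_le_sum _)) // lerD /= ?HM ?HN.
Qed.

Lemma hnorm_ge_history phi th : history phi -> -1 <= th <= 0 ->
  enorm (phi th) <= hnorm phi.
Proof. by move=> /history_bounded[M _ H]; exact: hnorm_ge H. Qed.

Lemma hnorm_ge0 phi : history phi -> 0 <= hnorm phi.
Proof.
move=> h; apply: le_trans (enorm_ge0 (phi 0)) (hnorm_ge_history h _).
by rewrite lexx oppr_le0 ler01.
Qed.

Lemma g_ge0 s t : 0 <= g_ s t.
Proof. by rewrite /g_ mulr_ge0 ?sqr_ge0. Qed.

Lemma g_le s t : s = 1 \/ s = -1 -> g_ s t <= t ^+ 2 / 2.
Proof.
move=> hs; rewrite /g_ ler_wpM2r //.
have -> : t ^+ 2 = (s * t) ^+ 2 by case: hs => ->;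
  rewrite ?mul1r ?mulN1r ?sqrrN.
by rewrite /Num.max; case: ltP => _; rewrite ?expr0n ?sqr_ge0.
Qed.

Lemma g_lip s t r M : s = 1 \/ s = -1 -> `|t| <= M -> `|r| <= M ->
  g_ s t <= g_ s r + M * `|t - r|.
Proof.
move=> hs tM rM.
have E : `|s * t - s * r| = `|t - r|.
  by rewrite -mulrBr normrM; case: hs => ->; rewrite ?normrN normr1 mul1r.
have E1 : `|s * t| = `|t| by rewrite normrM; case: hs => ->;
  rewrite ?normrN normr1 mul1r.
have E2 : `|s * r| = `|r| by rewrite normrM; case: hs => ->;
  rewrite ?normrN normr1 mul1r.
rewrite /g_ -E; rewrite -E1 in tM; rewrite -E2 in rM.
move: (s * t) (s * r) tM rM => {s t r hs E E1 E2} t r; rewrite !ler_norml =>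
  /andP[t1 t2] /andP[r1 r2].
have := ler_norm (t - r); have := normr_ge0 (t - r).
move: (`|t - r|) => d d0 dd.
rewrite /Num.max -subr_ge0; case: ltP => h1; case: ltP => h2; nra.
Qed.

(** The three added terms are at most M^2 / 2 each and the two subtracted ones are nonnegative.
    Besides the upper bound on V, this shows that the supremum defining V is taken over a bounded
    set. *)
Lemma F_le s phi th M : s = 1 \/ s = -1 -> (forall th, -1 <= th <= 0 ->
  enorm (phi th) <= M) ->
  -1 <= th <= 0 -> F_ s phi th <= 3 / 2 * M ^+ 2.
Proof.
move=> hs H tht.
have H0 := H 0; rewrite lexx oppr_le0 ler01 in H0.
have M0 := le_trans (enorm_ge0 _) (H0 isT).
have h1 : (phi th).1 ^+ 2 <= M ^+ 2.
  rewrite -[leLHS]real_normK ?num_real // ler_sqr ?nnegrE //.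
  by rewrite (le_trans (enorm_ge1 _)) // H.
have h2 : (phi 0).2 ^+ 2 <= M ^+ 2.
  rewrite -[leLHS]real_normK ?num_real // ler_sqr ?nnegrE //.
  by rewrite (le_trans (enorm_ge2 _)) // H0.
rewrite /F_ /=.
have := g_le (phi th).1 hs; have := g_le (phi 0).2 hs; have :=
  g_ge0 s (phi th).2.
have : 0 <= \int[mu]_(r in `[th, 0]) ((phi r).1 ^+ 2).
  by apply: Rintegral_ge0 => x _; exact: sqr_ge0.
lra.
Qed.

Lemma V_le phi M :
  (forall s th, s = 1 \/ s = -1 -> -1 <= th <= 0 -> F_ s phi th <= M) ->
    V_ phi <= M.
Proof.
move=> H; apply: ge_sup.
  exists (F_ 1 phi 0); exists 1; first by left.
  by exists 0 => //=; rewrite in_itv /= lexx oppr_le0 ler01.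
by move=> _ [s hs] [th /= + <-]; rewrite in_itv /=; exact: H.
Qed.

Lemma F_le_V s phi th : history phi -> s = 1 \/ s = -1 -> -1 <= th <= 0 ->
  F_ s phi th <= V_ phi.
Proof.
move=> /history_bounded[M _ HM] hs tht; apply: sup_upper_bound; last first.
  by exists s => //; exists th => //=; rewrite in_itv.
split; first by exists (F_ s phi th); exists s => //; exists th => //=;
  rewrite in_itv.
exists (3 / 2 * M ^+ 2) => _ [s' hs'] [th' /= + <-]; rewrite in_itv /= => tht'.
exact: F_le.
Qed.

Lemma eq_V phi psi : (forall th, -1 <= th <= 0 -> phi th = psi th) ->
  V_ phi = V_ psi.
Proof.
move=> H; have FE s th : -1 <= th <= 0 -> F_ s phi th = F_ s psi th.
  move=> tht; rewrite /F_ /= !H //; last by rewrite lexx oppr_le0 ler01.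
  congr (_ - _); apply: eq_Rintegral => x; rewrite inE /= in_itv /= =>
    /andP[x1 x2].
  by rewrite H // x2 andbT; move/andP: tht => [/le_trans -> //].
congr sup; apply/seteqP; split=> _ [s hs] [th /= + <-]; rewrite in_itv /= =>
  tht;
  by exists s => //; exists th; rewrite /= ?in_itv //= FE.
Qed.

Lemma eq_E phi psi : (forall th, -1 <= th <= 0 -> phi th = psi th) ->
  E_ phi = E_ psi.
Proof. by move=> H; rewrite /E_ (eq_V H) H // lexx oppr_le0 ler01. Qed.

Lemma eq_f phi psi u : (forall th, -1 <= th <= 0 -> phi th = psi th) ->
  f_ phi u = f_ psi u.
Proof. by move=> H; rewrite /f_ (eq_E H) (eq_V H) H // lexx oppr_le0 ler01. Qed.

Lemma g_sum t : exists2 s, s = 1 \/ s = -1 & g_ s t = t ^+ 2 / 2.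
Proof.
have [t0|t0] := leP 0 t.
  by exists 1; [left|rewrite /g_ mul1r (max_idPl t0)].
exists (-1); first by right.
by rewrite /g_ mulN1r (max_idPl _) ?sqrrN // oppr_ge0 ltW.
Qed.

(** At th = 0 the two [g_] terms in q cancel and the integral vanishes; [g_sum] provides the sign s
    for which the remaining [g_] term is p^2 / 2. *)
Lemma C_le_V phi : history phi -> ((phi 0).1 ^+ 2 + (phi 0).2 ^+ 2) / 2 <= V_
  phi.
Proof.
move=> h; have [s hs gs] := g_sum (phi 0).1.
have := @F_le_V s phi 0 h hs; rewrite lexx oppr_le0 ler01 => /(_ isT).
rewrite /F_ /= gs set_itv1 Rintegral_set1; lra.
Qed.

Lemma E_ge0 phi : history phi -> 0 <= E_ phi.
Proof. by move=> h; rewrite subr_ge0 C_le_V. Qed.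

Lemma V_ge0 phi : history phi -> 0 <= V_ phi.
Proof.
move=> h; apply: le_trans (C_le_V h); rewrite divr_ge0 //.
by rewrite addr_ge0 // sqr_ge0.
Qed.

Lemma V_upper phi M : (forall th, -1 <= th <= 0 -> enorm (phi th) <= M) ->
  V_ phi <= 3 / 2 * M ^+ 2.
Proof. by move=> H; apply: V_le => s th hs tht; exact: F_le. Qed.

Lemma slope_le (a b c : R) (h d : R -> R) : a <= b ->
  (forall t, a <= t <= b -> is_derive t 1 h (d t) /\ d t <= c) ->
    h b - h a <= c * (b - a).
Proof.
move=> ab H; have [||x xab ->] := @MVT_segment R h d a b ab.
- by move=> x; rewrite in_itv /= => /andP[x1 x2]; apply: (H x _).1;
  rewrite !ltW.
- by apply: derivable_within_continuous => x; rewrite in_itv /= => /H[] [].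
by rewrite ler_wpM2r ?subr_ge0 //; apply: (H x _).2.
Qed.

(* Segments at times t >= 0 only involve times at least -1; any bound below -1
   would do in place of -2. *)
Definition primitive_sq p (P : R -> R) := forall t, -2 < t ->
  is_derive t 1 P (p t ^+ 2).

Lemma primitive_sq_ex p : continuous p -> exists P, primitive_sq p P.
Proof.
move=> cp; have c2 : continuous (fun t => p t ^+ 2 : R).
  by move=> t; apply: (@continuous_comp _ _ _ p (fun x => x ^+ 2));
    [exact: cp|exact: exprn_continuous].
exists (fun t => \int[mu]_(r in `[-2, t]) (p r ^+ 2)) => t t2.
have [] := @continuous_FTC1_closed R (fun t =>
  p t ^+ 2) (-2) t (t + 1) _ _ t2 (c2 t).
- by rewrite ltrDl.
- apply: continuous_compact_integrable; first exact: segment_compact.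
  exact: continuous_subspaceT.
by move=> d; rewrite derive1E => e; split.
Qed.

Lemma int_sq p P th t : continuous p -> primitive_sq p P -> -1 <= th <= 0 ->
  0 <= t ->
  \int[mu]_(r in `[th, 0]) (p (t + r) ^+ 2) = P t - P (t + th).
Proof.
move=> cp hP /andP[th1]; rewrite le_eqVlt => /predU1P[->|th0] t0.
  by rewrite addr0 subrr set_itv1 Rintegral_set1.
have D r : -1 <= r -> is_derive r 1 (fun r => P (t + r)) (p (t + r) ^+ 2).
  move=> r1; rewrite -[X in is_derive _ _ _ X]mulr1.
  apply: (@is_derive1_comp R P (fun r => t + r)); first by apply: hP; lra.
  have := @is_deriveD _ _ _ (cst t) id r 1 0 1 (is_derive_cst _ _ _)
    (is_derive_id _ _).
  by rewrite add0r.
have C r : -1 <= r -> {for r, continuous (fun r => P (t + r))}.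
  move=> r1; apply: differentiable_continuous; apply/derivable1_diffP.
  by apply: ex_derive; exact: D.
rewrite /Rintegral (@continuous_FTC2 _ _ (fun r =>
  P (t + r)) _ _ th0) ?addr0 //.
- apply: continuous_subspaceT => x.
  apply: (@continuous_comp _ _ _ (fun r => p (t + r)) (fun x => x ^+ 2));
    last exact: exprn_continuous.
  apply: (@continuous_comp _ _ _ (fun r => t + r) p); last exact: cp.
  exact: continuous_shift.
- split.
  + by move=> x; rewrite in_itv /= => /andP[x1 _]; apply: ex_derive; apply: D;
    lra.
  + by apply: cvg_at_right_filter; apply: C.
  + by apply: cvg_at_left_filter; apply: C; rewrite oppr_le0.
- move=> x; rewrite in_itv /= => /andP[x1 _].
  by rewrite derive1E; apply: derive_val; apply: D; lra.
Qed.

(** A term of V written with the absolute past time r instead of the offset th. For fixed r it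
    depends on t only through q t and P t, so it can be differentiated in t although the history is
    merely continuous. *)
Definition F_trj p q (P : R -> R) s t r :=
  g_ s (p r) + q t ^+ 2 / 2 + g_ s (q t) - g_ s (q r) - (P t - P r).

Lemma F_segment p q P s t th : continuous p -> primitive_sq p P ->
  -1 <= th <= 0 -> 0 <= t ->
  F_ s (segment (trj p q) t) th = F_trj p q P s t (t + th).
Proof. by move=> cp hP tht t0; rewrite /F_ /F_trj /segment /= (int_sq cp hP) //
  addr0. Qed.

End functional.

(** * Lipschitz estimates *)

Section lipschitz_estimates.
Variable R : realType.
Implicit Types (phi psi : R -> plane R) (r : R).

Lemma enormN (v : plane R) : enorm (- v) = enorm v.
Proof. by rewrite /enorm /= !sqrrN. Qed.

Lemma hnorm_sub phi psi th : history phi -> history psi -> -1 <= th <= 0 ->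
  enorm (phi th - psi th) <= hnorm (phi - psi).
Proof.
move=> /history_bounded[M _ HM] /history_bounded[N _ HN] tht.
apply: (@hnorm_ge R (phi - psi) (M + N + (M + N)) th) tht => t tht.
rewrite (le_trans (enorm_le_sum _)) // lerD // (le_trans (ler_normB _ _)) //
  lerD //.
- by rewrite (le_trans (enorm_ge1 _)) // HM.
- by rewrite (le_trans (enorm_ge1 _)) // HN.
- by rewrite (le_trans (enorm_ge2 _)) // HM.
- by rewrite (le_trans (enorm_ge2 _)) // HN.
Qed.

Lemma hnormC phi psi : hnorm (phi - psi) = hnorm (psi - phi).
Proof.
by congr sup; apply/seteqP; split=> _ [th /= tht <-]; exists th => //=;
  rewrite -enormN opprB.
Qed.

Lemma hnorm_sub_ge0 phi psi : history phi -> history psi ->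
  0 <= hnorm (phi - psi).
Proof.
move=> h1 h2; apply: le_trans (enorm_ge0 _) (hnorm_sub h1 h2 (_ : -1 <= 0 <=
  0)).
by rewrite lexx oppr_le0 ler01.
Qed.

(** Terms with the same s and th are compared. The 6 collects r from each of the four quadratic
    terms and 2 r from the integral, whose window has length at most 1. *)
Lemma V_lip_le phi psi r : history phi -> history psi -> hnorm phi <= r ->
  hnorm psi <= r ->
  V_ phi - V_ psi <= 6 * r * hnorm (phi - psi).
Proof.
move=> hp hs pr sr; rewrite lerBlDl; apply: V_le => s th hs' tht.
have r0 : 0 <= r := le_trans (hnorm_ge0 hp) pr.
set d := hnorm (phi - psi); have d0 : 0 <= d by exact: hnorm_sub_ge0.
have z01 : -1 <= (0 : R) <= 0 by rewrite lexx oppr_le0 ler01.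
have b1 t : -1 <= t <= 0 -> `|(phi t).1| <= r.
  by move=> h; rewrite (le_trans (enorm_ge1 _)) // (le_trans (hnorm_ge_history
    hp h)).
have b2 t : -1 <= t <= 0 -> `|(phi t).2| <= r.
  by move=> h; rewrite (le_trans (enorm_ge2 _)) // (le_trans (hnorm_ge_history
    hp h)).
have b3 t : -1 <= t <= 0 -> `|(psi t).1| <= r.
  by move=> h; rewrite (le_trans (enorm_ge1 _)) // (le_trans (hnorm_ge_history
    hs h)).
have b4 t : -1 <= t <= 0 -> `|(psi t).2| <= r.
  by move=> h; rewrite (le_trans (enorm_ge2 _)) // (le_trans (hnorm_ge_history
    hs h)).
have d1 t : -1 <= t <= 0 -> `|(phi t).1 - (psi t).1| <= d.
  by move=> h; apply: le_trans (hnorm_sub hp hs h);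
    exact: (enorm_ge1 (phi t - psi t)).
have d2 t : -1 <= t <= 0 -> `|(phi t).2 - (psi t).2| <= d.
  by move=> h; apply: le_trans (hnorm_sub hp hs h);
    exact: (enorm_ge2 (phi t - psi t)).
apply: (@le_trans _ _ (F_ s psi th + 6 * r * d)); last first.
  by rewrite lerD2r; exact: F_le_V.
have sqb (x y : R) : `|x| <= r -> `|y| <= r -> `|x - y| <= d ->
  x ^+ 2 <= y ^+ 2 + 2 * r * d.
  move=> xr yr xyd.
  have : `|(x - y) * (x + y)| <= d * (2 * r).
    rewrite normrM ler_pM // (le_trans (ler_normD _ _)) //; lra.
  by have := ler_norm ((x - y) * (x + y)); lra.
have gb (x y : R) : `|x| <= r -> `|y| <= r -> `|x - y| <= d ->
  g_ s x <= g_ s y + r * d.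
  move=> xr yr xyd; have := g_lip hs' xr yr.
  have := ler_wpM2l r0 xyd; lra.
have g1 := gb _ _ (b1 _ tht) (b3 _ tht) (d1 _ tht).
have g2 := gb _ _ (b2 _ z01) (b4 _ z01) (d2 _ z01).
have d2' : `|(psi th).2 - (phi th).2| <= d by rewrite distrC d2.
have g3 := gb _ _ (b4 _ tht) (b2 _ tht) d2'.
have q2 := sqb _ _ (b2 _ z01) (b4 _ z01) (d2 _ z01).
have [p [q [cp cq pq]]] := history_trj hp; have [P hP] := primitive_sq_ex cp.
have [p' [q' [cp' cq' pq']]] := history_trj hs; have [P' hP'] :=
  primitive_sq_ex cp'.
have I1 : \int[lebesgue_measure]_(r in `[th, 0]) ((phi r).1 ^+ 2) = P 0 - P th.
  rewrite -[in RHS](add0r th) -(int_sq cp hP tht (lexx _)).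
  apply: eq_Rintegral => x; rewrite inE /= in_itv /= => /andP[x1 x2].
  by rewrite add0r pq //= x2 andbT; case/andP: tht => /le_trans -> //.
have I2 : \int[lebesgue_measure]_(r in `[th, 0]) ((psi r).1 ^+ 2) = P' 0 - P'
  th.
  rewrite -[in RHS](add0r th) -(int_sq cp' hP' tht (lexx _)).
  apply: eq_Rintegral => x; rewrite inE /= in_itv /= => /andP[x1 x2].
  by rewrite add0r pq' //= x2 andbT; case/andP: tht => /le_trans -> //.
(* The two integrals are compared through the derivative of P' - P. *)
have I3 : (P' 0 - P 0) - (P' th - P th) <= 2 * r * d * (0 - th).
  case/andP: (tht) => t1 t2.
  apply: (@slope_le _ _ _ _ (fun t => P' t - P t) (fun t =>
    p' t ^+ 2 - p t ^+ 2)) => // t /andP[t3 t4].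
  have t5 : -1 <= t <= 0 by rewrite t4 (le_trans t1).
  split; first by apply: (@is_deriveB _ _ _ P' P); [apply: hP'|apply: hP]; lra.
  rewrite lerBlDl; apply: sqb.
  - by have := b3 t t5; rewrite pq'.
  - by have := b1 t t5; rewrite pq.
  - by have := d1 t t5; rewrite pq // pq' // distrC.
have : 2 * r * d * (0 - th) <= 2 * r * d.
  rewrite ler_piMr ?mulr_ge0 //; case/andP: tht; lra.
rewrite /F_ /= I1 I2; lra.
Qed.

Lemma V_lip phi psi r : history phi -> history psi -> hnorm phi <= r ->
  hnorm psi <= r ->
  `|V_ phi - V_ psi| <= 6 * r * hnorm (phi - psi).
Proof.
move=> hp hs pr sr; rewrite ler_norml lerNl opprB V_lip_le // andbT.
by rewrite hnormC V_lip_le.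
Qed.

Lemma V_lipschitz_functional : lipschitz_functional (@V_ R).
Proof.
move=> B BH [r Hr]; exists (6 * r) => y z By Bz.
by apply: V_lip; [exact: BH|exact: BH|exact: Hr|exact: Hr].
Qed.

Section bounded_lip.
Variables (T : Type) (B : set T) (D : T -> T -> R).

(** A product of Lipschitz functions need not be Lipschitz unless the factors are bounded, so a
    bound is carried along; [f_] is then treated as a polynomial in p, q, a, b and V. *)
Definition bounded_lip (x : T -> R) := exists M K, [/\ 0 <= M, 0 <= K &
  forall y z, B y -> B z -> `|x y| <= M /\ `|x y - x z| <= K * D y z].

Lemma bounded_lip_cst (c : R) : bounded_lip (fun=> c).
Proof. by exists `|c|, 0; split=> // y z By Bz; rewrite subrr normr0 mul0r. Qed.

Lemma bounded_lipD f g : bounded_lip f -> bounded_lip g ->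
  bounded_lip (fun y => f y + g y).
Proof.
move=> [M [K [M0 K0 H]]] [N [L [N0 L0 G]]]; exists (M + N), (K + L).
split; try exact: addr_ge0.
move=> y z By Bz; have [h1 h2] := H y z By Bz; have [g1 g2] := G y z By Bz.
split; first by rewrite (le_trans (ler_normD _ _)) // lerD.
by rewrite mulrDl opprD addrACA (le_trans (ler_normD _ _)) // lerD.
Qed.

Lemma bounded_lipM f g : bounded_lip f -> bounded_lip g ->
  bounded_lip (fun y => f y * g y).
Proof.
move=> [M [K [M0 K0 H]]] [N [L [N0 L0 G]]]; exists (M * N), (M * L + N * K).
split; [exact: mulr_ge0|by rewrite addr_ge0 // mulr_ge0|].
move=> y z By Bz; have [h1 h2] := H y z By Bz; have [g1 g2] := G y z By Bz.
have [g3 _] := G z y Bz By.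
split; first by rewrite normrM ler_pM.
have -> : f y * g y - f z * g z = f y * (g y - g z) + g z * (f y - f z) by ring.
rewrite (le_trans (ler_normD _ _)) // !normrM mulrDl -!mulrA.
by rewrite lerD // ler_pM.
Qed.

Lemma bounded_lipN f : bounded_lip f -> bounded_lip (fun y => - f y).
Proof.
move=> [M [K [M0 K0 H]]]; exists M, K; split=> // y z By Bz.
by have [h1 h2] := H y z By Bz; rewrite normrN -opprD normrN.
Qed.

Lemma bounded_lipX f n : bounded_lip f -> bounded_lip (fun y => f y ^+ n).
Proof.
move=> bf; elim: n => [|n IH]; first exact: (bounded_lip_cst 1).
have [M [K [M0 K0 H]]] := bounded_lipM bf IH; exists M, K; split=> // y z By Bz.
by have := H y z By Bz; rewrite !exprS.
Qed.

End bounded_lip.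

Lemma f_lipschitz_field : lipschitz_field (@f_ R).
Proof.
move=> B BH [r0 Hr0].
(* The given bound may be negative when B is empty. *)
pose r := Num.max r0 0; have r_ge0 : 0 <= r by rewrite le_max lexx orbT.
have Hr z : B z -> hnorm z.1 <= r /\ enorm z.2 <= r.
  move=> Bz; have h := hnorm_ge0 (BH z Bz); have e := enorm_ge0 z.2.
  have := Hr0 z Bz; have : r0 <= r by rewrite le_max lexx.
  by lra.
pose D (y z : (R -> plane R) * plane R) := hnorm (y - z).1 + enorm (y - z).2.
have Dh y z : B y -> B z -> hnorm (y.1 - z.1) <= D y z.
  by move=> By Bz; rewrite /D lerDl enorm_ge0.
have De y z : B y -> B z -> enorm (y.2 - z.2) <= D y z.
  by move=> By Bz; rewrite /D lerDr; apply: hnorm_sub_ge0; exact: BH.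
have z01 : -1 <= (0 : R) <= 0 by rewrite lexx oppr_le0 ler01.
have bp : bounded_lip B D (fun y => (y.1 0).1).
  exists r, 1; split=> // y z By Bz; rewrite mul1r; split.
    rewrite (le_trans (enorm_ge1 _)) // (le_trans (hnorm_ge_history (BH y By)
      z01)) //.
    by have [] := Hr y By.
  apply: le_trans (Dh y z By Bz).
  apply: le_trans (hnorm_sub (BH y By) (BH z Bz) z01).
  exact: (enorm_ge1 (y.1 0 - z.1 0)).
have bq : bounded_lip B D (fun y => (y.1 0).2).
  exists r, 1; split=> // y z By Bz; rewrite mul1r; split.
    rewrite (le_trans (enorm_ge2 _)) // (le_trans (hnorm_ge_history (BH y By)
      z01)) //.
    by have [] := Hr y By.
  apply: le_trans (Dh y z By Bz).
  apply: le_trans (hnorm_sub (BH y By) (BH z Bz) z01).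
  exact: (enorm_ge2 (y.1 0 - z.1 0)).
have ba : bounded_lip B D (fun y => y.2.1).
  exists r, 1; split=> // y z By Bz; rewrite mul1r; split.
    by rewrite (le_trans (enorm_ge1 _)) //; have [] := Hr y By.
  by apply: le_trans (De y z By Bz); exact: (enorm_ge1 (y.2 - z.2)).
have bb : bounded_lip B D (fun y => y.2.2).
  exists r, 1; split=> // y z By Bz; rewrite mul1r; split.
    by rewrite (le_trans (enorm_ge2 _)) //; have [] := Hr y By.
  by apply: le_trans (De y z By Bz); exact: (enorm_ge2 (y.2 - z.2)).
have bV : bounded_lip B D (fun y => V_ y.1).
  exists (3 / 2 * r ^+ 2), (6 * r); split; try by rewrite ?mulr_ge0 ?sqr_ge0.
  move=> y z By Bz; split.
    rewrite ger0_norm ?V_ge0 //; last exact: BH.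
    apply: V_upper => th tht; apply: le_trans (hnorm_ge_history (BH y By) tht)
      _.
    by have [] := Hr y By.
  have [h1 _] := Hr y By; have [h2 _] := Hr z Bz.
  apply: (le_trans (V_lip (BH y By) (BH z Bz) h1 h2)).
  by rewrite ler_wpM2l ?mulr_ge0 // Dh.
have b1 : bounded_lip B D (fun y => (f_ y.1 y.2).1).
  rewrite /f_ /E_ /=.
  apply: bounded_lipD.
    by apply: bounded_lipD; [apply: bounded_lipN|apply: bounded_lipN;
      apply: bounded_lipX].
  apply: bounded_lipM => //.
    apply: bounded_lipM => //; apply: bounded_lipM => //;
      first exact: bounded_lip_cst.
    by apply: bounded_lipX => //; apply: bounded_lipD => //;
      exact: bounded_lip_cst.
  apply: bounded_lipD => //; apply: bounded_lipN => //; apply: bounded_lipM =>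
    //; last exact: bounded_lip_cst.
  by apply: bounded_lipD; apply: bounded_lipX.
have b2 : bounded_lip B D (fun y => (f_ y.1 y.2).2).
  by rewrite /f_ /=; apply: bounded_lipD => //; apply: bounded_lipN.
move: b1 b2 => [M [K [_ K0 H]]] [N [L [_ L0 G]]].
exists (K + L) => y z By Bz.
rewrite (le_trans (enorm_le_sum _)) // mulrDl lerD //.
  by have [_] := H y z By Bz.
by have [_] := G y z By Bz.
Qed.

Lemma f_zero : f_ (0 : R -> plane R) 0 = 0.
Proof. by rewrite /f_ /= !(mulr0, mul0r, expr0n, subr0, oppr0, addr0). Qed.

Lemma V_bounds phi : history phi -> enorm (phi 0) ^+ 2 / 2 <= V_ phi <= 3 / 2 *
  hnorm phi ^+ 2.
Proof.
move=> h; rewrite enorm_sq C_le_V //=.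
by apply: V_upper => th; exact: hnorm_ge_history.
Qed.

End lipschitz_estimates.

(** * Growth of V *)

Section growth.
Variable R : realType.
Notation mu := (@lebesgue_measure R).
Implicit Types (p q P : R -> R) (s t A K : R).

Lemma derD (f g : R -> R) t (a b : R) : is_derive t 1 f a ->
  is_derive t 1 g b ->
  is_derive t 1 (fun x => f x + g x) (a + b).
Proof. by move=> h k; exact: (@is_deriveD _ _ _ f g). Qed.

Lemma derB (f g : R -> R) t (a b : R) : is_derive t 1 f a ->
  is_derive t 1 g b ->
  is_derive t 1 (fun x => f x - g x) (a - b).
Proof. by move=> h k; exact: (@is_deriveB _ _ _ f g). Qed.

Lemma derN (f : R -> R) t (a : R) : is_derive t 1 f a ->
  is_derive t 1 (fun x => - f x) (- a).
Proof. by move=> h; exact: (@is_deriveN _ _ _ f). Qed.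

Lemma derM (f g : R -> R) t (a b : R) : is_derive t 1 f a ->
  is_derive t 1 g b ->
  is_derive t 1 (fun x => f x * g x) (f t * b + g t * a).
Proof. by move=> h k; exact: (@is_deriveM _ _ f g). Qed.

Lemma derMl (f : R -> R) t (c a : R) : is_derive t 1 f a ->
  is_derive t 1 (fun x => c * f x) (c * a).
Proof. by move=> h; exact: (@is_deriveZ _ _ _ f c t 1 a). Qed.

Lemma derSq (f : R -> R) t (a : R) : is_derive t 1 f a ->
  is_derive t 1 (fun x => f x ^+ 2) (2 * (f t * a)).
Proof.
move=> h; apply: (is_derive_eq (derM h h)); ring.
Qed.

Lemma derC (c t : R) : is_derive t 1 (fun=> c) (0 : R).
Proof. exact: is_derive_cst. Qed.

Lemma derId t : is_derive t 1 (fun x : R => x) 1.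
Proof. exact: is_derive_id. Qed.

Lemma derMr (f : R -> R) t (c a : R) : is_derive t 1 f a ->
  is_derive t 1 (fun x => f x * c) (a * c).
Proof.
move=> h; apply: (is_derive_eq (derM h (derC c t))); ring.
Qed.

Lemma der_continuous (f : R -> R) t (a : R) : is_derive t 1 f a -> {for t,
  continuous f}.
Proof.
move=> h; apply: differentiable_continuous; apply/derivable1_diffP.
exact: ex_derive.
Qed.

(** Squaring removes the kink of the maximum: the first-order error is at most (y - x)^2, wherever x
    and y lie relative to 0. *)
Lemma is_derive_half_max (x : R) :
  is_derive x 1 (fun v : R => Num.max v 0 ^+ 2 / 2) (Num.max x 0).
Proof.
apply/is_deriveP => e e0; exists e => // y yx.
apply: (@le_trans _ _ (`|y - x| * `|y - x|)); last by rewrite ler_wpM2r // ltW.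
rewrite /GRing.scale /= -normrM [leRHS]ger0_norm; last
  by rewrite -expr2 sqr_ge0.
have := sqr_ge0 (y - x); rewrite ler_norml /Num.max.
by case: ltP => h1; case: ltP => h2 H; apply/andP; split; nra.
Qed.

Lemma derg s q t (dq : R) : is_derive t 1 q dq ->
  is_derive t 1 (fun t => g_ s (q t)) (Num.max (s * q t) 0 * (s * dq)).
Proof.
move=> h; exact: (@is_derive1_comp R _ (fun t =>
  s * q t) _ _ _ (is_derive_half_max _) (derMl s h)).
Qed.

Lemma lip_g a b s q : lip a b q -> lip a b (fun t => g_ s (q t)).
Proof.
move=> lq; apply: lipM; last exact: lip_cst.
by apply: lipX; apply: lip_max0; apply: lipM => //; exact: lip_cst.
Qed.

Lemma lip_primitive p P a b : primitive_sq p P -> lip a b p -> -2 < a ->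
  lip a b P.
Proof.
move=> hP lp a2; have [M M0 HM] := lip_bounded lp.
apply: (@lip_derive_bounded _ _ _ _ (fun t => p t ^+ 2) (M ^+ 2)) =>
  t /[dup] tab /andP[t1 t2].
  by apply: hP; lra.
by rewrite normrX ler_sqr ?nnegrE // HM.
Qed.

Lemma is_derive_expRM K t : is_derive t 1 (fun t =>
  expR (K * t)) (expR (K * t) * K).
Proof.
have := @is_derive1_comp R expR (fun t => K * t) t _ _ (is_derive_expR _) (derMl
  K (derId t)).
by rewrite mulr1.
Qed.

Lemma lip_expR K a b : lip a b (fun t => expR (K * t)).
Proof.
apply: (@lip_derive_bounded _ _ _ _ (fun t =>
  expR (K * t) * K) (expR (`|K| * Num.max `|a| `|b|) * `|K|)) =>
  [t _|t /andP[ta tb]]; first exact: is_derive_expRM.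
rewrite normrM ler_wpM2r // ger0_norm ?expR_ge0 // ler_expR.
rewrite (le_trans (ler_norm _)) // normrM ler_wpM2l //.
rewrite le_max; have := ler_norm b; have := ler_norm (- a); rewrite normrN =>
  a1 b1.
have [t0|t0] := leP 0 t; apply/orP.
  by right; rewrite ger0_norm //; lra.
by left; rewrite ltr0_norm //; lra.
Qed.

Lemma proj_lip a b (x y : R) : a <= b ->
  `|Num.max a (Num.min x b) - Num.max a (Num.min y b)| <= `|x - y|.
Proof.
move=> ab; wlog xy : x y / x <= y.
  move=> H; have [xy|/ltW yx] := leP x y; first exact: H.
  by rewrite distrC [`|x - y|]distrC; exact: H.
rewrite [`|x - y|]ler0_norm ?subr_le0 // ler_norml /Num.max /Num.min.
by case: (ltP x b) => ?; case: (ltP y b) => ?; do 2 ?case: ltP => ?;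
  apply/andP; split; lra.
Qed.

Lemma lip_attains_max a b (h : R -> R) : a <= b -> lip a b h -> exists2 c,
  a <= c <= b &
  forall t, a <= t <= b -> h t <= h c.
Proof.
move=> ab [K K0 H].
pose h' t := h (Num.max a (Num.min t b)).
have cl t : a <= Num.max a (Num.min t b) <= b.
  by rewrite le_max lexx /= ge_max ab ge_min lexx orbT.
have ci t : a <= t <= b -> Num.max a (Num.min t b) = t.
  by move=> /andP[t1 t2]; rewrite (min_idPl t2) (max_idPr t1).
have [||c cab Hc] := @EVT_max R h' a b => //.
  apply: continuous_subspaceT => x; apply/cvgrPdist_le => e e0.
  exists (e / (K + 1)) => /=; first by rewrite divr_gt0 // ltr_wpDl.
  move=> y /=; rewrite ltr_pdivlMr ?ltr_wpDl // => xy.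
  apply: le_trans (H _ _ (cl x) (cl y)) _.
  apply: le_trans (ltW xy); rewrite mulrC ler_pM ?lerDl //.
  exact: proj_lip.
move: cab; rewrite in_itv /= => cab.
exists c => // t tab; have := Hc t; rewrite in_itv /= => /(_ tab).
by rewrite /h' !ci.
Qed.

(** The third clause bounds the growth of q^2 / 2 + g_s(q), the only part of a term of V that can
    increase when its past time is fixed; the fourth lets p^2 / 2 grow at most in proportion to E,
    hence not at all when C = V. *)
Definition dissipative p q A K t := exists dp dq,
  [/\ is_derive t 1 p dp, is_derive t 1 q dq,
      forall s, s = 1 \/ s = -1 -> q t * dq + Num.max (s * q t) 0 * (s * dq) <=
        A &
      p t * dp <= K * E_ (segment (trj p q) t)].

(* With C = |x|^2/2, the weight A absorbs the growth of every term of V except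
   C itself; and C decreases, up to A, as soon as it equals V because E = V - C
   then vanishes. Gronwall turns this into the comparison of C with the maximum
   m of C - A t. *)
Lemma V_growth p q P t0 t1 A K :
  continuous p -> continuous q -> primitive_sq p P -> 0 <= t0 <= t1 -> 0 <= K ->
  lip t0 t1 p -> lip t0 t1 q ->
  {ae mu, forall t, t0 < t < t1 -> dissipative p q A K t} ->
  V_ (segment (trj p q) t1) <= V_ (segment (trj p q) t0) + A * (t1 - t0).
Proof.
move=> cp cq hP /andP[t00 t01] K0 lp lq ae.
have hs t : history (segment (trj p q) t) by exact: segment_history.
have lP : lip t0 t1 P by apply: lip_primitive hP lp _; lra.
(* The part of [F_trj] that varies with t at a fixed past time. *)
pose k s t := q t ^+ 2 / 2 + g_ s (q t) - P t.
have lk s : lip t0 t1 (k s).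
  apply: lipB => //; apply: lipD; last exact: lip_g.
  by apply: lipM; [exact: lipX|exact: lip_cst].
have kA s r t : s = 1 \/ s = -1 -> t0 <= r -> r <= t -> t <= t1 ->
  k s t - k s r <= A * (t - r).
  move=> hs' tr rt tt; apply: lip_slope_le => //; first exact: lipS (lk s).
  refine (ae_imp ae _) => x H /andP[x1 x2].
  have [|dp [dq [Dp Dq HA _]]] := H; first by apply/andP; split; lra.
  have Dk := derB (derD (derMr 2^-1 (derSq Dq)) (derg s Dq)) (hP x ltac:(lra)).
  exists (2 * (q x * dq) / 2 + Num.max (s * q x) 0 * (s * dq) - p x ^+ 2);
    first exact: Dk.
  have := HA s hs'; have := sqr_ge0 (p x); lra.
set M := V_ (segment (trj p q) t0).
pose y r := (p r ^+ 2 + q r ^+ 2) / 2 - A * (r - t0).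
(* A past time up to t0 already belongs to the window at t0. A later one, r, enters with the value
   g_s(p r) + q r^2 / 2, at most C at time r. From then on either term grows at rate at most A. *)
have Vb t m : t0 <= t <= t1 -> M <= m -> (forall r, t0 <= r <= t -> y r <= m) ->
    V_ (segment (trj p q) t) <= m + A * (t - t0).
  move=> /andP[tt0 tt1] Mm ym; apply: V_le =>
    s th hs' /[dup] tht /andP[th1 th0].
  rewrite (F_segment _ _ cp hP) //; last by lra.
  have [rt0|rt0] := leP (t + th) t0.
    have := kA s t0 t hs' (lexx _) tt0 tt1.
    have z : -1 <= t + th - t0 <= 0 by apply/andP; split; lra.
    have := F_le_V (hs t0) hs' z; rewrite -/M (F_segment _ _ cp hP) // addrCA
      subrr addr0.
    rewrite /k /F_trj; lra.
  have := kA s (t + th) t hs' (ltW rt0); have := g_le (p (t + th)) hs'.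
  have := ym (t + th); rewrite /y (ltW rt0) /F_trj /k => H1 H2 H3.
  have := H1 ltac:(lra); have := H3 ltac:(lra) ltac:(lra); lra.
have ly : lip t0 t1 y.
  apply: lipB.
    by apply: lipM; [apply: lipD; apply: lipX|exact: lip_cst].
  apply: lipM; first exact: lip_cst.
  by apply: lipB; [exact: lip_id|exact: lip_cst].
have [c /andP[c0 c1] Hc] := lip_attains_max t01 ly.
have [mM|Mm] := leP (y c) M.
  by apply: Vb => //; [rewrite t01 lexx|move=> r /Hc /le_trans; apply].
exfalso.
have yM : y t0 <= M.
  by have := C_le_V (hs t0); rewrite /y subrr mulr0 subr0 /segment /trj addr0.
(* If y c exceeds M, then y' <= K E <= K (y c - y) on [t0, c], which makes h nondecreasing there;
   this contradicts h t0 > 0 = h c. *)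
pose h t := (y c - y t) * expR (K * t).
have lh : lip t0 c h.
  apply: lipM; last exact: lip_expR.
  by apply: lipB; [exact: lip_cst|exact: lipS ly].
have : 0 * (c - t0) <= h c - h t0.
  apply: lip_slope_ge => //; refine (ae_imp ae _) => x H /andP[x1 x2].
  have [|dp [dq [Dp Dq HA HE]]] := H; first by apply/andP; split; lra.
  have Dy : is_derive x 1 y ((2 * (p x * dp) + 2 * (q x * dq)) / 2 - A * (1 -
    0)).
    exact: (derB (derMr 2^-1 (derD (derSq Dp) (derSq Dq))) (derMl A (derB (derId
      x) (derC t0 x)))).
  have Dh := derM (derB (derC (y c) x) Dy) (is_derive_expRM K x).
  eexists; first exact: Dh.
  (* The sign opposite to q makes the [g_] contribution vanish and leaves a bound on q * dq
     alone. *)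
  have qA : q x * dq <= A.
    have [q0|q0] := leP 0 (q x).
      have := HA (-1) (or_intror erefl); rewrite (max_idPr _) ?mul0r ?addr0 //;
        lra.
    by have := HA 1 (or_introl erefl); rewrite (max_idPr _) ?mul0r ?addr0 //;
      lra.
  have VE : E_ (segment (trj p q) x) <= y c - y x.
    have := Vb x (y c); rewrite /E_ /segment /trj /= addr0 => Vx.
    have := Vx ltac:(lra) (ltW Mm) (fun r hr => Hc r ltac:(lra)).
    rewrite /y; lra.
  have := ler_wpM2l K0 VE => KE.
  have eg : 0 <= expR (K * x) by exact: expR_ge0.
  have -> : (y c - y x) * (expR (K * x) * K) + expR (K * x) *
     (0 - ((2 * (p x * dp) + 2 * (q x * dq)) / 2 - A * (1 - 0))) =
     expR (K * x) * (K * (y c - y x) - p x * dp - (q x * dq - A)) by field.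
  apply: mulr_ge0 => //; lra.
rewrite mul0r /h subrr mul0r sub0r oppr_ge0.
rewrite leNgt mulr_gt0 ?expR_gt0 // subr_gt0; lra.
Qed.

(* driver_shift phi h w is the segment at time h of the trajectory continuing
   phi with the constant velocity w. *)
Lemma driver_derivative_le phi (p0 q0 a b : R) : history phi -> phi 0 = (p0,
  q0) ->
  (driver_derivative (@V_ R) phi (f_ phi (a, b)) <= (- p0 ^+ 2 - q0 ^+ 2 / 2 + a
    ^+ 2)%:E)%E.
Proof.
move=> hphi phi0.
have [pp [qq [cpp cqq phiE]]] := history_trj hphi.
have z01 : -1 <= (0 : R) <= 0 by rewrite lexx oppr_le0 ler01.
have pp0 : pp 0 = p0 by have := phiE 0 z01; rewrite phi0 => -[].
have qq0 : qq 0 = q0 by have := phiE 0 z01; rewrite phi0 => -[].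
set w := f_ phi (a, b).
have w2 : w.2 = - q0 + a by rewrite /w /f_ phi0.
pose p t := pp (Num.min t 0) + Num.max t 0 * w.1.
pose q t := qq (Num.min t 0) + Num.max t 0 * w.2.
have cc (g : R -> R) (c : R) : continuous g -> continuous (fun t =>
  g (Num.min t 0) + Num.max t 0 * c).
  move=> cg x; apply: (@continuousD _ R^o R^o (fun t =>
    g (Num.min t 0)) (fun t => Num.max t 0 * c)).
    apply: (@continuous_comp _ _ _ (fun t => Num.min t 0) g); last exact: cg.
    by apply: (@continuous_min R R^o id (cst 0) x); [exact: cvg_id|
      exact: cvg_cst].
  apply: (@continuousM _ R^o (fun t => Num.max t 0) (cst c));
    last exact: cvg_cst.
  by apply: (@continuous_max R R^o id (cst 0) x); [exact: cvg_id|
    exact: cvg_cst].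
have cp : continuous p by exact: cc.
have cq : continuous q by exact: cc.
have [P hP] := primitive_sq_ex cp.
have pneg t : t <= 0 -> p t = pp t.
  by move=> t0; rewrite /p (min_idPl t0) (max_idPr t0) mul0r addr0.
have qneg t : t <= 0 -> q t = qq t.
  by move=> t0; rewrite /q (min_idPl t0) (max_idPr t0) mul0r addr0.
have ppos t : 0 <= t -> p t = p0 + t * w.1.
  by move=> t0; rewrite /p (min_idPr t0) (max_idPl t0) pp0.
have qpos t : 0 <= t -> q t = q0 + t * w.2.
  by move=> t0; rewrite /q (min_idPr t0) (max_idPl t0) qq0.
have hs t : history (segment (trj p q) t) by exact: segment_history.
have V0 : V_ phi = V_ (segment (trj p q) 0).
  by apply: eq_V => th tht; rewrite /segment /trj add0r pneg ?qneg ?phiE //;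
    case/andP: tht.
have VS h : 0 < h < 1 -> V_ (driver_shift phi h w) = V_ (segment (trj p q) h).
  move=> /andP[h0 h1]; apply: eq_V => th /andP[t1 t2].
  rewrite /driver_shift /segment /trj; case: ifP => thh.
    rewrite phiE; last by apply/andP; split; lra.
    by rewrite addrC pneg ?qneg //; lra.
  have ht : 0 <= h + th by move/negbT: thh; rewrite -leNgt; lra.
  by rewrite phi0 (ppos _ ht) (qpos _ ht) [th + h]addrC.
set D := - p0 ^+ 2 - q0 ^+ 2 / 2 + a ^+ 2.
(* K1 * x bounds the excess over D of the derivative of k at x: w.2^2 comes from each of the two
   terms in q, and 2 |p0 w.1| from - p^2. *)
pose K1 := 2 * w.2 ^+ 2 + 2 * `|p0 * w.1|.
have K10 : 0 <= K1 by rewrite addr_ge0 // mulr_ge0 ?sqr_ge0.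
pose k s t := (q0 + t * w.2) ^+ 2 / 2 + g_ s (q0 + t * w.2) - P t.
have kD s r t : s = 1 \/ s = -1 -> 0 <= r -> r <= t ->
  k s t - k s r <= (D + K1 * t) * (t - r).
  move=> hs' r0 rt.
  pose d x := 2 * ((q0 + x * w.2) * w.2) / 2 + Num.max (s * (q0 + x * w.2)) 0 *
    (s * w.2) - p x ^+ 2.
  have := @slope_le R r t (D + K1 * t) (k s) d rt; apply => x /andP[x1 x2].
  have x0 : 0 <= x by exact: le_trans x1.
  have Dq : is_derive x 1 (fun x => q0 + x * w.2) w.2.
    by apply: (is_derive_eq (derD (derC q0 x) (derMr w.2 (derId x))));
      rewrite add0r mul1r.
  split.
    by apply: (derB (derD (derMr 2^-1 (derSq Dq)) (derg s Dq))); apply: hP; lra.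
  apply: (@le_trans _ _ (D + K1 * x)); last by rewrite lerD2l ler_wpM2l.
  rewrite /d ppos // /D /K1.
  have h1 : - ((p0 + x * w.1) ^+ 2) <= - p0 ^+ 2 + 2 * `|p0 * w.1| * x.
    have := ler_norm (- (p0 * w.1)); rewrite normrN => /(ler_wpM2r x0).
    have := sqr_ge0 (x * w.1); lra.
  have h2 : Num.max (s * (q0 + x * w.2)) 0 * (s * w.2) <= Num.max (s * q0) 0 *
    (s * w.2) + x * w.2 ^+ 2.
    have -> : w.2 ^+ 2 = (s * w.2) ^+ 2 by case: hs' => ->;
      rewrite ?mul1r ?mulN1r ?sqrrN.
    have -> : s * (q0 + x * w.2) = s * q0 + x * (s * w.2) by ring.
    move: (s * q0) (s * w.2) => Q W.
    rewrite /Num.max; case: ltP => h2; case: ltP => h3; nra.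
  have h3 : (q0 * w.2) + Num.max (s * q0) 0 * (s * w.2) <= - q0 ^+ 2 / 2 + a ^+
    2.
    rewrite w2; have := sqr_ge0 (q0 - a); have := sqr_ge0 a; have := sqr_ge0 q0.
    case: hs' => ->; rewrite ?mul1r ?mulN1r /Num.max; case: ltP => h3;
      rewrite ?mul0r; lra.
  lra.
pose Cr r := ((p0 + r * w.1) ^+ 2 + (q0 + r * w.2) ^+ 2) / 2.
have VC h m : 0 < h < 1 -> V_ phi + h * (D + K1 * h) <= m ->
    (forall r, 0 <= r <= h -> Cr r + (D + K1 * h) * (h - r) <= m) ->
    V_ (segment (trj p q) h) <= m.
  move=> /andP[h0 h1] Hm HC; apply: V_le => s th hs' /[dup] tht /andP[th1 th2].
  rewrite (F_segment _ _ cp hP) //; last exact: ltW.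
  have [r0|r0] := leP (h + th) 0.
    apply: le_trans Hm; rewrite V0.
    have z : -1 <= h + th <= 0 by apply/andP; split; lra.
    have := F_le_V (hs 0) hs' z; rewrite (F_segment _ _ cp hP) // add0r.
    have := kD s 0 h hs' (lexx _) (ltW h0).
    rewrite /k /F_trj (qpos h) ?(ltW h0) // (qpos 0) // mul0r addr0; lra.
  have := HC (h + th); have := kD s (h + th) h hs' (ltW r0).
  have := g_le (p (h + th)) hs'.
  rewrite /k /F_trj (qpos h) ?(ltW h0) // (qpos (h + th)) ?(ltW r0) // (ppos (h
    + th)) ?(ltW r0) // /Cr.
  move=> H1 H2 H3; have := H2 ltac:(lra); have := H3 ltac:(lra).
  lra.
have key : exists2 K, 0 <= K & exists2 h0, 0 < h0 & forall h, 0 < h < h0 ->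
    V_ (driver_shift phi h w) - V_ phi <= h * (D + K * h).
  (* If E > 0, C starts strictly below V and remains there for small h, with room for all
     corrections of order h. If E = 0, the b-term disappears from w and C itself has derivative at
     most D at h = 0. *)
  have := E_ge0 hphi; rewrite le_eqVlt => /predU1P[E0|E0]; last first.
    pose K2 := `|p0 * w.1| + w.1 ^+ 2 + `|q0 * w.2| + w.2 ^+ 2.
    have K20 : 0 <= K2 by rewrite !addr_ge0 ?sqr_ge0.
    pose K3 := K2 + `|D| + K1 + `|D| + 1.
    have K30 : 0 < K3 by rewrite /K3; have := normr_ge0 D; lra.
    exists K1 => //; exists (Num.min 1 (E_ phi / K3)); first
      by rewrite lt_min ltr01 divr_gt0.
    move=> h /andP[h0]; rewrite lt_min ltr_pdivlMr // => /andP[h1 h2].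
    rewrite lerBlDl; rewrite VS ?h0 //; apply: VC; rewrite ?h0 //.
    move=> r /andP[r0 rh].
    have rle u : r * u <= h * `|u|.
      apply: (le_trans (ler_wpM2l r0 (ler_norm u))).
      by rewrite ler_wpM2r.
    have r1 : r ^+ 2 <= h by nra.
    have C1 : Cr r <= (p0 ^+ 2 + q0 ^+ 2) / 2 + h * K2.
      rewrite /Cr /K2; have := rle (p0 * w.1); have := rle (q0 * w.2).
      have := ler_wpM2r (sqr_ge0 w.1) r1; have := ler_wpM2r (sqr_ge0 w.2) r1.
      have := mulr_ge0 (ltW h0) (sqr_ge0 w.1); have :=
        mulr_ge0 (ltW h0) (sqr_ge0 w.2).
      lra.
    have C2 : (D + K1 * h) * (h - r) <= (`|D| + K1) * h.
      have := ler_norm D; have := normr_ge0 D => d0 dD.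
      apply: (@le_trans _ _ ((`|D| + K1) * (h - r))).
        rewrite ler_wpM2r ?subr_ge0 // lerD // ler_piMr //; exact: ltW.
      by apply: ler_wpM2l; [clear -d0 K10|]; lra.
    have C3 : - (h * `|D|) <= h * D.
      rewrite lerNl -mulrN ler_wpM2l ?(ltW h0) //.
      by have := ler_norm (- D); rewrite normrN.
    have C4 : 0 <= h * (K1 * h) by rewrite mulr_ge0 ?(ltW h0) // mulr_ge0 ?(ltW
      h0).
    move: h2; rewrite /E_ phi0 /= /K3; lra.
  have w1 : w.1 = - p0 - p0 ^+ 5 by rewrite /w /f_ phi0 /= -E0 mulr0 addr0.
  have VC0 : V_ phi = (p0 ^+ 2 + q0 ^+ 2) / 2.
    by move: E0; rewrite /E_ phi0 /= => /eqP; rewrite eq_sym subr_eq0 => /eqP.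
  pose K4 := w.1 ^+ 2 + w.2 ^+ 2; have K40 : 0 <= K4
    by rewrite addr_ge0 ?sqr_ge0.
  exists (K1 + K4); first exact: addr_ge0.
  exists 1 => // h /andP[h0 h1].
  have hK4 : 0 <= h * (K4 * h) by rewrite mulr_ge0 ?(ltW h0) // mulr_ge0 ?(ltW
    h0).
  rewrite lerBlDl VS ?h0 //; apply: VC; rewrite ?h0 //; first by lra.
  move=> r /andP[r0 rh].
  have r2 : r ^+ 2 <= h ^+ 2 by rewrite ler_sqr ?nnegrE // ltW.
  have C1 : Cr r <= V_ phi + r * D + h ^+ 2 * K4.
    rewrite VC0 /Cr /D.
    have pw : p0 * w.1 <= - p0 ^+ 2.
      rewrite w1; have := sqr_ge0 (p0 ^+ 3); rewrite -exprM /= => h6; lra.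
    have qw : q0 * w.2 <= - q0 ^+ 2 / 2 + a ^+ 2.
      by rewrite w2; have := sqr_ge0 (q0 - a); have := sqr_ge0 a; lra.
    have := ler_wpM2l r0 pw; have := ler_wpM2l r0 qw.
    have := ler_wpM2r K40 r2; have := mulr_ge0 (sqr_ge0 h) K40; rewrite /K4;
      lra.
  have C2 : 0 <= K1 * (h * r) by rewrite mulr_ge0 // mulr_ge0 // ltW.
  lra.
have [K K0 [h0 h00 Hh]] := key.
apply/lee_addgt0Pr => e e0.
pose h1 := Num.min h0 (Num.min 1 (e / (K + 1))).
have h10 : 0 < h1 by rewrite !lt_min h00 ltr01 divr_gt0 // ltr_wpDl.
apply: (@le_trans _ _ (ereal_sup
    [set ((V_ (driver_shift phi h w) - V_ phi) / h)%:E | h in [set h | 0 < h <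
      h1]])).
  apply: ereal_inf_lbound; exists [set h | 0 < h < h1] => //.
  rewrite /at_right /=; exists h1 => //= x /=; rewrite sub0r normrN => xh x0.
  by rewrite x0 /=; apply: le_lt_trans xh; rewrite ler_norm.
apply: ge_ereal_sup => _ [h /= /andP[hp hh1] <-]; rewrite -EFinD lee_fin.
move: hh1; rewrite !lt_min => /andP[hh0 /andP[_]];
  rewrite ltr_pdivlMr ?ltr_wpDl // => he.
rewrite ler_pdivrMr //; apply: (le_trans (Hh h _)); first by rewrite hp.
rewrite mulrC ler_wpM2r ?(ltW hp) // lerD2l.
by apply: le_trans (ltW he); rewrite mulrC ler_wpM2l ?(ltW hp) // lerDl.
Qed.

End growth.

(** * A priori bounds along solutions *)

Section solutions.
Variable R : realType.
Notation mu := (@lebesgue_measure R).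
Implicit Types (p q P : R -> R) (s t T r : R) (u x phi : R -> plane R).

Lemma ess_norm_leP (D : set R) u r :
  (ess_norm D u <= r%:E)%E -> {ae mu, forall t, D t -> enorm (u t) <= r}.
Proof.
move=> /ess_supP h; refine (ae_imp h _) => t; rewrite patchE => ht Dt.
by move: ht; rewrite mem_set.
Qed.

Lemma ess_norm_lty (D : set R) u : (ess_norm D u < +oo)%E ->
  exists2 r, 0 <= r & (ess_norm D u <= r%:E)%E.
Proof.
move e : (ess_norm D u) => n; case: n e => [r|//|] e _.
  by exists (Num.max r 0); rewrite ?le_max ?lexx ?orbT // lee_fin le_max lexx.
by exists 0 => //; rewrite leNye.
Qed.

(** Comparison with f(0, 0) = 0 through the Lipschitz constant on a bounded set; the absolute value
    of r keeps (0, 0) in that set when r is negative. *)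
Lemma f_bounded r : exists2 K, 0 <= K & forall phi (v : plane R), history phi ->
  hnorm phi <= r -> enorm v <= r -> enorm (f_ phi v) <= K.
Proof.
have h0 : history (0 : R -> plane R) by apply: continuous_subspaceT => x;
  exact: cvg_cst.
have e0 : enorm (0 : plane R) = 0 by rewrite /enorm /= expr0n addr0 sqrtr0.
have H0 : hnorm (0 : R -> plane R) <= 0 by apply: hnorm_le => th _; rewrite e0.
pose B := [set z : (R -> plane R) * plane R |
  [/\ history z.1, hnorm z.1 <= `|r| & enorm z.2 <= `|r|]].
have [|//|L HL] := @f_lipschitz_field R B; first by move=> z [].
  by exists (`|r| + `|r|) => z [_ h1 h2]; exact: lerD.
exists (`|L| * (`|r| + `|r|)); first by rewrite mulr_ge0 // addr_ge0.
move=> phi v hp hr vr.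
have rr := ler_norm r.
have B1 : B (phi, v) by split=> //=; exact: le_trans rr.
have B0 : B (0, 0) by split=> //=; rewrite ?e0 // (le_trans H0).
have := HL _ _ B1 B0; rewrite /= f_zero !subr0 => /le_trans; apply.
have h3 : 0 <= hnorm phi + enorm v by rewrite addr_ge0 ?hnorm_ge0 ?enorm_ge0.
apply: (@le_trans _ _ (`|L| * (hnorm phi + enorm v))).
  by rewrite ler_wpM2r // ler_norm.
by rewrite ler_wpM2l // lerD // (le_trans _ rr).
Qed.

(** Working form of a solution on a finite horizon: p and q are continuous on the whole line and
    Lipschitz on [0, T]. The initial history is left out, and is compared separately where it
    matters. *)
Definition solves_on T p q u := [/\ continuous p, continuous q, lip 0 T p,
  lip 0 T q &
  {ae mu, forall t, 0 < t < T ->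
     is_derive t 1 (trj p q) (f_ (segment (trj p q) t) (u t))}].

Lemma segment_bounded p q T : continuous p -> continuous q -> 0 <= T ->
  exists2 M, 0 <= M & forall t, 0 <= t <= T -> forall th, -1 <= th <= 0 ->
    enorm (segment (trj p q) t th) <= M.
Proof.
move=> cp cq T0.
have bnd (h : R -> R) : continuous h -> exists2 M : R, 0 <= M & forall t,
  -1 <= t <= T -> `|h t| <= M.
  move=> ch; have [||c _ H] := @EVT_max R (fun y => `|h y|) (-1) T.
  - by rewrite (le_trans _ T0) // oppr_le0.
  - by apply: continuous_subspaceT => y; apply: continuous_comp; [exact: ch|
    exact: norm_continuous].
  by exists `|h c| => // th tht; apply: H; rewrite in_itv.
have [M M0 HM] := bnd p cp; have [N N0 HN] := bnd q cq.
exists (M + N); first exact: addr_ge0.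
move=> t /andP[t0 tT] th /andP[th1 th0].
have tt : -1 <= t + th <= T by apply/andP; split; lra.
by rewrite (le_trans (enorm_le_sum _)) // lerD /= ?HM ?HN.
Qed.

(** Freezing x at its value in -1 to the left of -1 gives continuity everywhere. On [0, T] the
    segments are bounded and the input is essentially bounded, so f is bounded almost everywhere
    along x, and absolute continuity improves to a Lipschitz estimate. *)
Lemma solution_solves_on phi u x : is_input u -> is_solution (@f_ R) phi u x ->
  exists p q, (forall t, -1 <= t -> x t = (p t, q t)) /\ forall T, 0 <= T ->
    solves_on T p q u.
Proof.
move=> [_ uT] [_ cx ax dx].
have cm : continuous (fun t : R => Num.max t (-1) : R).
  by move=> t; apply: (@continuous_max R R^o id (cst (-1)) t);
    [exact: cvg_id|exact: cvg_cst].
have cy : continuous (x \o (fun t => Num.max t (-1))).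
  by apply: (within_comp_continuous cx cm) => t;
    rewrite /= in_itv /= le_max lexx orbT.
pose p t := (x (Num.max t (-1))).1; pose q t := (x (Num.max t (-1))).2.
have cp : continuous p.
  by move=> t; apply: (@cvg_comp _ _ _ _ fst _ _ _ (cy t)); exact: cvg_fst.
have cq : continuous q.
  by move=> t; apply: (@cvg_comp _ _ _ _ snd _ _ _ (cy t)); exact: cvg_snd.
have xE t : -1 <= t -> x t = trj p q t.
  by move=> t1; rewrite /trj /p /q (max_idPl t1); case: (x t).
exists p, q; split=> // T T0.
have [M M0 HM] := segment_bounded cp cq T0.
have [r r0 ur] := ess_norm_lty (uT T T0).
have [K K0 HK] := f_bounded (Num.max M r).
have D : {ae mu, forall t, 0 < t < T ->
     is_derive t 1 (trj p q) (f_ (segment (trj p q) t) (u t)) /\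
     enorm (f_ (segment (trj p q) t) (u t)) <= K}.
  refine (ae_imp2 dx (ess_norm_leP ur) _) => t Dt Ut /andP[t0 tT]; split.
    have <- : f_ (segment x t) (u t) = f_ (segment (trj p q) t) (u t).
      by apply: eq_f => th /andP[th1 th0]; rewrite /segment xE //; lra.
    apply: (@is_derive_near R _ x _ t _ 1) => //; last by apply: Dt; exact: ltW.
    by move=> s; rewrite ltr_norml => /andP[s1 s2]; apply: xE; lra.
  apply: HK; first exact: segment_history.
    apply: hnorm_le => th tht; rewrite le_max HM //.
    by rewrite (ltW t0) (ltW tT).
  by rewrite le_max Ut ?orbT //= in_itv /= (ltW t0) (ltW tT).
have ac := ax T T0.
have acp : abs_cont 0 T p.
  move=> e e0; have [d d0 H] := ac e e0; exists d => // n I HI tI sI.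
  apply: le_lt_trans (H n I HI tI sI); apply: ler_sum => i _.
  have [h1 h2 h3] := HI i.
  have -> : p (I i).2 = (x (I i).2).1 by rewrite xE //; lra.
  have -> : p (I i).1 = (x (I i).1).1 by rewrite xE //; lra.
  exact: (enorm_ge1 (x (I i).2 - x (I i).1)).
have acq : abs_cont 0 T q.
  move=> e e0; have [d d0 H] := ac e e0; exists d => // n I HI tI sI.
  apply: le_lt_trans (H n I HI tI sI); apply: ler_sum => i _.
  have [h1 h2 h3] := HI i.
  have -> : q (I i).2 = (x (I i).2).2 by rewrite xE //; lra.
  have -> : q (I i).1 = (x (I i).1).2 by rewrite xE //; lra.
  exact: (enorm_ge2 (x (I i).2 - x (I i).1)).
split=> //.
- apply: (abs_cont_lip K0 acp); refine (ae_imp D _) =>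
  t H /H[/is_derive_pair[h1 h2] h3].
  eexists; first exact: h1.
  exact: le_trans (enorm_ge1 _) h3.
- apply: (abs_cont_lip K0 acq); refine (ae_imp D _) =>
  t H /H[/is_derive_pair[h1 h2] h3].
  eexists; first exact: h2.
  exact: le_trans (enorm_ge2 _) h3.
- by refine (ae_imp D _) => t H /H[].
Qed.

Lemma solves_onS T T' p q u : T' <= T -> solves_on T p q u ->
  solves_on T' p q u.
Proof.
move=> TT [cp cq lp lq D]; split=> //.
- exact: lipS (lexx 0) TT lp.
- exact: lipS (lexx 0) TT lq.
by refine (ae_imp D _) => t H /andP[t0 tT]; apply: H;
  rewrite t0 (lt_le_trans tT).
Qed.

(** The damping contributes - p^2 - p^6 to p p', and the coefficient of E is bounded by compactness.
    K depends on the solution, which is harmless because the conclusion of [V_growth] does not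
    contain it. *)
Lemma solves_on_p_growth T p q u r : 0 <= T -> 0 <= r -> solves_on T p q u ->
  {ae mu, forall t, 0 < t < T -> enorm (u t) <= r} ->
  exists2 K, 0 <= K & {ae mu, forall t, 0 < t < T ->
    p t * (f_ (segment (trj p q) t) (u t)).1 <= K * E_ (segment (trj p q) t)}.
Proof.
move=> T0 r0 [cp cq _ _ _] ur.
have [M M0 HM] := segment_bounded cp cq T0.
pose W := 3 / 2 * M ^+ 2; have W0 : 0 <= W by rewrite mulr_ge0 ?sqr_ge0.
pose K := M * (16 * (1 + W) ^+ 3 * r).
have W3 : 0 <= (1 + W) ^+ 3 by apply: exprn_ge0; lra.
have K0 : 0 <= K by apply: mulr_ge0 => //; apply: mulr_ge0 => //;
  apply: mulr_ge0.
exists K => //; refine (ae_imp ur _) => t ut /[dup] t0T /andP[t0 tT].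
have {}ut := ut t0T.
have ht : history (segment (trj p q) t) by exact: segment_history.
have tI : 0 <= t <= T by rewrite !ltW.
have V0 : 0 <= V_ (segment (trj p q) t) by exact: V_ge0.
have E0 : 0 <= E_ (segment (trj p q) t) by exact: E_ge0.
have VW : V_ (segment (trj p q) t) <= W by apply: V_upper; exact: HM.
have h0 : segment (trj p q) t 0 = (p t, q t) by rewrite /segment addr0.
rewrite /f_ h0 /=; move: (V_ _) (E_ _) V0 E0 VW => V E V0 E0 VW.
set b := (u t).2.
have br : `|b| <= r by rewrite (le_trans (enorm_ge2 _)).
have pM : `|p t| <= M.
  have := HM t tI 0; rewrite lexx oppr_le0 ler01 =>
    /(_ isT) /(le_trans (enorm_ge1 _)).
  by rewrite h0.
have h1 : p t * (16 * (1 + V) ^+ 3 * b) <= K.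
  apply: (le_trans (ler_norm _)); rewrite normrM ler_pM //.
  rewrite normrM ler_pM // normrM ler_pM ?normr_ge0 // ?normr_nat // ger0_norm
    ?exprn_ge0 ?addr_ge0 //.
  by rewrite lerXn2r ?nnegrE ?addr_ge0 // lerD2l.
have := ler_wpM2r E0 h1.
have := sqr_ge0 (p t); have := sqr_ge0 (p t ^+ 3); rewrite -exprM /=; lra.
Qed.

(** [V_growth] with A = r^2: the product q q' = q (a - q), counted once or twice according to s, is
    at most a^2. *)
Lemma solves_on_V_le T p q u r : 0 <= T -> 0 <= r -> solves_on T p q u ->
  {ae mu, forall t, 0 < t < T -> enorm (u t) <= r} ->
  V_ (segment (trj p q) T) <= V_ (segment (trj p q) 0) + r ^+ 2 * T.
Proof.
move=> T0 r0 sol ur; have [K K0 HK] := solves_on_p_growth T0 r0 sol ur.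
have [cp cq lp lq D] := sol; have [P hP] := primitive_sq_ex cp.
rewrite -[X in _ * X]subr0.
apply: (V_growth cp cq hP _ K0 lp lq); first by rewrite lexx.
refine (ae_imp2 D (ae_imp2 ur HK (fun t h k => conj h k)) _) =>
  t Dt [ut Kt] t0T.
have [D1 D2] := (is_derive_pair _ _ _).1 (Dt t0T).
exists (f_ (segment (trj p q) t) (u t)).1, (f_ (segment (trj p q) t) (u t)).2.
split=> //; last exact: Kt.
move=> s hs; rewrite /f_ /segment /trj /= addr0; set a := (u t).1.
have ar : a ^+ 2 <= r ^+ 2.
  rewrite -[leLHS]real_normK ?num_real // ler_sqr ?nnegrE // (le_trans
    (enorm_ge1 _)) //.
  exact: ut.
have := sqr_ge0 (q t - a); have := sqr_ge0 a; have := sqr_ge0 (q t).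
by case: hs => ->; rewrite ?mul1r ?mulN1r /Num.max; case: ltP => h3;
  rewrite ?mul0r; lra.
Qed.

Lemma solution_bound phi u x r t : 0 <= r -> 0 <= t -> is_input u ->
  is_solution (@f_ R) phi u x -> {ae mu, forall s, 0 < s < t ->
    enorm (u s) <= r} ->
  enorm (x t) ^+ 2 / 2 <= V_ phi + r ^+ 2 * t.
Proof.
move=> r0 t0 iu sx ur.
have [p [q [xE H]]] := solution_solves_on iu sx.
have [cp cq _ _ _] := H t t0.
have := solves_on_V_le t0 r0 (H t t0) ur.
have -> : V_ (segment (trj p q) 0) = V_ phi.
  apply: eq_V => th tht; rewrite /segment add0r /trj -xE; last
    by case/andP: tht.
  by case: sx => + _ _ _; apply; rewrite in_itv.
apply: le_trans; have := C_le_V (@segment_history R p q t cp cq).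
by rewrite /segment /trj addr0 /= enorm_sq xE //; lra.
Qed.

End solutions.

(** * Borel versions of Lebesgue measurable inputs *)

Section borel_version.
Variable R : realType.
Notation mu := (@lebesgue_measure R).
Notation lebT := (caratheodory_type (@wlength R idfun)^*%mu).

(** The Caratheodory sigma-algebra is the completion of the Borel one, so A is a Borel set together
    with part of a null set. *)
Lemma caratheodory_split (A : set R) : @measurable _ lebT A ->
  exists B N : set R, [/\ measurable B, measurable N,
    mu N = 0%E & A `\` N = B `\` N].
Proof.
move=> mA.
have : measurable_realfun.completed_algebra_gen mu A.
  by rewrite -g_sigma_completed_algebra_genE completed_caratheodory_measurable.
move=> [B mB [N [M [mM M0 NM]]] <-]; exists B, M; split=> //.
by apply/seteqP; split=> t [] => [[|/NM//]|] //= Bt nM; split=> //; left.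
Qed.

(* Off a null set containing the exceptional sets of all rational superlevels
   of f, these superlevels are Borel. *)
Lemma borel_version_real (f : R -> R) (D : set R) : measurable D ->
  (forall Y : set R, measurable Y -> @measurable _ lebT (D `&` f @^-1` Y)) ->
  exists2 g : R -> R, measurable_fun setT g & {ae mu, forall t, D t ->
    f t = g t}.
Proof.
move=> mD mf.
have mA r : @measurable _ lebT (D `&` f @^-1` `]r, +oo[%classic) by apply: mf;
  exact: measurable_itv.
have split_r (r : rat) := caratheodory_split (mA (ratr r)).
pose B r := projT1 (cid (split_r r)).
have HB r : exists N, [/\ measurable (B r), measurable N, mu N = 0%E
    & (D `&` f @^-1` `](ratr r), +oo[%classic) `\` N = B r `\` N].
  by rewrite /B; case: cid.
pose N r := projT1 (cid (HB r)).
have HN r : [/\ measurable (B r), measurable (N r), mu (N r) = 0%E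
    & (D `&` f @^-1` `](ratr r), +oo[%classic) `\` N r = B r `\` N r].
  by rewrite /N; case: cid.
pose M := \bigcup_r N r.
have mM : measurable M by apply: bigcupT_measurable_rat => r; have [] := HN r.
have M0 : mu.-negligible M.
  rewrite /M.
  have := @negligible_bigcup _ _ _ mu (fun n =>
    if unpickle n is Some r then N r else set0) => H.
  apply: negligibleS (H _) => [t [r _ Nt]|n].
    by exists (pickle r); [exact: I|rewrite pickleK; exact: Nt].
  case: unpickle => [r|]; last exact: negligible_set0.
  by have [_ mN N0 _] := HN r; exact/negligibleP.
have mDM : measurable (D `\` M) by exact: measurableD.
have mfDM : measurable_fun (D `\` M) f.
  apply: (measurability _ (measurable_realfun.RGenOInfty.measurableE R)).
  move=> _ [_ [x ->] <-].
  have -> : (D `\` M) `&` f @^-1` `]x, +oo[%classic =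
      \bigcup_r (if x <= ratr r then B r `\` M else set0).
    apply/seteqP; split=> t.
      move=> [[Dt Mt]]; rewrite /= in_itv /= andbT => xf.
      have [r] := rat_in_itvoo xf; rewrite in_itv /= => /andP[xr rf].
      exists r => //; rewrite (ltW xr); split=> //.
      have [_ _ _ E] := HN r.
      have : ((D `&` f @^-1` `](ratr r), +oo[%classic) `\` N r) t.
        by split; [split=> //; rewrite /= in_itv /= andbT|move=> Nt; apply: Mt;
          exists r].
      by rewrite E => -[].
    move=> [r _]; case: ifPn => // xr [Bt Mt].
    have [_ _ _ E] := HN r.
    have : (B r `\` N r) t by split=> // Nt; apply: Mt; exists r.
    rewrite -E => -[[Dt]]; rewrite /= !in_itv /= !andbT => rf _.
    by split=> //; exact: le_lt_trans rf.
  apply: bigcupT_measurable_rat => r; case: ifP => // _.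
  by apply: measurableD => //; have [] := HN r.
exists (f \_ (D `\` M)); first exact/(measurable_restrictT _ mDM).
apply: negligibleS M0 => t /= H; apply: contrapT => Mt; apply: H => Dt.
by rewrite patchE mem_set.
Qed.

(** The integration below is carried out for Borel functions, whereas an input is only Lebesgue
    measurable. An equation that holds almost everywhere does not see the difference. *)
Lemma borel_version (u : R -> plane R) : is_input u ->
  exists v1 v2 : R -> R, [/\ measurable_fun setT v1, measurable_fun setT v2 &
    {ae mu, forall t, 0 <= t -> u t = (v1 t, v2 t)}].
Proof.
move=> [mu0 _].
have mD : measurable (`[(0 : R), +oo[%classic) by exact: measurable_itv.
have mDc : @measurable _ lebT (`[(0 : R), +oo[%classic).
  by apply: sub_caratheodory; exact: mD.
have H (Y : set (plane R)) : measurable Y -> @measurable _ lebT (`[(0:R),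
  +oo[ `&` u @^-1` Y).
  by move=> mY; apply: mu0.
have H1 (Y : set R) : measurable Y ->
    @measurable _ lebT (`[(0:R), +oo[ `&` (fun t => (u t).1) @^-1` Y).
  move=> mY; apply: (H (fst @^-1` Y)); rewrite -[X in measurable X]setTI.
  exact: measurable_fst.
have H2 (Y : set R) : measurable Y ->
    @measurable _ lebT (`[(0:R), +oo[ `&` (fun t => (u t).2) @^-1` Y).
  move=> mY; apply: (H (snd @^-1` Y)); rewrite -[X in measurable X]setTI.
  exact: measurable_snd.
have [v1 mv1 e1] := borel_version_real mD H1.
have [v2 mv2 e2] := borel_version_real mD H2.
exists v1, v2; split=> //.
refine (ae_imp2 e1 e2 _) => t h1 h2 t0.
by rewrite -h1 -?h2 //= ?in_itv /= ?t0 //; case: (u t).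
Qed.

End borel_version.

(** * Antiderivatives, and measurability of V along a trajectory *)

Section antiderivative.
Variable R : realType.
Notation mu := (@lebesgue_measure R).
Implicit Types (p q : R -> R) (s t T K : R).

Lemma bounded_integrable (G : R -> R) K (A : set R) : measurable_fun setT G ->
  (forall t, `|G t| <= K) ->
  measurable A -> (mu A < +oo)%E -> mu.-integrable A (EFin \o G).
Proof.
move=> mG GK mA Ay; apply: measurable_bounded_integrable => //.
  exact: measurable_funS mG.
exists K; split; first exact: num_real.
by move=> x Kx t _ /=; apply: le_trans (GK t) (ltW Kx).
Qed.

(** For a merely measurable G the integral has derivative G almost everywhere, by Lebesgue
    differentiation; this is one source of the exceptional null sets in the existence proof. *)
Lemma antiderivative (G : R -> R) K : measurable_fun setT G -> (forall t,
  `|G t| <= K) ->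
  exists I : R -> R, [/\ I 0 = 0,
    forall s t, 0 <= s -> 0 <= t -> `|I s - I t| <= K * `|s - t| &
    {ae mu, forall t, 0 < t -> is_derive t 1 I (G t)}].
Proof.
move=> mG GK.
pose I t := \int[mu]_(r in `[0, t]) G r.
have iG a b : mu.-integrable `[a, b] (EFin \o G).
  apply: bounded_integrable mG GK _ _ => //.
  by rewrite lebesgue_measure_itv /=; case: ifP => // _; rewrite -EFinB ltry.
exists I; split.
- by rewrite /I set_itv1 Rintegral_set1.
- move=> s t; wlog st : s t / s <= t.
    move=> H s0 t0; have [st|/ltW ts] := leP s t; first exact: H.
    by rewrite distrC [`|s - t|]distrC; exact: H.
  move=> s0 t0; rewrite distrC [`|s - t|]distrC [`|t - s|]ger0_norm ?subr_ge0
    //.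
  rewrite /I Rintegral_itvB //= ?bnd_simp //.
  have iG' : mu.-integrable `]s, t] (EFin \o G).
    apply: integrableS (iG s t) => //; exact: subset_itv_oc_cc.
  apply: (le_trans (le_normr_Rintegral _ iG')) => //.
  apply: (@le_trans _ _ (\int[mu]_(r in `]s, t]) K)).
    apply: le_Rintegral => //.
      exact: integrable_norm iG'.
    apply: (@bounded_integrable (fun=> K) `|K|) => //.
    by rewrite lebesgue_measure_itv /=; case: ifP => // _; rewrite -EFinB ltry.
  rewrite Rintegral_cst // [X in fine X](_ : _ = (t - s)%:E) //.
  transitivity (mu `]s, t]%classic) => //.
  rewrite lebesgue_measure_itv /= lte_fin; case: ltP => // ts.
  by have -> : t = s; [apply/eqP; rewrite eq_le ts st|rewrite subrr].
have locG : locally_integrable [set: R] G.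
  split=> //; first exact: openT.
  move=> A _ cA.
  have : mu.-integrable A (EFin \o G).
    apply: bounded_integrable mG GK _ _; first exact:
      measurable_realfun.compact_measurable.
    exact: compact_finite_measure.
  by move=> /integrableP[].
have H := @FTC1 R G (BLeft 0) (fun y => iG 0 y) locG.
refine (ae_imp H _) => t Ht t0.
have [|d e] := Ht; first exact: t0.
by rewrite derive1E in e; exact: DeriveDef d e.
Qed.

Lemma measurable_open_superlevel (D : set R) (h : R -> R) : open D ->
  (forall x, open (D `&` [set t | x < h t])) -> measurable_fun D h.
Proof.
move=> oD oh; apply: (measurability _ (measurable_realfun.RGenOInfty.measurableE
  R)).
move=> _ [_ [x ->] <-].
have -> : D `&` h @^-1` `]x, +oo[%classic = D `&` [set t | x < h t].
  by apply/seteqP; split=> t [Dt]; rewrite /= in_itv /= andbT.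
exact: measurable_realfun.open_measurable.
Qed.

(* V (x_t) is a supremum of continuous functions of t, hence lower
   semicontinuous. *)
Lemma measurable_V p q : continuous p -> continuous q ->
  measurable_fun (`]0, +oo[%classic : set R) (fun t =>
    V_ (segment (trj p q) t)).
Proof.
move=> cp cq; have [P hP] := primitive_sq_ex cp.
apply: measurable_open_superlevel; first exact: interval_open.
move=> x.
pose F s th t := F_trj p q P s t (t + th).
have -> : `]0, +oo[%classic `&` [set t | x < V_ (segment (trj p q) t)] =
    \bigcup_(z in [set z : R * R | (z.1 = 1 \/ z.1 = -1) /\ -1 <= z.2 <= 0])
      (`]0, +oo[%classic `&` [set t | x < F z.1 z.2 t]).
  apply/seteqP; split=> t.
    move=> [t0 xV]; have t0' : 0 <= t by move: t0;
      rewrite /= in_itv /= andbT => /ltW.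
    apply: contrapT => H; move: xV; rewrite /= ltNge => /negP; apply.
    apply: V_le => s th hs tht; rewrite (F_segment _ _ cp hP) // leNgt;
      apply/negP => xF.
    by apply: H; exists (s, th).
  move=> [[s th] /= [hs tht] [t0 xF]]; split=> //.
  have t0' : 0 <= t by move: t0; rewrite /= in_itv /= andbT => /ltW.
  apply: lt_le_trans xF _; rewrite /F -(F_segment _ _ cp hP) //.
  by apply: F_le_V => //; exact: segment_history.
apply: bigcup_open => -[s th] /= [hs /andP[th1 th0]].
rewrite openE => t [t0 xF]; have t0' : 0 < t by move: t0;
  rewrite /= in_itv /= andbT.
have cg (h : R -> R) y : {for y, continuous h} -> {for y, continuous (fun t =>
  g_ s (h t))}.
  move=> ch; apply: (@continuous_comp _ _ _ h (g_ s)) => //.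
  have := derg s (derId (h y)); exact: der_continuous.
have cs : {for t, continuous (fun t => t + th)}.
  by apply: der_continuous; apply: derD (derId t) (derC th t).
have cF : {for t, continuous (F s th)}.
  have cpt : {for t, continuous (fun t => p (t + th))}.
    by apply: (@continuous_comp _ _ _ (fun t => t + th) p) => //; exact: cp.
  have cqt : {for t, continuous (fun t => q (t + th))}.
    by apply: (@continuous_comp _ _ _ (fun t => t + th) q) => //; exact: cq.
  have cP : {for t, continuous P} by apply: der_continuous; apply: hP; lra.
  have cPt : {for t, continuous (fun t => P (t + th))}.
    apply: (@continuous_comp _ _ _ (fun t => t + th) P) => //.
    by apply: der_continuous; apply: hP; lra.
  have cq2 : {for t, continuous (fun t => q t ^+ 2 / 2)}.
    apply: (@continuousM _ R^o (fun t => q t ^+ 2) (cst 2^-1));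
      last exact: cvg_cst.
    by apply: (@continuous_comp _ _ _ q (fun x => x ^+ 2)); [exact: cq|
      exact: exprn_continuous].
  rewrite /F /F_trj.
  apply: (@continuousB _ R^o R^o); last exact: (@continuousB _ R^o R^o _ _ _ cP
    cPt).
  apply: (@continuousB _ R^o R^o); last exact: cg.
  apply: (@continuousD _ R^o R^o); last by apply: cg; exact: cq.
  by apply: (@continuousD _ R^o R^o); first exact: cg.
have n1 : nbhs t (`]0, +oo[%classic : set R).
  by apply: open_nbhs_nbhs; split=> //; exact: interval_open.
have n2 : nbhs t [set t | x < F s th t].
  exact: (cF _ (open_nbhs_nbhs (conj (@open_gt R x) xF))).
exact: filterI.
Qed.

End antiderivative.

(** * Existence of solutions *)

Section picard.
Variable R : realType.
Notation mu := (@lebesgue_measure R).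
Implicit Types (p q : R -> R) (s t T K c : R).

Lemma f_lip r : exists2 L, 0 <= L & forall phi psi (v : plane R),
  history phi -> history psi ->
  hnorm phi <= r -> hnorm psi <= r -> enorm v <= r ->
  enorm (f_ phi v - f_ psi v) <= L * hnorm (phi - psi).
Proof.
pose B := [set z : (R -> plane R) * plane R |
  [/\ history z.1, hnorm z.1 <= r & enorm z.2 <= r]].
have [|//|L HL] := @f_lipschitz_field R B; first by move=> z [].
  by exists (r + r) => z [_ h1 h2]; exact: lerD.
exists `|L| => // phi psi v hp hs pr sr vr.
have e0 : enorm (0 : plane R) = 0 by rewrite /enorm /= expr0n addr0 sqrtr0.
have := HL (phi, v) (psi, v); rewrite /B /= subrr e0 addr0 => H.
apply: le_trans (H _ _) _ => //.
by rewrite ler_wpM2r ?ler_norm //; exact: hnorm_sub_ge0.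
Qed.

Lemma div_expr2_lt c e : 0 < e -> exists n : nat, c / 2 ^+ n < e.
Proof.
move=> e0; exists (Num.bound (c / e)).
rewrite ltr_pdivrMr ?exprn_gt0 // mulrC -ltr_pdivrMr //.
apply: (le_lt_trans (ler_norm _)).
apply: (lt_le_trans (archi_boundP (normr_ge0 _))).
have bE : Num.bound `|c / e| = Num.bound (c / e) by rewrite /Num.bound normr_id.
by rewrite bE -natrX ler_nat ltnW // ltn_expl.
Qed.

Lemma le_div_expr2_eq0 (a c : R) : (forall n : nat, `|a| <= c / 2 ^+ n) ->
  a = 0.
Proof.
move=> H; apply/eqP; rewrite -normr_le0 leNgt; apply/negP =>
  /(div_expr2_lt c)[n].
by rewrite ltNge H.
Qed.

(** The intervals centred at x n with radius 2 c / 2^n are nested, so the supremum of their left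
    ends lies in all of them. *)
Lemma geometric_limit (x : nat -> R) c : (forall n,
  `|x n.+1 - x n| <= c / 2 ^+ n) ->
  exists l, forall n, `|x n - l| <= 2 * c / 2 ^+ n.
Proof.
move=> H; have c0 : 0 <= c by have := le_trans (normr_ge0 _) (H 0%N);
  rewrite expr0 divr1.
pose d n := 2 * c / 2 ^+ n.
have d0 n : 0 <= d n by rewrite divr_ge0 ?mulr_ge0 // exprn_ge0.
have dS n : d n.+1 = d n - c / 2 ^+ n.
  rewrite /d exprS; field.
  by rewrite expf_neq0 // pnatr_eq0.
have up m n : (m <= n)%N -> x m - d m <= x n - d n /\ x n + d n <= x m + d m.
  move=> /subnK <-; elim: (n - m)%N => [|k [IH1 IH2]]; first by rewrite add0n.
  rewrite addSn; have := H (k + m)%N; rewrite ler_norml => /andP[h1 h2].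
  rewrite dS; lra.
have AB m n : x m - d m <= x n + d n.
  have [mn|nm] := leqP m n.
    by have [h _] := up m n mn; have := d0 n; lra.
  by have [_ h] := up n m (ltnW nm); have := d0 m; lra.
pose S := [set x n - d n | n in setT].
have S0 : S !=set0 by exists (x 0%N - d 0%N); exists 0%N.
have hS : has_sup S by split=> //; exists (x 0%N + d 0%N) => _ [n _ <-].
exists (sup S) => n; rewrite ler_distlC -/(d n); apply/andP; split.
  by apply: sup_upper_bound => //; exists n.
by apply: ge_sup => // _ [m _ <-].
Qed.

(* With the weight expR (lam * t), lam twice the Lipschitz constant, the Picard
   operator contracts distances by a factor 2. *)
Lemma exp_weight_step T (d : R -> R) lam c : 0 <= T -> 0 <= c -> lip 0 T d ->
  d 0 = 0 ->
  {ae mu, forall t, 0 < t < T -> exists2 d', is_derive t 1 d d' & `|d'| <= lam /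
    2 * c * expR (lam * t)} ->
  forall t, 0 <= t <= T -> `|d t| <= c / 2 * expR (lam * t).
Proof.
move=> T0 c0 ld d0 D t /andP[t0 tT].
have one (h : R -> R) : lip 0 T h -> h 0 = 0 ->
    {ae mu, forall t, 0 < t < T -> exists2 d',
      is_derive t 1 h d' & d' <= lam / 2 * c * expR (lam * t)} ->
    h t <= c / 2 * expR (lam * t).
  move=> lh h0 Dh.
  have lk : lip 0 t (fun s => h s - c / 2 * expR (lam * s)).
    by apply: lipB; [exact: lipS lh|apply: lipM; [exact: lip_cst|
      exact: lip_expR]].
  have := @lip_slope_le R 0 t 0 _ t0 lk; rewrite mul0r mulr0 expR0 h0 => H.
  suff : h t - c / 2 * expR (lam * t) - (0 - c / 2 * 1) <= 0 by lra.
  apply: H; refine (ae_imp Dh _) => s Hs /andP[s0 st].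
  have [|d' Hd' dd] := Hs; first by rewrite s0 (lt_le_trans st).
  eexists; first exact: (derB Hd' (derMl (c / 2) (is_derive_expRM lam s))).
  lra.
rewrite ler_norml lerNl; apply/andP; split.
  apply: (one (fun s => - d s)); [exact: lipN|by rewrite d0 oppr0|].
  refine (ae_imp D _) => s Hs /Hs[d' Hd' dd]; exists (- d'); first exact: derN.
  by apply: le_trans dd; rewrite -normrN ler_norm.
apply: one => //; refine (ae_imp D _) => s Hs /Hs[d' Hd' dd]; exists d' => //.
exact: le_trans (ler_norm _) dd.
Qed.

Definition trunc c x : R := Num.max (- c) (Num.min x c).

Lemma trunc_le c x : 0 <= c -> `|trunc c x| <= c.
Proof.
by move=> c0; rewrite ler_norml /trunc le_max lexx /= ge_max ge_min lexx orbT
  andbT; lra.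
Qed.

Lemma trunc_id c x : `|x| <= c -> trunc c x = x.
Proof. by rewrite ler_norml /trunc => /andP[h1 h2];
  rewrite (min_idPl h2) (max_idPr h1). Qed.

Lemma trunc_lip c x y : 0 <= c -> `|trunc c x - trunc c y| <= `|x - y|.
Proof. by move=> c0; apply: proj_lip; lra. Qed.

Lemma lip1_continuous (h : R -> R) : (forall x y, `|h x - h y| <= `|x - y|) ->
  continuous h.
Proof.
move=> H x; apply/cvgrPdist_le => e e0; exists e => //= y /ltW xy.
exact: le_trans (H x y) xy.
Qed.

Lemma trunc_continuous c p : 0 <= c -> continuous p ->
  continuous (trunc c \o p).
Proof.
move=> c0 cp x; apply: continuous_comp; first exact: cp.
by apply: lip1_continuous => y z; exact: trunc_lip.
Qed.

Lemma min0_continuous (p : R -> R) : continuous p -> continuous (fun t =>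
  p (Num.min t 0)).
Proof.
move=> cp x; apply: (@continuous_comp _ _ _ (fun t => Num.min t 0) p);
  last exact: cp.
by apply: (@continuous_min R R^o id (cst 0) x); [exact: cvg_id|exact: cvg_cst].
Qed.

(** One step of the Picard iteration: history p0 up to time 0, integral of G on [0, T], and a
    constant afterwards. The constant tail lets uniform estimates on [0, T] extend to the whole
    line. *)
Lemma primitive_extension p0 (G : R -> R) T K : 0 <= T -> 0 <= K ->
  continuous p0 ->
  measurable_fun (`]0, +oo[%classic : set R) G -> (forall t, 0 < t < T ->
    `|G t| <= K) ->
  exists p, [/\ continuous p, forall t, t <= 0 -> p t = p0 t, forall t,
    p t = p (Num.min t T),
    forall s t, 0 <= s <= T -> 0 <= t <= T -> `|p s - p t| <= K * `|s - t| &
    {ae mu, forall t, 0 < t < T -> is_derive t 1 p (G t)}].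
Proof.
move=> T0 K0 cp0 mG GK.
have mI : measurable (`]0, T[%classic : set R) by exact: measurable_itv.
have [||I [I0 lI DI]] := @antiderivative R (G \_ `]0, T[%classic) K.
- have sub : `]0, T[%classic `<=` (`]0, +oo[%classic : set R).
    by move=> t /=; rewrite !in_itv /= andbT => /andP[].
  exact: (measurable_restrictT G mI).1 (measurable_funS (measurable_itv _) sub
    mG).
- move=> t; rewrite patchE; case: ifPn => [|_]; last by rewrite normr0.
  by rewrite inE /= in_itv /=; exact: GK.
pose pr t : R := Num.max 0 (Num.min t T).
have pr0 t : 0 <= pr t by rewrite le_max lexx.
have pr_lip s t : `|pr s - pr t| <= `|s - t| by exact: proj_lip.
exists (fun t => p0 (Num.min t 0) + I (pr t)); split.
- move=> t; apply: (@continuousD _ R^o R^o (fun t =>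
  p0 (Num.min t 0)) (fun t => I (pr t))).
    exact: min0_continuous.
  apply/cvgrPdist_le => e e0; exists (e / (K + 1)) => /=; first
    by rewrite divr_gt0 // ltr_wpDl.
  move=> y /=; rewrite ltr_pdivlMr ?ltr_wpDl // => xy.
  apply: le_trans (lI _ _ (pr0 _) (pr0 _)) _.
  apply: le_trans (ltW xy); rewrite mulrC ler_pM ?lerDl //.
- move=> t t0; have -> : pr t = 0.
    by rewrite /pr (max_idPl _) // ge_min t0.
  by rewrite I0 addr0 (min_idPl t0).
- move=> t; congr (p0 _ + I _).
    by rewrite -minA (min_idPr T0).
  by rewrite /pr -minA minxx.
- move=> s t /andP[s0 sT] /andP[t0 tT].
  rewrite (min_idPr s0) (min_idPr t0) opprD addrACA subrr add0r.
  rewrite /pr (min_idPl sT) (min_idPl tT) (max_idPr s0) (max_idPr t0).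
  exact: lI.
refine (ae_imp DI _) => t Dt /[dup] tT /andP[t0 tT'].
have := Dt t0; rewrite patchE mem_set /=; last by rewrite in_itv.
move=> {}Dt.
have Dt' := derD (derC (p0 0) t) Dt; rewrite add0r in Dt'.
apply: (@is_derive_near R _ _ _ t _ (Num.min t (T - t))) Dt'.
  by rewrite lt_min t0 subr_gt0.
move=> s; rewrite lt_min !ltr_norml => /andP[/andP[s1 s2] /andP[s3 s4]].
have s0 : 0 <= s by lra.
have sT : s <= T by lra.
by rewrite (min_idPr s0) /pr (min_idPl sT) (max_idPr s0).
Qed.

End picard.

Section picard_iteration.
Variable R : realType.
Notation mu := (@lebesgue_measure R).
Implicit Types (p q : R -> R) (s t T K c : R).

Lemma measurable_f1 p q (v1 v2 : R -> R) : continuous p -> continuous q ->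
  measurable_fun setT v2 ->
  measurable_fun (`]0, +oo[%classic : set R) (fun t =>
    (f_ (segment (trj p q) t) (v1 t, v2 t)).1).
Proof.
move=> cp cq mv2; have mV := measurable_V cp cq.
have mc (h : R -> R) : continuous h -> measurable_fun (`]0,
  +oo[%classic : set R) h.
  by move=> ch; apply: (measurable_funS measurableT _
    (measurable_realfun.continuous_measurable_fun ch)).
have mv : measurable_fun (`]0, +oo[%classic : set R) v2
  by exact: (measurable_funS measurableT _ mv2).
apply: (eq_measurable_fun (fun t => - p t - p t ^+ 5 +
   16 * (1 + V_ (segment (trj p q) t)) ^+ 3 * v2 t *
   (V_ (segment (trj p q) t) - (p t ^+ 2 + q t ^+ 2) * 2^-1))).
  by move=> t _; rewrite /f_ /E_ /= /segment /trj addr0.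
apply: measurable_funD.
  apply: measurable_funB; first by apply: (measurableT_comp
    (@measurable_realfun.oppr_measurable R setT)); exact: mc.
  exact: measurable_funX (mc _ cp).
apply: measurable_funM.
  apply: measurable_funM => //; apply: measurable_funM;
    first exact: measurable_cst.
  by apply: measurable_funX; apply: measurable_funD => //;
    exact: measurable_cst.
apply: measurable_funB => //; apply: measurable_funM;
  last exact: measurable_cst.
by apply: measurable_funD; apply: measurable_funX; exact: mc.
Qed.

Lemma uniform_limit_continuous (x : nat -> R -> R) p C : (forall n,
  continuous (x n)) ->
  (forall n t, `|x n t - p t| <= C / 2 ^+ n) -> continuous p.
Proof.
move=> cx H t; apply/cvgrPdist_le => e e0.
have e3 : 0 < e / 3 by rewrite divr_gt0.
have [n Hn] := div_expr2_lt C e3.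
have /cvgrPdist_le /(_ _ e3) := cx n t.
apply: filterS => s st.
have := H n t; have := H n s; rewrite (distrC (x n t)).
have := ler_normD (p t - x n t) (x n t - x n s).
have := ler_normD (p t - x n t + (x n t - x n s)) (x n s - p s).
have -> : p t - x n t + (x n t - x n s) + (x n s - p s) = p t - p s by ring.
lra.
Qed.

(** The equation for q does not involve p, so only p is iterated, with q given. Truncating p in the
    history provides bounds K and L common to all iterates, and the exponential weight allows an
    arbitrary horizon T. *)
Lemma picard p0 q (v1 v2 : R -> R) T c r : continuous p0 -> continuous q ->
  measurable_fun setT v2 -> (forall t, enorm (v1 t, v2 t) <= r) -> 0 <= T ->
    0 <= c ->
  exists p, [/\ continuous p, forall t, t <= 0 -> p t = p0 t, lip 0 T p &
    {ae mu, forall t, 0 < t < T ->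
       is_derive t 1 p (f_ (segment (trj (trunc c \o p) q) t) (v1 t, v2 t)).1}].
Proof.
move=> cp0 cq mv2 vr T0 c0.
pose G p t := (f_ (segment (trj (trunc c \o p) q) t) (v1 t, v2 t)).1.
have [Q Q0 HQ] := segment_bounded cq cq T0.
pose M := c + Q.
have hseg p t : continuous p -> history (segment (trj (trunc c \o p) q) t).
  by move=> cp; apply: segment_history => //; exact: trunc_continuous.
have bM p t : continuous p -> 0 <= t <= T -> hnorm (segment (trj (trunc c \o p)
  q) t) <= M.
  move=> cp tT; apply: hnorm_le => th tht; apply: (le_trans (enorm_le_sum _)).
  rewrite lerD //= ?trunc_le //.
  exact: le_trans (enorm_ge2 (trj q q (t + th))) (HQ t tT th tht).
have [K K0 HK] := f_bounded (Num.max M r).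
have [L L0 HL] := f_lip (Num.max M r).
have vr' t : enorm (v1 t, v2 t) <= Num.max M r by rewrite le_max vr orbT.
have bM' p t : continuous p -> 0 <= t <= T ->
    hnorm (segment (trj (trunc c \o p) q) t) <= Num.max M r.
  by move=> cp tT; rewrite le_max bM.
have GK p t : continuous p -> 0 < t < T -> `|G p t| <= K.
  move=> cp /andP[t0 tT]; apply: le_trans (enorm_ge1 _) _.
  by apply: HK => //; [exact: hseg|apply: bM' => //; rewrite !ltW].
pose A p := [/\ continuous p, forall t, t <= 0 -> p t = p0 t, forall t,
  p t = p (Num.min t T) &
    forall s t, 0 <= s <= T -> 0 <= t <= T -> `|p s - p t| <= K * `|s - t| ].
pose Phi p p' := A p' /\ {ae mu, forall t, 0 < t < T ->
  is_derive t 1 p' (G p t)}.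
have exPhi p : exists p', continuous p -> Phi p p'.
  have [cp|ncp] := pselect (continuous p); last by exists p.
  have mG : measurable_fun (`]0, +oo[%classic : set R) (G p).
    by apply: measurable_f1 => //; exact: trunc_continuous.
  have [p' [h1 h2 h3 h4 h5]] := primitive_extension T0 K0 cp0 mG (fun t =>
    @GK p t cp).
  by exists p'; split.
have [Gam HGam] := choice exPhi.
pose lam := 2 * L.
have lam0 : 0 <= lam by rewrite mulr_ge0.
have contr p p1 a : A p -> A p1 -> 0 <= a ->
    (forall t, 0 <= t <= T -> `|p t - p1 t| <= a * expR (lam * t)) ->
    forall t, 0 <= t <= T -> `|Gam p t - Gam p1 t| <= a / 2 * expR (lam * t).
  move=> [cp pp0 _ _] [cp1 p1p0 _ _] a0 Ha.
  have [[_ g0 _ gl] gd] := HGam p cp; have [[_ g10 _ g1l] g1d] := HGam p1 cp1.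
  apply: (@exp_weight_step R T (fun t => Gam p t - Gam p1 t) lam a) => //.
  - apply: lipB; by exists K.
  - by rewrite g0 // g10 // subrr.
  refine (ae_imp2 gd g1d _) => t Dt D1t tT; exists (G p t - G p1 t).
    by apply: derB; [exact: Dt|exact: D1t].
  case/andP: tT => t0 tT; have tI : 0 <= t <= T by rewrite !ltW.
  apply: le_trans (enorm_ge1 (f_ _ _ - f_ _ _)) _.
  apply: le_trans (HL _ _ _ (hseg p t cp) (hseg p1 t cp1) (bM' p t cp tI) (bM'
    p1 t cp1 tI) (vr' t)) _.
  have -> : lam / 2 = L by rewrite /lam; field.
  rewrite -mulrA ler_wpM2l //; apply: hnorm_le => th /andP[th1 th0].
  apply: (le_trans (enorm_le_sum _)); rewrite /= subrr normr0 addr0.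
  apply: (le_trans (trunc_lip _ _ c0)).
  have [tt|tt] := leP (t + th) 0.
    by rewrite pp0 // p1p0 // subrr normr0 mulr_ge0 // expR_ge0.
  apply: (le_trans (Ha _ _)); first by apply/andP; split; lra.
  rewrite ler_wpM2l // ler_expR ler_wpM2l //; lra.
pose x n := iter n Gam (fun t => p0 (Num.min t 0)).
have Ax n : A (x n).
  elim: n => [|n [cx _ _ _]]; last by have [] := HGam _ cx.
  split=> /=.
  - exact: min0_continuous.
  - by move=> t t0; rewrite (min_idPl t0).
  - by move=> t; congr p0; rewrite -minA (min_idPr T0).
  - move=> s t /andP[s0 _] /andP[t0 _].
    by rewrite (min_idPr s0) (min_idPr t0) subrr normr0 mulr_ge0.
(* The first two iterates agree at 0 and each moves by at most K * T. *)
pose a := K * T + K * T.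
have KT0 : 0 <= K * T by rewrite mulr_ge0.
have a0 : 0 <= a by rewrite addr_ge0.
have step n t : 0 <= t <= T -> `|x n.+1 t - x n t| <= a / 2 ^+ n * expR (lam *
  t).
  elim: n t => [|n IH] t tT.
    have [_ e1 _ l1] := Ax 1%N; have [_ e0 _ l0] := Ax 0%N.
    have z : 0 <= (0 : R) <= T by rewrite lexx.
    have h1 := l1 t 0 tT z; have h0 := l0 t 0 tT z.
    have -> : x 1%N t - x 0%N t = (x 1%N t - x 1%N 0) - (x 0%N t - x 0%N 0).
      have -> : x 1%N 0 = x 0%N 0 by rewrite (e1 0 (lexx _)) (e0 0 (lexx _)).
      by ring.
    apply: (le_trans (ler_normB _ _)).
    apply: (@le_trans _ _ a).
      case/andP: tT => t0 tT; move: h1 h0; rewrite subr0 [`|t|]ger0_norm // =>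
        h1 h0.
      by apply: lerD; [apply: le_trans h1 _|apply: le_trans h0 _];
        rewrite ler_wpM2l.
    rewrite expr0 divr1 ler_peMr // -expR0 ler_expR mulr_ge0 //;
      by case/andP: tT.
  have -> : a / 2 ^+ n.+1 = a / 2 ^+ n / 2.
    by rewrite exprSr invfM mulrA.
  have an0 : 0 <= a / 2 ^+ n by rewrite divr_ge0 // exprn_ge0.
  exact: contr (Ax n.+1) (Ax n) an0 IH t tT.
pose C := a * expR (lam * T).
have all_t (p p1 : R -> R) B : A p -> A p1 -> 0 <= B -> (forall t,
  0 <= t <= T -> `|p t - p1 t| <= B) ->
    forall t, `|p t - p1 t| <= B.
  move=> [_ e0 m0 _] [_ e1 m1 _] B0 H t.
  have [t0|t0] := leP t 0; first by rewrite e0 // e1 // subrr normr0.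
  rewrite m0 m1; apply: H; rewrite le_min (ltW t0) T0 /= ge_min lexx orbT //.
have stepC n t : `|x n.+1 t - x n t| <= C / 2 ^+ n.
  apply: all_t => // {t}.
    by rewrite divr_ge0 ?exprn_ge0 // mulr_ge0 // expR_ge0.
  move=> t /[dup] tT /andP[t0 t1]; apply: (le_trans (step n t tT)).
  rewrite /C mulrAC ler_wpM2r ?invr_ge0 ?exprn_ge0 // ler_wpM2l // ler_expR
    ler_wpM2l //.
have [p Hp] := choice (fun t => geometric_limit (fun n => stepC n t)).
have Ap : A p.
  split.
  - by apply: (uniform_limit_continuous (fun n => let: And4 c _ _ _ :=
    Ax n in c) (fun n t => Hp t n)).
  - move=> t t0; apply/eqP; rewrite -subr_eq0; apply/eqP.
    apply: (@le_div_expr2_eq0 R _ (2 * C)) => n; rewrite distrC.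
    by have := Hp t n; have [_ e _ _] := Ax n; rewrite e.
  - move=> t; apply/eqP; rewrite -subr_eq0; apply/eqP.
    apply: (@le_div_expr2_eq0 R _ (2 * C + 2 * C)) => n.
    have [_ _ e _] := Ax n.
    have -> : p t - p (Num.min t T) = (x n (Num.min t T) - p (Num.min t T)) - (x
      n t - p t).
      by rewrite -e; ring.
    by rewrite mulrDl (le_trans (ler_normB _ _)) // lerD.
  - move=> s t sT tT; apply/ler_addgt0Pr => e e0.
    have [n Hn] := div_expr2_lt (2 * C + 2 * C) e0.
    have [_ _ _ l] := Ax n.
    have -> : p s - p t = (x n s - x n t) + ((x n t - p t) - (x n s - p s))
      by ring.
    apply: (le_trans (ler_normD _ _)); apply: lerD; first exact: l.
    apply: le_trans (ltW Hn).
    by rewrite mulrDl (le_trans (ler_normB _ _)) // lerD.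
have cp : continuous p by case: Ap.
have [AG DG] := HGam p cp.
have C0 : 0 <= C by rewrite mulr_ge0 // expR_ge0.
(* [Gam p] is close to [x n.+1] by contraction, and [x n.+1] to p by convergence. *)
have fix_p t : Gam p t = p t.
  apply/eqP; rewrite -subr_eq0; apply/eqP.
  apply: (@le_div_expr2_eq0 R _ (C * expR (lam * T) + C)) => n.
  have B0 : 0 <= 2 * C / 2 ^+ n by rewrite divr_ge0 ?exprn_ge0 // mulr_ge0.
  have h1 s : 0 <= s <= T -> `|p s - x n s| <= 2 * C / 2 ^+ n * expR (lam * s).
    move=> /andP[s0 _]; rewrite distrC; apply: (le_trans (Hp s n)).
    by rewrite ler_peMr // -expR0 ler_expR mulr_ge0.
  have h2 : `|Gam p t - x n.+1 t| <= C * expR (lam * T) / 2 ^+ n.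
    apply: all_t => //.
      by rewrite divr_ge0 ?exprn_ge0 // mulr_ge0 ?expR_ge0.
    move=> s /[dup] sT /andP[s0 s1]; apply: (le_trans (contr _ _ _ Ap (Ax n) B0
      h1 s sT)).
    have -> : 2 * C / 2 ^+ n / 2 * expR (lam * s) = C * expR (lam * s) / 2 ^+ n.
      by field; rewrite expf_neq0 // pnatr_eq0.
    rewrite ler_wpM2r ?invr_ge0 ?exprn_ge0 // ler_wpM2l // ler_expR ler_wpM2l
      //.
  have h3 := Hp t n.+1.
  have h4 : 2 * C / 2 ^+ n.+1 = C / 2 ^+ n.
    by rewrite exprS; field; rewrite expf_neq0 // pnatr_eq0.
  rewrite h4 in h3.
  have := ler_normD (Gam p t - x n.+1 t) (x n.+1 t - p t).
  by rewrite addrA subrK mulrDl => /le_trans; apply; exact: lerD.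
exists p; case: Ap => _ e0 _ l0; split=> //; first by exists K.
refine (ae_imp DG _) => t Dt tT; have {}Dt := Dt tT.
have E : Gam p = p by apply/funext.
by rewrite E in Dt.
Qed.

End picard_iteration.

Section existence.
Variable R : realType.
Notation mu := (@lebesgue_measure R).
Implicit Types (p q : R -> R) (s t T K c r : R) (u phi : R -> plane R).

(** Variation of constants: expR t * q t has derivative expR t * v1 t. *)
Lemma linear_solution q0 (v1 : R -> R) T r : continuous q0 ->
  measurable_fun setT v1 ->
  (forall t, `|v1 t| <= r) -> 0 <= T ->
  exists q, [/\ continuous q, forall t, t <= 0 -> q t = q0 t, lip 0 T q &
    {ae mu, forall t, 0 < t < T -> is_derive t 1 q (- q t + v1 t)}].
Proof.
move=> cq0 mv vr T0.
have r0 : 0 <= r := le_trans (normr_ge0 _) (vr 0).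
have mG : measurable_fun (`]0, +oo[%classic : set R) (fun t => expR t * v1 t).
  apply: measurable_funM; last exact: (measurable_funS measurableT _ mv).
  by apply: (measurable_funS measurableT _ (continuous_measurable_fun
    (@continuous_expR R))).
have GK t : 0 < t < T -> `|expR t * v1 t| <= expR T * r.
  move=> /andP[_ tT]; rewrite normrM ler_pM // ger0_norm ?expR_ge0 // ler_expR.
  exact: ltW.
have K0 : 0 <= expR T * r by rewrite mulr_ge0 // expR_ge0.
have cc : continuous (fun _ : R => q0 0) by move=> x; exact: cvg_cst.
have [J [cJ J0 _ lJ DJ]] := primitive_extension T0 K0 cc mG GK.
(* For t <= 0 the exponential is 1 and J t = q0 0, so q is the history; for t >= 0 the first two
   terms cancel. *)
pose q t := q0 (Num.min t 0) - q0 0 + expR (-1 * Num.max t 0) * J t.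
have qE t : 0 <= t -> q t = expR (-1 * t) * J t.
  by move=> t0; rewrite /q (min_idPr t0) subrr add0r (max_idPl t0).
have lJ' : lip 0 T J by exists (expR T * r).
exists q; split.
- move=> t; apply: (@continuousD _ R^o R^o (fun t => q0 (Num.min t 0) - q0 0)).
    apply: (@continuousB _ R^o R^o); last exact: cvg_cst.
    exact: min0_continuous.
  apply: (@continuousM _ R^o (fun t => expR (-1 * Num.max t 0)));
    last exact: cJ.
  apply: (@continuous_comp _ _ _ (fun t => -1 * Num.max t 0) expR);
    last exact: continuous_expR.
  apply: (@continuousM _ R^o (cst (-1)) (fun t => Num.max t 0));
    first exact: cvg_cst.
  by apply: (@continuous_max R R^o id (cst 0) t); [exact: cvg_id|
    exact: cvg_cst].
- move=> t t0; rewrite /q (min_idPl t0) (max_idPr t0) mulr0 expR0 mul1r J0 //.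
  by rewrite subrK.
- apply: (eq_lip (f := fun t => expR (-1 * t) * J t)); first
  by move=> t /andP[t0 _]; rewrite qE.
  by apply: lipM => //; exact: lip_expR.
refine (ae_imp DJ _) => t Dt /[dup] /andP[t0 tT] /Dt {}Dt.
have D := derM (is_derive_expRM (-1) t) Dt.
apply: (@is_derive_near R _ _ _ t _ t t0 _ (is_derive_eq D _)).
  by move=> s; rewrite ltr_norml => /andP[s1 s2]; rewrite qE //; lra.
rewrite qE ?(ltW t0) // mulrA -expRD mulN1r addNr expR0; ring.
Qed.

(* The equation truncated at level c has a global solution, and the growth bound
   on V keeps p below c, so that the truncation is never active. *)
Lemma local_existence phi u T : history phi -> is_input u -> 0 <= T ->
  exists p q, solves_on T p q u /\ forall th, -1 <= th <= 0 -> phi th = (p th,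
    q th).
Proof.
move=> hphi iu T0.
have [p0 [q0 [cp0 cq0 phiE]]] := history_trj hphi.
have [v1 [v2 [mv1 mv2 uv]]] := borel_version iu.
have [_ /(_ T T0)/ess_norm_lty[r r0 /ess_norm_leP ur]] := iu.
(* The Borel version is bounded only almost everywhere on [0, T]; truncation bounds it everywhere
   without affecting the equation. *)
pose w1 := trunc r \o v1; pose w2 := trunc r \o v2.
have mw (v : R -> R) : measurable_fun setT v ->
  measurable_fun setT (trunc r \o v).
  move=> mv; apply: (@measurableT_comp _ _ _ _ _ _ (trunc r) _ v) => //.
  by apply: continuous_measurable_fun; apply: lip1_continuous => x y;
    exact: trunc_lip.
have uw : {ae mu, forall t, 0 < t < T -> u t = (w1 t,
  w2 t) /\ enorm (u t) <= r}.
  refine (ae_imp2 uv ur _) => t /[swap] + + /andP[t0 tT].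
  rewrite /= in_itv /= (ltW t0) (ltW tT) => /(_ isT) h1 /(_ isT) h2.
  split=> //; rewrite h2 /w1 /w2 /= !trunc_id //.
    by apply: le_trans h1; rewrite h2; exact: (enorm_ge2 (v1 t, v2 t)).
  by apply: le_trans h1; rewrite h2; exact: (enorm_ge1 (v1 t, v2 t)).
have [q [cq qE lq Dq]] := linear_solution cq0 (mw _ mv1) (fun t =>
  trunc_le (v1 t) r0) T0.
have [M0 M00 HM0] := history_bounded hphi.
pose W := V_ phi + r ^+ 2 * T.
have W0 : 0 <= W by rewrite addr_ge0 ?V_ge0 // mulr_ge0 // sqr_ge0.
(* M0 covers the history. If the modulus of p reached c, then c <= c^2 <= p^2 <= 2 V <= 2 W < c,
   where the first inequality uses c >= 1. *)
pose c := 1 + 2 * W + M0.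
have c1 : 1 <= c by rewrite /c; lra.
have c0 : 0 <= c by lra.
have wr t : enorm (w1 t, w2 t) <= r + r.
  by apply: (le_trans (enorm_le_sum _)); rewrite lerD // trunc_le.
have [p [cp pE lp Dp]] := picard cp0 cq (mw _ mv2) wr T0 c0.
have pqE th : -1 <= th <= 0 -> phi th = (p th, q th).
  by move=> /[dup] tht /andP[_ t0]; rewrite phiE // pE // qE.
have neg t : -1 <= t <= 0 -> `|p t| <= c.
  move=> tt; have := le_trans (enorm_ge1 _) (HM0 t tt); rewrite pqE //= =>
    /le_trans; apply.
  by rewrite /c; lra.
have sol t1 : 0 <= t1 <= T -> (forall t, 0 < t < t1 -> `|p t| <= c) ->
  solves_on t1 p q u.
  move=> /andP[t10 t1T] pc; split=> //.
  - exact: lipS lp.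
  - exact: lipS lq.
  refine (ae_imp2 uw (ae_imp2 Dp Dq (fun t h k => conj h k)) _) =>
    t ut [pt qt] /andP[t0 tt1].
  have tT : 0 < t < T by rewrite t0 (lt_le_trans tt1).
  have [uE _] := ut tT.
  have <- : f_ (segment (trj (trunc c \o p) q) t) (u t) = f_ (segment (trj p q)
    t) (u t).
    apply: eq_f => th /andP[th1 th0]; rewrite /segment /trj /= trunc_id //.
    have [h|h] := leP (t + th) 0; first by apply: neg; clear -h th1 t0;
      apply/andP; split; lra.
    by apply: pc; clear -h th0 tt1; apply/andP; split; lra.
  apply/is_derive_pair; split; first by rewrite uE; exact: pt.
  by rewrite uE /f_ /= /segment /trj /= addr0; exact: qt.
exists p, q; split=> //; apply: (sol T); first by rewrite T0 lexx.
suff H t : 0 <= t <= T -> `|p t| < c.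
  by move=> t /andP[t0 tT]; apply: ltW; apply: H; rewrite !ltW.
rewrite ltNge => tT; apply/negP => ct.
(* Its infimum t1 is the first time at which p reaches level c. Before t1 the truncation is
   inactive, so the growth bound for the true equation holds up to t1. *)
pose S := [set t | 0 <= t <= T /\ c <= `|p t|].
have hS : has_inf S by split; [exists t|exists 0 => x [/andP[]]].
pose t1 := inf S.
have t10 : 0 <= t1 by apply: lb_le_inf; [exists t|move=> x [/andP[]]].
have t1T : t1 <= T by apply: le_trans (_ : t <= T); [apply: ge_inf => //;
  exact: hS.2|case/andP: tT].
have ct1 : c <= `|p t1|.
  have [K K0 HK] := lp; apply/ler_addgt0Pr => e e0.
  have [|x [xT cx] xt1] := @inf_adherent _ S (e / (K + 1)) _ hS.
    by rewrite divr_gt0 // ltr_wpDl.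
  have t1x : t1 <= x by apply: ge_inf; [exact: hS.2|split].
  have := HK x t1 xT; rewrite t10 t1T => /(_ isT).
  rewrite [`|x - t1|]ger0_norm ?subr_ge0 // => h.
  have : K * (x - t1) <= e.
    apply: (@le_trans _ _ ((K + 1) * (x - t1))).
      by rewrite ler_wpM2r ?subr_ge0 // lerDl.
    rewrite mulrC -ler_pdivlMr ?ltr_wpDl //.
    by move: xt1; rewrite -/t1; lra.
  have := ler_normD (p x - p t1) (p t1); rewrite subrK; lra.
have pc s : 0 < s < t1 -> `|p s| <= c.
  move=> /andP[s0 st1]; apply: ltW; rewrite ltNge; apply/negP => cs.
  have : t1 <= s.
    by apply: ge_inf; [exact: hS.2|split=> //;
      rewrite (ltW s0) (le_trans (ltW st1))].
  by rewrite leNgt st1.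
have t1I : 0 <= t1 <= T by rewrite t10.
have ur1 : {ae mu, forall s, 0 < s < t1 -> enorm (u s) <= r}.
  refine (ae_imp uw _) => s h /andP[s0 st]; have [|_ //] := h.
  by rewrite s0 (lt_le_trans st).
have := solves_on_V_le t10 r0 (sol t1 t1I pc) ur1.
have -> : V_ (segment (trj p q) 0) = V_ phi.
  by apply: eq_V => th tht; rewrite /segment /trj add0r pqE.
have := C_le_V (@segment_history R p q t1 cp cq).
rewrite /segment /trj addr0 /=.
have : r ^+ 2 * t1 <= r ^+ 2 * T by rewrite ler_wpM2l // sqr_ge0.
have : c ^+ 2 <= p t1 ^+ 2 by rewrite -[leRHS]real_normK ?num_real // ler_sqr
  ?nnegrE.
have : c <= c ^+ 2 by rewrite expr2 ler_peMr.
have := sqr_ge0 (q t1); rewrite /c /W; lra.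
Qed.

(** By induction on n, the difference is at most a / 2^n times the exponential weight. Here lam is 4
    L, against 2 L in the Picard iteration, because both components contribute to the distance
    between the histories. *)
Lemma solves_on_unique T r p q p' q' u : 0 <= T -> solves_on T p q u ->
  solves_on T p' q' u ->
  {ae mu, forall t, 0 < t < T -> enorm (u t) <= r} ->
  (forall th, -1 <= th <= 0 -> trj p q th = trj p' q' th) ->
  forall t, 0 <= t <= T -> trj p q t = trj p' q' t.
Proof.
move=> T0 [cp cq lp lq D] [cp' cq' lp' lq' D'] ur e0.
have [M _ HM] := segment_bounded cp cq T0; have [M' _ HM'] :=
  segment_bounded cp' cq' T0.
pose B := Num.max (Num.max M M') r.
have [L L0 HL] := f_lip B.
pose lam := 4 * L; have lam0 : 0 <= lam by rewrite mulr_ge0.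
have ld1 : lip 0 T (fun t => p t - p' t) by exact: lipB.
have ld2 : lip 0 T (fun t => q t - q' t) by exact: lipB.
have [N1 N10 HN1] := lip_bounded ld1; have [N2 N20 HN2] := lip_bounded ld2.
have z01 : -1 <= (0 : R) <= 0 by rewrite lexx oppr_le0 ler01.
have d10 : p 0 - p' 0 = 0 by have [-> _] := e0 0 z01; rewrite subrr.
have d20 : q 0 - q' 0 = 0 by have [_ ->] := e0 0 z01; rewrite subrr.
pose a := N1 + N2; have a0 : 0 <= a by rewrite addr_ge0.
have key n : forall t, 0 <= t <= T ->
   `|p t - p' t| <= a / 2 ^+ n * expR (lam * t) /\ `|q t - q' t| <= a / 2 ^+ n *
     expR (lam * t).
  elim: n => [|n IH].
    move=> t /[dup] tT /andP[t0 _]; rewrite expr0 divr1.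
    have h : a <= a * expR (lam * t) by rewrite ler_peMr // -expR0 ler_expR
      mulr_ge0.
    by split; apply: le_trans h; [apply: (le_trans (HN1 t tT))|
      apply: (le_trans (HN2 t tT))]; rewrite ?lerDl ?lerDr.
  have an0 : 0 <= a / 2 ^+ n by rewrite divr_ge0 // exprn_ge0.
  have DD : {ae mu, forall t, 0 < t < T -> exists d d' : plane R,
      [/\ is_derive t 1 (trj p q) d, is_derive t 1 (trj p' q') d' &
          enorm (d - d') <= lam / 2 * (a / 2 ^+ n) * expR (lam * t)]}.
    refine (ae_imp2 ur (ae_imp2 D D' (fun t h k => conj h k)) _) =>
      t ut [Dt D't] /[dup] tT /andP[t0 tT'].
    exists (f_ (segment (trj p q) t) (u t)), (f_ (segment (trj p' q') t) (u t)).
    split; [exact: Dt|exact: D't|].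
    have tI : 0 <= t <= T by rewrite !ltW.
    apply: le_trans (HL _ _ _ _ _ _ _ _) _.
    - exact: segment_history.
    - exact: segment_history.
    - by rewrite /B !le_max hnorm_le //; exact: HM.
    - by rewrite /B !le_max [X in _ || X || _]hnorm_le ?orbT //; exact: HM'.
    - by rewrite /B le_max ut ?orbT.
    move: (a / 2 ^+ n) an0 IH => X X0 IH.
    have -> : lam / 2 * X * expR (lam * t) = L * (2 * (X * expR (lam * t))).
      by rewrite /lam; field.
    rewrite ler_wpM2l //; apply: hnorm_le => th /andP[th1 th0].
    apply: (le_trans (enorm_le_sum _)) => /=.
    have [tt|tt] := leP (t + th) 0.
      have hh : -1 <= t + th <= 0 by clear -tt th1 t0; apply/andP; split; lra.
      have [-> ->] := e0 _ hh.
      by rewrite !subrr normr0 addr0 !mulr_ge0 // expR_ge0.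
    have [|h1 h2] := IH (t + th).
      by clear -tt th0 tT'; apply/andP; split; lra.
    have ee : expR (lam * (t + th)) <= expR (lam * t)
      by rewrite ler_expR ler_wpM2l //; clear -th0; lra.
    have := ler_wpM2l X0 ee; clear -h1 h2; lra.
  have half : a / 2 ^+ n.+1 = a / 2 ^+ n / 2 by rewrite exprSr invfM mulrA.
  move=> t tT; rewrite half; split.
    apply: (@exp_weight_step R T (fun t => p t - p' t)) => // {t tT}.
    refine (ae_imp DD _) => t h /h[d [d' [/is_derive_pair[h1 _]
      /is_derive_pair[h2 _] h3]]].
    exists (d.1 - d'.1); first exact: derB h1 h2.
    by apply: le_trans h3; exact: (enorm_ge1 (d - d')).
  apply: (@exp_weight_step R T (fun t => q t - q' t)) => // {t tT}.
  refine (ae_imp DD _) => t h /h[d [d' [/is_derive_pair[_ h1] /is_derive_pair[_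
    h2] h3]]].
  exists (d.2 - d'.2); first exact: derB h1 h2.
  by apply: le_trans h3; exact: (enorm_ge2 (d - d')).
move=> t tT; rewrite /trj.
have -> : p t = p' t.
  apply/eqP; rewrite -subr_eq0; apply/eqP.
  apply: (@le_div_expr2_eq0 R _ (a * expR (lam * t))) => n.
  by rewrite mulrAC; have [] := key n t tT.
suff -> : q t = q' t by [].
apply/eqP; rewrite -subr_eq0; apply/eqP.
apply: (@le_div_expr2_eq0 R _ (a * expR (lam * t))) => n.
by rewrite mulrAC; have [] := key n t tT.
Qed.

End existence.

(** * Global solutions, forward completeness and the hypotheses of the conjecture *)

Section forward_completeness.
Variable R : realType.
Notation mu := (@lebesgue_measure R).
Implicit Types (p q : R -> R) (s t T K c r : R) (u phi x : R -> plane R).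

Lemma near_eq_continuous (f g : R -> plane R) t eta : 0 < eta -> (forall s,
  `|s - t| < eta -> f s = g s) ->
  {for t, continuous g} -> {for t, continuous f}.
Proof.
move=> eta0 fg cg; have e : f t = g t by apply: fg; rewrite subrr normr0.
move=> U; rewrite /= e => HU.
have gU : nbhs t (fun s => U (g s)) by exact: (cg U HU).
have n1 : nbhs t (fun s => `|s - t| < eta).
  by exists eta => //= s; rewrite /ball_ /= distrC.
have : nbhs t (fun s => U (f s)) by apply: filterS2 gU n1 => s h1 /fg ->.
exact.
Qed.

(** Solutions with integer horizons agree on overlaps by uniqueness, and are glued by using at time
    t a horizon beyond t. Their exceptional null sets form a countable family. *)
Lemma solution_exists phi u : history phi -> is_input u -> exists x,
  is_solution (@f_ R) phi u x.
Proof.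
move=> hphi iu.
have [P HP] := choice (fun N : nat => local_existence hphi iu (ler0n R N)).
have [Q HQ] := choice HP.
pose y M := trj (P M) (Q M).
have yphi M th : -1 <= th <= 0 -> y M th = phi th by move=> tht; have [_ ->] :=
  HQ M.
have agree M N t : -1 <= t <= M%:R -> -1 <= t <= N%:R -> y M t = y N t.
  wlog MN : M N / (M <= N)%N.
    move=> H h1 h2; have [MN|/ltnW NM] := leqP M N; first exact: H.
    by apply/esym; apply: H.
  move=> /andP[t1 tM] /andP[_ tN].
  have [t0|/ltW t0] := leP t 0; first by rewrite !yphi ?t1.
  have [_ /(_ M%:R (ler0n R M))/ess_norm_lty[r r0 /ess_norm_leP ur]] := iu.
  have sN : solves_on M%:R (P N) (Q N) u by apply: solves_onS (HQ N).1;
    rewrite ler_nat.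
  apply: (solves_on_unique (ler0n R M) (HQ M).1 sN (r := r)).
  - refine (ae_imp ur _) => s h /andP[s0 sM]; apply: h.
    by rewrite /= in_itv /= (ltW s0) (ltW sM).
  - by move=> th tht; rewrite [LHS]yphi // [RHS]yphi.
  - by rewrite t0.
pose pr t : R := Num.max t (-1).
have pr1 t : -1 <= pr t by rewrite le_max lexx orbT.
pose N t := Num.bound `|t|.
have Nt t : t < (N t)%:R.
  by apply: le_lt_trans (ler_norm t) _; exact: archi_boundP.
pose x t := y (N t) (pr t).
have prE t : -1 <= t -> pr t = t by move=> h; rewrite /pr (max_idPl h).
have prN t : pr t <= (N t)%:R by rewrite /pr ge_max (ltW (Nt t)) (le_trans _
  (ler0n R _)) // oppr_le0.
have xE M t : t <= M%:R -> x t = y M (pr t).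
  move=> tM; apply: agree; rewrite pr1 ?prN //=.
  by rewrite /pr ge_max tM (le_trans _ (ler0n R _)) // oppr_le0.
have cpr : continuous pr.
  by move=> t; apply: (@continuous_max R R^o id (cst (-1)) t);
    [exact: cvg_id|exact: cvg_cst].
exists x; split.
- by move=> t; rewrite in_itv /= => /[dup] tt /andP[t1 _];
  rewrite /x prE // yphi.
- apply: continuous_subspaceT => t.
  pose M := (N t).+1.
  apply: (@near_eq_continuous _ (y M \o pr) _ 1) => //.
    move=> s; rewrite ltr_norml => /andP[_ s2]; apply: xE.
    by rewrite /M -natr1; have := Nt t; lra.
  apply: continuous_comp; first exact: cpr.
  by have [[cP cQ _ _ _] _] := HQ M; exact: trj_continuous.
- move=> b b0 e e0.
  have [[_ _ lP lQ _] _] := HQ (N b).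
  have {}lP : lip 0 b (P (N b)) by apply: lipS lP => //; exact: ltW.
  have {}lQ : lip 0 b (Q (N b)) by apply: lipS lQ => //; exact: ltW.
  have e2 : 0 < e / 2 by rewrite divr_gt0.
  have [d1 d10 H1] := lip_abs_cont lP e2; have [d2 d20 H2] :=
    lip_abs_cont lQ e2.
  exists (Num.min d1 d2); first by rewrite lt_min d10.
  move=> n I HI tI; rewrite lt_min => /andP[s1 s2].
  have h1 := H1 n I HI tI s1; have h2 := H2 n I HI tI s2.
  have xI t : 0 <= t <= b -> x t = (P (N b) t, Q (N b) t).
    move=> /andP[t0 tb]; rewrite (xE (N b)) ?(le_trans tb (ltW (Nt b))) // prE
      //.
    by apply: le_trans t0; rewrite oppr_le0.
  apply: (@le_lt_trans _ _ (\sum_(i < n) (`|P (N b) (I i).2 - P (N b) (I i).1| +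
      `|Q (N b) (I i).2 - Q (N b) (I i).1|))).
    apply: ler_sum => i _; have [a1 a2 a3] := HI i.
    rewrite !xI ?a3 ?a1 ?(le_trans a1 a2) ?(le_trans a2 a3) //.
    exact: enorm_le_sum.
  by rewrite big_split /=; lra.
- have D : {ae mu, forall t, forall M : nat, 0 < t < M%:R ->
     is_derive t 1 (y M) (f_ (segment (y M) t) (u t))}.
    by apply/ae_foralln => M; have [[_ _ _ _ h] _] := HQ M.
  (* The equation is asked for t >= 0 with a two-sided derivative, which the initial history need
     not admit at 0. *)
  have N0 : {ae mu, forall t, t != 0}.
    exists [set 0]; split; first exact: measurable_set1.
      exact: lebesgue_measure_set1.
    by move=> t /= /negP /negPn /eqP ->.
  refine (ae_imp2 D N0 _) => t Dt tn0 t0; have {tn0}t0 : 0 < t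
    by rewrite lt_neqAle eq_sym tn0.
  pose M := (N t).+1; have tM : t + 1 < M%:R by rewrite /M -natr1; have :=
    Nt t; lra.
  have [|d e] := Dt M; first by rewrite t0; lra.
  have <- : f_ (segment (y M) t) (u t) = f_ (segment x t) (u t).
    apply: eq_f => th /andP[th1 th0]; rewrite /segment (xE M) ?prE //; lra.
  apply: (@is_derive_near R _ (y M) x t _ (Num.min 1 t));
    [by rewrite lt_min ltr01| |].
    move=> s; rewrite lt_min !ltr_norml => /andP[/andP[s1 s2] /andP[s3 s4]].
    by rewrite (xE M) ?prE //; lra.
  by split.
Qed.

Lemma f_robustly_forward_complete : robustly_forward_complete (@f_ R).
Proof.
split; first exact: solution_exists.
move=> r T r0 T0; pose W := 3 / 2 * r ^+ 2 + r ^+ 2 * T.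
apply: (@le_lt_trans _ _ (1 + 2 * W)%:E); last exact: ltry.
apply: ge_ereal_sup => _ [phi [u [x [t [[hp pr] [iu ur] sx /andP[t0 tT] ->]]]]].
rewrite lee_fin.
have := @solution_bound R phi u x r t (ltW r0) t0 iu sx => H.
have {H} : enorm (x t) ^+ 2 / 2 <= V_ phi + r ^+ 2 * t.
  apply: H; refine (ae_imp (ess_norm_leP ur) _) => s h /andP[s0 _]; apply: h.
  by rewrite /= in_itv /= (ltW s0).
have h1 : V_ phi <= 3 / 2 * r ^+ 2.
  have /andP[_ /le_trans] := V_bounds hp; apply.
  by rewrite ler_wpM2l // ler_sqr ?nnegrE ?hnorm_ge0 // ltW.
have h2 : r ^+ 2 * t <= r ^+ 2 * T by rewrite ler_wpM2l // sqr_ge0.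
have := enorm_ge0 (x t); have := sqr_ge0 (enorm (x t) - 1); rewrite /W; lra.
Qed.

Lemma dissipation_le (phi : R -> plane R) (p q a b : R) : phi 0 = (p, q) ->
  - p ^+ 2 - q ^+ 2 / 2 + a ^+ 2 <= - (enorm (phi 0) ^+ 2 / 2) + enorm (a,
    b) ^+ 2.
Proof.
by move=> ->; rewrite !enorm_sq /=; have := sqr_ge0 p; have := sqr_ge0 b; lra.
Qed.

Lemma sqr_class_Koo c : 0 < c -> class_Koo (fun r : R => c * r ^+ 2).
Proof.
move=> c0; split.
  split.
  - by rewrite expr0n mulr0.
  - apply: continuous_subspaceT => t; apply: (@continuousM _ R^o (cst c) (fun r
    => r ^+ 2)).
      exact: cvg_cst.
    exact: exprn_continuous.
  - by move=> r s r0 rs; rewrite ltr_pM2l // ltr_sqr ?nnegrE // (le_trans r0) //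
    ltW.
move=> M; pose s := 1 + `|M| / c.
have s0 : 0 <= `|M| / c by rewrite divr_ge0 // ltW.
exists s; first by rewrite /s; lra.
apply: (le_lt_trans (ler_norm M)).
rewrite -ltr_pdivrMl // mulrC /s; nra.
Qed.

Lemma sqr_class_N : class_N (fun r : R => r ^+ 2).
Proof.
split; first by rewrite expr0n.
- apply: continuous_subspaceT => t; exact: exprn_continuous.
- by move=> r s r0 rs; rewrite ler_sqr ?nnegrE // (le_trans r0).
Qed.

Lemma f_V_conjecture_hypotheses : conjecture_hypotheses (@f_ R) (@V_ R).
Proof.
split.
- exact: f_lipschitz_field.
- exact: f_zero.
- by split; [exact: V_ge0|exact: V_lipschitz_functional].
- exists (fun r => 2^-1 * r ^+ 2), (fun r => 3 / 2 * r ^+ 2).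
  split; [exact: sqr_class_Koo|by apply: sqr_class_Koo; rewrite divr_gt0|].
  by move=> phi hp; rewrite [2^-1 * _]mulrC; exact: V_bounds.
- exists (fun r => 2^-1 * r ^+ 2), (fun r => r ^+ 2).
  split; [exact: sqr_class_Koo|exact: sqr_class_N|].
  move=> phi [a b] hp; case e : (phi 0) => [p q].
  apply: (le_trans (driver_derivative_le a b hp e)); rewrite lee_fin -e.
  by rewrite [2^-1 * _]mulrC; exact: dissipation_le.
Qed.

End forward_completeness.

(** * One period of the switching input *)

Section phases.
Variable R : realType.
Notation mu := (@lebesgue_measure R).
Implicit Types (p q P : R -> R) (s t e : R).

Lemma relaxation_unique (a b : R) (d : R -> R) : lip a b d -> d a = 0 ->
  {ae mu, forall t, a < t < b -> is_derive t 1 d (- d t)} ->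
  forall t, a <= t <= b -> d t = 0.
Proof.
move=> ld d0 D t /andP[at_ tb].
have := @lip_slope_le R a t 0 (fun s => d s ^+ 2) at_ (lipX 2 (lipS (lexx a) tb
  ld)).
rewrite mul0r d0 expr0n subr0 => H.
apply/eqP; rewrite -sqrf_eq0 -[_ == 0]andbT eq_le sqr_ge0 !andbT; apply: H.
refine (ae_imp D _) => s Ds /andP[s1 s2].
have {}Ds := Ds (introT andP (conj s1 (lt_le_trans s2 tb))).
eexists; first exact: (derSq Ds).
by have := sqr_ge0 (d s); lra.
Qed.

(** The forcing is q + q' for the affine profile. With a = -4 and b = 32 it is the ramp, which
    explains 28 = 32 - 4; with a = 4 and b = 0 it holds q at rest during the pulse. *)
Lemma affine_relaxation q (e t0 t1 a b : R) : lip t0 t1 q -> q t0 = e * a ->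
  {ae mu, forall t, t0 < t < t1 -> is_derive t 1 q (- q t + e * (a + b + b * (t
    - t0)))} ->
  forall t, t0 <= t <= t1 -> q t = e * (a + b * (t - t0)).
Proof.
move=> lq q0 D t tt; apply/eqP; rewrite -subr_eq0; apply/eqP.
have ll : lip t0 t1 (fun t => e * (a + b * (t - t0))).
  apply: lipM; first exact: lip_cst.
  apply: lipD; first exact: lip_cst.
  by apply: lipM; [exact: lip_cst|apply: lipB; [exact: lip_id|exact: lip_cst]].
apply: (@relaxation_unique t0 t1 (fun t => q t - e * (a + b * (t - t0)))) tt.
- exact: lipB.
- by rewrite subrr mulr0 addr0 q0 subrr.
refine (ae_imp D _) => s Ds /Ds {}Ds.
have Da : is_derive s 1 (fun t => e * (a + b * (t - t0))) (e * (0 + b * (1 -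
  0))).
  exact: (derMl e (derD (derC a s) (derMl b (derB (derId s) (derC t0 s))))).
apply: (is_derive_eq (derB Ds Da)); ring.
Qed.

Lemma g_sign e v : e = 1 \/ e = -1 -> 0 <= v ->
  g_ e (e * v) = v ^+ 2 / 2 /\ g_ e (- (e * v)) = 0.
Proof.
move=> he v0; have e2 : e * (e * v) = v by case: he => ->; ring.
by rewrite /g_ mulrN e2 (max_idPl v0) (max_idPr _) ?oppr_le0 // expr0n mul0r.
Qed.

Lemma primitive_sq_le p P a b : primitive_sq p P -> -2 < a -> a <= b ->
  P a <= P b.
Proof.
move=> hP a2 ab.
have := @slope_le R a b 0 (fun t => - P t) (fun t => - p t ^+ 2) ab => H.
suff : - P b - - P a <= 0 * (b - a) by lra.
apply: H => t /andP[t1 t2]; split; last by rewrite oppr_le0 sqr_ge0.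
by apply: derN; apply: hP; lra.
Qed.

(** The gain of V is read off the endpoints: q^2 / 2 is 8 at both, P does not decrease, and g_s(q)
    rises by at most 8. A past time r inside the ramp contributes at most p(t0)^2 / 2 + 16, that is
    C(t0) + 8. A constant rate A in [V_growth] would have to cover the end of the ramp and would
    overshoot 8. *)
Lemma ramp_phase p q P t0 e : continuous p -> continuous q ->
  primitive_sq p P -> 0 <= t0 ->
  e = 1 \/ e = -1 -> lip t0 (t0 + 1 / 4) p -> lip t0 (t0 + 1 / 4) q ->
  {ae mu, forall t, t0 < t < t0 + 1 / 4 ->
    is_derive t 1 p (- p t - p t ^+ 5) /\
    is_derive t 1 q (- q t + e * (28 + 32 * (t - t0)))} ->
  q t0 = - 4 * e ->
  [/\ q (t0 + 1 / 4) = 4 * e, p (t0 + 1 / 4) ^+ 2 <= p t0 ^+ 2,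
      P (t0 + 1 / 4) - P t0 <= 1 &
      V_ (segment (trj p q) (t0 + 1 / 4)) <= V_ (segment (trj p q) t0) + 8].
Proof.
move=> cp cq hP t00 he lp lq D q0; set t1 := t0 + 1 / 4.
have t01 : t0 <= t1 by rewrite /t1; lra.
have hs t : history (segment (trj p q) t) by exact: segment_history.
have qE : q t1 = 4 * e.
  have H := @affine_relaxation q e t0 t1 (- 4) 32 lq.
  rewrite H ?t01 ?lexx //.
  - by rewrite /t1; field.
  - by rewrite q0 mulrC.
  refine (ae_imp D _) => t Dt /Dt[_ h]; apply: (is_derive_eq h); ring.
have p_dec t : t0 <= t <= t1 -> p t ^+ 2 <= p t0 ^+ 2.
  move=> /andP[h1 h2].
  have := @lip_slope_le R t0 t 0 (fun s => p s ^+ 2) h1 (lipX 2 (lipS (lexx t0)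
    h2 lp)).
  rewrite mul0r subr_le0; apply.
  refine (ae_imp D _) => s Ds /andP[s1 s2].
  have [|Dp _] := Ds; first by rewrite s1 (lt_le_trans s2).
  eexists; first exact: (derSq Dp).
  by have := sqr_ge0 (p s); have := sqr_ge0 (p s ^+ 3); rewrite -exprM /=; lra.
(* 1 / (1 + p^2) grows at least as fast as P. *)
have P1 : P t1 - P t0 <= 1.
  have lh : lip t0 t1 (fun t => (1 + p t ^+ 2)^-1).
    apply: lip_inv; first by move=> t _; rewrite lerDl sqr_ge0.
    by apply: lipD; [exact: lip_cst|exact: lipX].
  have lP : lip t0 t1 P by apply: lip_primitive hP lp _; lra.
  have := @lip_slope_ge R t0 t1 0 _ t01 (lipB lh lP); rewrite mul0r => H.
  have : 0 <= (1 + p t1 ^+ 2)^-1 - P t1 - ((1 + p t0 ^+ 2)^-1 - P t0).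
    apply: H; refine (ae_imp D _) => s Ds /[dup] /Ds[Dp _] /andP[s1 s2].
    have nz : 1 + p s ^+ 2 != 0 by rewrite gt_eqF // ltr_wpDr // sqr_ge0.
    have D1 := derD (derC 1 s) (derSq Dp).
    have D2 := @is_deriveV _ (fun t => 1 + p t ^+ 2) s _ 1 nz D1.
    eexists; first by apply: (derB D2); apply: hP; lra.
    rewrite /GRing.scale /=.
    (* The numerator comes from 2 (1 + p^4) - (1 + p^2)^2 = (1 - p^2)^2. *)
    have -> : - (1 + p s ^+ 2) ^- 2 * (0 + 2 * (p s * (- p s - p s ^+ 5))) - p s
      ^+ 2 =
      (p s * (1 - p s ^+ 2) / (1 + p s ^+ 2)) ^+ 2 by field.
    exact: sqr_ge0.
  have : (1 + p t1 ^+ 2)^-1 <= 1 by rewrite invf_le1 ?lerDl ?sqr_ge0 // ltr_wpDr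
    // sqr_ge0.
  have : 0 <= (1 + p t0 ^+ 2)^-1 by rewrite invr_ge0 addr_ge0 // sqr_ge0.
  lra.
split=> //; first by apply: p_dec; rewrite t01 lexx.
have e2 : e ^+ 2 = 1 by case: he => ->; ring.
have g4 s : s = 1 \/ s = -1 -> 0 <= g_ s (4 * e) /\ g_ s (4 * e) <= 8.
  move=> hs'; split; first exact: g_ge0.
  by have := g_le (4 * e) hs'; rewrite exprMn e2; lra.
apply: V_le => s th hs' /andP[th1 th0].
rewrite (F_segment _ _ cp hP) ?th1 //; last by lra.
have [r0|r0] := leP (t1 + th) t0.
  have z : -1 <= t1 + th - t0 <= 0 by apply/andP; split; [rewrite /t1|]; lra.
  have := F_le_V (hs t0) hs' z; rewrite (F_segment _ _ cp hP) // addrCA subrr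
    addr0.
  have := primitive_sq_le hP (_ : -2 < t0) t01 => H; have {H} := H ltac:(lra).
  have [_] := g4 s hs'; have := g_ge0 s (- 4 * e).
  rewrite /F_trj qE q0 !exprMn e2; lra.
have rI : t0 <= t1 + th <= t1 by apply/andP; split; lra.
have := p_dec _ rI; have := g_le (p (t1 + th)) hs'.
have := C_le_V (hs t0); rewrite /segment /trj addr0 /= q0 exprMn e2.
have := primitive_sq_le hP (_ : -2 < t1 + th) (_ : t1 + th <= t1) => H;
  have {H} := H ltac:(lra) ltac:(lra).
have [_] := g4 s hs'; have := g_ge0 s (q (t1 + th)).
rewrite /F_trj qE exprMn e2; lra.
Qed.

(** With E >= 1 / 2 the forcing is at least 8 (1 + Y)^3 >= 8 Y^3 + Y. The damping is at most Y + 4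
    Y^3, since z <= zs <= Y and zs^4 = (2 Y - 17)^2 <= 4 Y^2. *)
Lemma pulse_climb_rate (Y z zs V : R) : 29 / 2 <= Y -> 0 <= zs ->
  zs ^+ 2 = 2 * Y - 17 ->
  z <= zs -> Y <= V -> 4 * Y ^+ 3 <= 16 * (1 + V) ^+ 3 * 2^-1 - z - z ^+ 5.
Proof.
move=> Y0 zs0 zsE zz YV.
have zsY : zs <= Y.
  rewrite -ler_sqr ?nnegrE //; last by lra.
  by rewrite zsE; have := sqr_ge0 (Y - 1); lra.
have z5 : z ^+ 5 <= 4 * Y ^+ 3.
  apply: (@le_trans _ _ (zs ^+ 5)).
    have [z0|z0] := leP 0 z; first by rewrite lerXn2r // nnegrE.
    apply: (@le_trans _ _ 0); last exact: exprn_ge0.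
    have -> : z ^+ 5 = z * (z ^+ 2) ^+ 2 by ring.
    by rewrite mulr_le0_ge0 ?sqr_ge0 // ltW.
  have -> : zs ^+ 5 = zs * (zs ^+ 2) ^+ 2 by ring.
  rewrite zsE.
  have h : (2 * Y - 17) ^+ 2 <= 4 * Y ^+ 2 by nra.
  apply: (@le_trans _ _ (Y * (4 * Y ^+ 2))); last by rewrite le_eqVlt;
    apply/orP; left; apply/eqP; ring.
  by rewrite ler_pM ?sqr_ge0.
have V3 : (1 + Y) ^+ 3 <= (1 + V) ^+ 3 by rewrite lerXn2r ?nnegrE; lra.
have : 8 * Y ^+ 3 + Y <= 8 * (1 + Y) ^+ 3.
  by have := sqr_ge0 Y; lra.
lra.
Qed.

(** The length d is short enough for p^2, of size up to 20 + 16 N, to integrate to at most 20 / 64,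
    and long enough for a climb at speed 4 Y^3 to cover the distance 2 Y. K serves [V_growth], which
    keeps V below its value at t1; the lower bound on V comes from the term frozen at t0. *)
Lemma pulse_phase p q P t0 d (N : R) e K : continuous p -> continuous q ->
  primitive_sq p P -> 0 <= t0 ->
  e = 1 \/ e = -1 -> 0 <= N -> d = (64 * (N + 1))^-1 ->
  let t1 := t0 + 1 / 4 in let t2 := t1 + d in
  lip t0 t2 p -> lip t0 t2 q -> 0 <= K ->
  {ae mu, forall t, t1 < t < t2 ->
    [/\ is_derive t 1 p (- p t - p t ^+ 5 +
          16 * (1 + V_ (segment (trj p q) t)) ^+ 3 * - e * E_ (segment (trj p q)
            t)),
        is_derive t 1 q (- q t + 4 * e) &
        p t * (- p t - p t ^+ 5 +
          16 * (1 + V_ (segment (trj p q) t)) ^+ 3 * - e * E_ (segment (trj p q)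
            t)) <=
        K * E_ (segment (trj p q) t)]} ->
  q t0 = - 4 * e -> q t1 = 4 * e -> 0 < e * p t0 -> 4 + 12 * N <= p t0 ^+ 2 ->
  p t1 ^+ 2 <= p t0 ^+ 2 -> P t1 - P t0 <= 1 ->
  V_ (segment (trj p q) t1) <= 18 + 8 * N ->
  [/\ q t2 = 4 * e, 0 < - e * p t2, p t0 ^+ 2 + 12 <= p t2 ^+ 2 &
      V_ (segment (trj p q) t2) <= 18 + 8 * N].
Proof.
move=> cp cq hP t00 he N0 dE t1 t2 lp lq K0 D q0 q1 ep0 p0N p10 P10 V1.
have hs t : history (segment (trj p q) t) by exact: segment_history.
have N1 : 0 < N + 1 by lra.
have d0 : 0 < d by rewrite dE invr_gt0 mulr_gt0.
have d64 : d <= 1 / 64.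
  rewrite dE div1r lef_pV2 ?posrE ?mulr_gt0 //; lra.
have t01 : t0 <= t1 by rewrite /t1; lra.
have t12 : t1 <= t2 by rewrite /t2; lra.
have lp' : lip t1 t2 p by exact: lipS lp.
have lq' : lip t1 t2 q by exact: lipS lq.
have e2 : e ^+ 2 = 1 by case: he => ->; ring.
have qE t : t1 <= t <= t2 -> q t = 4 * e.
  move=> tt; rewrite (@affine_relaxation q e t1 t2 4 0 lq') //; first by ring.
    by rewrite q1 mulrC.
  by refine (ae_imp D _) => s Ds /Ds[_ h _]; apply: (is_derive_eq h); ring.
(* Since q is at rest during the pulse, [V_growth] applies with A = 0. *)
have Vle t : t1 <= t <= t2 -> V_ (segment (trj p q) t) <= 18 + 8 * N.
  move=> /andP[h1 h2]; apply: le_trans V1.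
  rewrite -[leRHS]addr0 -[X in _ + X](mul0r (t - t1)).
  apply: (V_growth cp cq hP _ K0); first by apply/andP; split=> //; lra.
  - exact: lipS lp'.
  - exact: lipS lq'.
  refine (ae_imp D _) => s Ds /andP[s1 s2].
  have [|Dp Dq HK] := Ds; first by rewrite s1 (lt_le_trans s2).
  eexists; eexists; split; [exact: Dp|exact: Dq| |exact: HK].
  move=> s' _; rewrite qE; last by rewrite (ltW s1) (le_trans (ltW s2)).
  by rewrite addNr !mulr0 addr0.
have p2le t : t1 <= t <= t2 -> p t ^+ 2 <= 20 + 16 * N.
  move=> tt; have := Vle t tt; have := C_le_V (hs t).
  by rewrite /segment /trj addr0 /= qE // exprMn e2; lra.
have dN : (20 + 16 * N) * d <= 20 / 64.
  rewrite dE ler_pdivrMr ?mulr_gt0 //; lra.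
have PP t : t1 <= t <= t2 -> P t - P t0 <= 1 + 20 / 64.
  move=> /andP[h1 h2].
  have : P t - P t1 <= (20 + 16 * N) * (t - t1).
    have := @slope_le R t1 t (20 + 16 * N) P (fun s => p s ^+ 2) h1; apply =>
      s /andP[s1 s2].
    split; first by apply: hP; lra.
    by apply: p2le; rewrite s1 (le_trans s2).
  have : (20 + 16 * N) * (t - t1) <= (20 + 16 * N) * d.
    rewrite ler_wpM2l //; first by lra.
    by move: h2; rewrite /t2; lra.
  lra.
(* 235 / 16 = 8 + 8 - 1 - 20 / 64: the term of V indexed by the time t0 stays
   above Y during the pulse. *)
pose Y := p t0 ^+ 2 / 2 + 235 / 16.
have VY t : t1 <= t <= t2 -> Y <= V_ (segment (trj p q) t).
  move=> /[dup] tt /andP[h1 h2].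
  have z : -1 <= t0 - t <= 0.
    move: h1 h2; rewrite /t2 /t1 => h1 h2; clear -h1 h2 d64.
    by apply/andP; split; lra.
  apply: le_trans (F_le_V (hs t) he z).
  have tE : t + (t0 - t) = t0 by ring.
  rewrite (F_segment _ _ cp hP) //; last by lra.
  rewrite tE.
  rewrite /F_trj qE // q0.
  have pe : p t0 = e * (e * p t0) by rewrite mulrA -expr2 e2 mul1r.
  have [gp _] := g_sign he (ltW ep0); rewrite -pe exprMn e2 mul1r in gp.
  have [g1 g2] := @g_sign e 4 he ltac:(lra).
  rewrite gp (_ : 4 * e = e * 4) 1?mulrC // (_ : - 4 * e = - (e * 4)); last
    by ring.
  rewrite g1 g2 exprMn e2 /Y; have := PP t tt; lra.
(* E is at least 1 / 2 as long as `|p| <= zs. *)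
pose zs := Num.sqrt (2 * Y - 17).
have p0sq := sqr_ge0 (p t0).
have zsE : zs ^+ 2 = 2 * Y - 17 by rewrite sqr_sqrtr // /Y; lra.
have zs0 : 0 < zs by rewrite sqrtr_gt0 /Y; lra.
have pzs : e * p t0 <= zs.
  rewrite -ler_sqr ?nnegrE ?(ltW ep0) ?(ltW zs0) // zsE exprMn e2 /Y; lra.
(* z is p counted in the direction opposite to its sign at t0, so the pulse pushes z upwards and z
   t2 > 0 means that the sign has flipped. *)
pose z t := - e * p t.
have lz : lip t1 t2 z by apply: lipM => //; exact: lip_cst.
have z2 t : z t ^+ 2 = p t ^+ 2 by rewrite /z mulNr sqrrN exprMn e2 mul1r.
have Dz : {ae mu, forall t, t1 < t < t2 ->
    is_derive t 1 z (- z t - z t ^+ 5 + 16 * (1 + V_ (segment (trj p q) t)) ^+ 3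
      * E_ (segment (trj p q) t))}.
  refine (ae_imp D _) => t Dt /Dt[Dp _ _]; apply: (is_derive_eq (derMl (- e)
    Dp)).
  rewrite /z; move: (V_ _) (E_ _) => V E.
  by case: he => ->; ring.
have z1 : - (e * p t0) <= z t1.
  have : z t1 ^+ 2 <= (e * p t0) ^+ 2 by rewrite z2 exprMn e2 mul1r.
  move=> h; have : `|z t1| <= e * p t0.
    by rewrite -ler_sqr ?nnegrE ?(ltW ep0) // real_normK ?num_real.
  by rewrite ler_norml => /andP[].
(* Below this negative level damping and forcing both push z up. With z < zs this bounds z^2 by
   zs^2, which the lower bound on E requires. *)
have zlow t : t1 <= t <= t2 -> - (e * p t0) <= z t.
  move=> /andP[h1 h2].
  have := @barrier R t1 t (- (e * p t0)) 0 z h1 (lexx 0) (lipS (lexx t1) h2 lz).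
  rewrite mul0r addr0 (min_idPl z1); apply.
  refine (ae_imp Dz _) => s Ds /andP[s1 s2].
  have sI : t1 < s < t2 by rewrite s1 (lt_le_trans s2).
  exists (- z s - z s ^+ 5 + 16 * (1 + V_ (segment (trj p q) s)) ^+ 3 * E_
    (segment (trj p q) s)); first exact: Ds.
  move=> zs_lt.
  have zneg : z s < 0 by clear -zs_lt ep0; lra.
  have E0 := E_ge0 (hs s); have V0 := V_ge0 (hs s).
  have h3 : 0 <= 16 * (1 + V_ (segment (trj p q) s)) ^+ 3 * E_ (segment (trj p
    q) s).
    by rewrite mulr_ge0 // mulr_ge0 // exprn_ge0 // addr_ge0.
  have -> : z s ^+ 5 = z s * (z s ^+ 2) ^+ 2 by ring.
  have : z s * (z s ^+ 2) ^+ 2 <= 0 by rewrite mulr_le0_ge0 ?sqr_ge0 // ltW.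
  by clear -zneg h3; lra.
have Y0 : 29 / 2 <= Y by rewrite /Y; lra.
have Y3 : 0 <= 4 * Y ^+ 3 by rewrite mulr_ge0 // exprn_ge0 //; clear -Y0; lra.
have zend : zs <= z t2.
  have := @barrier R t1 t2 zs (4 * Y ^+ 3) z t12 Y3 lz.
  have -> : Num.min zs (z t1 + 4 * Y ^+ 3 * (t2 - t1)) = zs.
    apply/min_idPl.
    have zsY : zs <= Y.
      rewrite -ler_sqr ?nnegrE ?(ltW zs0) //; last by clear -Y0; lra.
      by rewrite zsE; have := sqr_ge0 (Y - 1); clear; lra.
    have -> : t2 - t1 = d by rewrite /t2; ring.
    (* The climb from - (e * p t0) to zs has length at most 2 zs <= 2 Y. In terms of d the claim is
       Y^2 >= 32 (N + 1), and Y >= 6 N + 16. *)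
    have : 2 * Y <= 4 * Y ^+ 3 * d.
      rewrite dE ler_pdivlMr ?mulr_gt0 //.
      have YN : 6 * N + 16 <= Y by rewrite /Y; clear -p0N; lra.
      have h : 32 * (N + 1) <= Y ^+ 2 by clear -YN N0; nra.
      have Y4 : 0 <= 4 * Y by clear -Y0; lra.
      have := ler_wpM2l Y4 h.
      have -> : 4 * Y * Y ^+ 2 = 4 * Y ^+ 3 by ring.
      by clear; lra.
    by clear -z1 pzs zsY; lra.
  apply; refine (ae_imp Dz _) => t Dt /[dup] tI /andP[h1 h2].
  have tI' : t1 <= t <= t2 by rewrite !ltW.
  exists (- z t - z t ^+ 5 + 16 * (1 + V_ (segment (trj p q) t)) ^+ 3 * E_
    (segment (trj p q) t)); first exact: Dt.
  move=> zlt.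
  have Vt := VY t tI'.
  have Et : 2^-1 <= E_ (segment (trj p q) t).
    have zz : z t ^+ 2 <= zs ^+ 2.
      rewrite -[leLHS]real_normK ?num_real // ler_sqr ?nnegrE ?(ltW zs0) //.
      rewrite ler_norml (ltW zlt) andbT; have := zlow t tI'; clear -pzs; lra.
    by move: zz; rewrite z2 zsE /E_ /segment /trj addr0 /= qE // exprMn e2;
      move: Vt; rewrite /segment /trj; clear; lra.
  have := pulse_climb_rate Y0 (ltW zs0) zsE (ltW zlt) Vt.
  have h3 : 0 <= 16 * (1 + V_ (segment (trj p q) t)) ^+ 3.
    by rewrite mulr_ge0 // exprn_ge0 //; clear -Vt Y0; lra.
  have := ler_wpM2l h3 Et; clear; lra.
split.
- by apply: qE; rewrite t12 lexx.
- exact: lt_le_trans zend.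
(* The square of zs is p t0^2 + 99 / 8, slightly more than the required gain of 12. *)
- have : zs ^+ 2 <= z t2 ^+ 2 by rewrite ler_sqr ?nnegrE ?(ltW zs0) // (le_trans
  _ zend) // ltW.
  by rewrite z2 zsE /Y; clear; lra.
- by apply: Vle; rewrite t12 lexx.
Qed.

End phases.

(** * The switching input *)

Section switching.
Variable R : realType.
Notation mu := (@lebesgue_measure R).
Notation sw := (@switching_input R).
Notation tau := (@tau R).
Notation rho := (@rho R).
Implicit Types (t s : R) (n : nat).

Lemma eps_cases n : @eps_ R n = 1 \/ @eps_ R n = -1.
Proof.
elim: n => [|n [] h]; first by left; rewrite /eps_ expr0.
  by right; rewrite /eps_ exprS -/(eps_ n) h mulr1.
by left; rewrite /eps_ exprS -/(eps_ n) h mulrNN mulr1.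
Qed.

Lemma tau0 : tau 0 = 0.
Proof. by rewrite /Defs.tau big_geq //= !mul0r addr0. Qed.

Lemma tau_ge0 n : 0 <= tau n.
Proof. by rewrite -tau0 tau_le. Qed.

Lemma switching_input_norm t : 0 <= t ->
  (exists2 n, tau n <= t < rho n & enorm (sw t) = 28 + 32 * (t - tau n)) \/
    enorm (sw t) <= 5.
Proof.
move=> t0; have [n /andP[h1 h2]] := tau_cover t0.
have [tr|rt] := ltP t (rho n); [left|right].
  exists n; rewrite ?h1 ?tr //; rewrite (switching_inputE n t).1 ?h1 ?tr //.
  have v0 : 0 <= 28 + 32 * (t - tau n) by lra.
  rewrite /enorm /= expr0n addr0 exprMn.
  have -> : @eps_ R n ^+ 2 = 1 by case: (eps_cases n) => ->; ring.
  by rewrite mul1r sqrtr_sqr ger0_norm.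
rewrite (switching_inputE n t).2 ?rt //.
by apply: enorm_leP => //=; case: (eps_cases n) => ->; lra.
Qed.

Lemma switching_input_le t : 0 <= t -> enorm (sw t) <= 36.
Proof.
move=> /switching_input_norm[[n /andP[h1 h2] ->]|]; last by lra.
by move: h2; rewrite /Defs.rho; lra.
Qed.

Lemma switching_ess_norm_le (D : set R) : (forall t, D t -> 0 <= t) ->
  (ess_norm D sw <= 36%:E)%E.
Proof.
move=> D0; apply/ess_supP; apply: nearW => t; rewrite patchE.
case: ifPn => [|_]; last by rewrite lee_fin.
by rewrite inE lee_fin => /D0; exact: switching_input_le.
Qed.

Lemma itv_not_negligible (a b : R) : a < b -> ~ mu.-negligible (`]a,
  b[%classic : set R).
Proof.
move=> ab /negligibleP h; have : mu (`]a, b[%classic : set R) = 0%E :=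
  h (measurable_itv _).
rewrite lebesgue_measure_itv /= lte_fin ab; by rewrite -EFinB => /eqP;
  rewrite eqe subr_eq0 gt_eqF.
Qed.

Lemma ess_norm_ge0 (D : set R) (u : R -> plane R) : (0 <= ess_norm D u)%E.
Proof.
rewrite leNgt; apply/negP => lt0.
have [r r0 /ess_supP h] : exists2 r : R, r < 0 & (ess_norm D u <= r%:E)%E.
  move e : (ess_norm D u) lt0 => [r| |] //= lt0; first by exists r;
    rewrite ?lexx // -lte_fin.
  by exists (-1); rewrite ?leNye // oppr_lt0.
apply: (@itv_not_negligible 0 1) => //; apply: negligibleS h => t _ /=.
rewrite patchE; case: ifPn => _; rewrite lee_fin => H.
  by move: (le_lt_trans (le_trans (enorm_ge0 (u t)) H) r0); rewrite ltxx.
by move: (le_lt_trans H r0); rewrite ltxx.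
Qed.

(** The value 36 is only approached, at the end of each ramp. For c < 36 the norm exceeds c on an
    interval of positive length ending at 1 / 4, whose left end a solves 28 + 32 a = c unless this
    is negative. *)
Lemma switching_ess_norm : ess_norm `[0, +oo[ sw = 36%:E.
Proof.
apply/eqP; rewrite eq_le switching_ess_norm_le /=; last first.
  by move=> t /=; rewrite in_itv /= andbT.
rewrite leNgt; apply/negP => lt36.
have [c c36 /ess_norm_leP h] : exists2 c : R, c < 36 & (ess_norm `[0%R,
  +oo[ sw <= c%:E)%E.
  have := ess_norm_ge0 `[0, +oo[ sw.
  by move: lt36; case: (ess_norm _ _) => [c| |] //= lt36 _; exists c;
    rewrite ?lexx // -lte_fin.
pose a := Num.max 0 ((c - 28) / 32).
have a4 : a < 1 / 4 by rewrite /a gt_max; apply/andP; split; lra.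
apply: (@itv_not_negligible a (1 / 4)) => //; apply: negligibleS h => t.
rewrite /= in_itv /= /a gt_max => /andP[/andP[t0 tc] t4] H.
have := H _; rewrite in_itv /= (ltW t0) => /(_ isT).
rewrite (switching_inputE 0 t).1 ?tau0 /Defs.rho ?tau0 ?add0r ?(ltW t0) ?t4 //.
have := enorm_ge1 (@eps_ R 0 * (28 + 32 * (t - 0)), 0 : R);
  rewrite /= /eps_ expr0 mul1r subr0.
rewrite ger0_norm; lra.
Qed.

Definition ramp n t : plane R := (@eps_ R n * (28 + 32 * (t - tau n)), 0).
Definition pulse n t : plane R := (4 * @eps_ R n, - @eps_ R n).

Lemma ramp_component_continuous n : continuous (fun t =>
  @eps_ R n * (28 + 32 * (t - tau n))).
Proof.
move=> t; have D := derMl (@eps_ R n) (derD (derC 28 t) (derMl 32 (derB (derId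
  t) (derC (tau n) t)))).
exact: (der_continuous D).
Qed.

Lemma ramp_continuous n : continuous (ramp n).
Proof.
have c0 : continuous (fun _ : R => 0 : R) by move=> t; exact: cvg_cst.
exact: (trj_continuous (@ramp_component_continuous n) c0).
Qed.

Lemma pulse_continuous n : continuous (pulse n).
Proof. by move=> t; exact: cvg_cst. Qed.

Lemma switching_right t : 0 <= t -> exists (b : R) (g : R -> plane R),
  [/\ t < b, continuous g & forall s, t <= s < b -> sw s = g s].
Proof.
move=> t0; have [n /andP[h1 h2]] := tau_cover t0.
have [tr|rt] := ltP t (rho n).
  exists (rho n), (ramp n); split; [by []|exact: ramp_continuous|] =>
    s /andP[s1 s2].
  by rewrite (switching_inputE n s).1 // (le_trans h1).
exists (tau n.+1), (pulse n); split; [by []|exact: pulse_continuous|] =>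
  s /andP[s1 s2].
by rewrite (switching_inputE n s).2 // (le_trans rt).
Qed.

Lemma switching_left t : 0 < t -> exists (a : R) (g : R -> plane R),
  [/\ a < t, continuous g & forall s, a < s < t -> sw s = g s].
Proof.
move=> t0; have [n /andP[h1 h2]] := tau_cover (ltW t0).
have [tr|rt] := ltP (rho n) t.
  exists (rho n), (pulse n); split; [by []|exact: pulse_continuous|] =>
    s /andP[s1 s2].
  by rewrite (switching_inputE n s).2 // (ltW s1) (lt_trans s2).
move: h1; rewrite le_eqVlt => /predU1P[tn|h1]; last first.
  exists (tau n), (ramp n); split; [by []|exact: ramp_continuous|] =>
    s /andP[s1 s2].
  by rewrite (switching_inputE n s).1 // (ltW s1) (lt_le_trans s2).
(* At a switching time tau_{n+1} the left limit comes from the preceding pulse; tau_0 = 0 is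
   excluded by t > 0. *)
case: n tn {rt h2} => [|n] tn; first by move: t0; rewrite -tn tau0 ltxx.
exists (rho n), (pulse n); split; [|exact: pulse_continuous|].
  by rewrite -tn rho_lt_tauS.
by move=> s /andP[s1 s2]; rewrite (switching_inputE n s).2 // (ltW s1) tn.
Qed.

Lemma switching_right_continuous : right_continuous_input sw.
Proof.
move=> t t0; have [b [g [tb cg sg]]] := switching_right t0.
rewrite sg ?lexx ?tb //; apply: cvg_trans (cvg_at_right_filter (cg t)).
apply: near_eq_cvg; near=> s; rewrite sg //; apply/andP; split.
  by apply: ltW; near: s; exact: nbhs_right_gt.
by near: s; exact: nbhs_right_lt.
Unshelve. all: by end_near. Qed.

Lemma switching_piecewise_continuous : piecewise_continuous_input sw.
Proof.
split.
- move=> T; have [T0|T0] := ltP T 0.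
    apply: (sub_finite_set _ (finite_set0 R)) => t [/andP[t0 tT] _].
    by move: (lt_le_trans t0 (le_trans tT (ltW T0))); rewrite ltxx.
  have [N /andP[N1 N2]] := tau_cover T0.
  apply: (@sub_finite_set _ _ ((tau @` `I_N.+1) `|` (rho @` `I_N.+1)));
    last first.
    by rewrite finite_setU; split; apply: finite_image; exact: finite_II.
  move=> t [/andP[t0 tT] nc]; have [n /andP[h1 h2]] := tau_cover (ltW t0).
  have nN : (n < N.+1)%N.
    rewrite ltnNge; apply/negP => Nn; have := @tau_le R _ _ Nn.
    by rewrite leNgt (le_lt_trans (le_trans h1 tT) N2).
  move: h1; rewrite le_eqVlt => /predU1P[<-|h1]; first by left; exists n.
  have [tr|rt] := ltP t (rho n).
    exfalso; apply: nc.
    apply: (@near_eq_continuous R _ (ramp n) t (Num.min (t - tau n) (rho n -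
      t))).
    - by rewrite lt_min !subr_gt0 h1.
    - move=> s; rewrite lt_min !ltr_norml => /andP[/andP[s1 s2] /andP[s3 s4]].
      rewrite (switching_inputE n s).1 //; apply/andP; split; lra.
    - exact: ramp_continuous.
  move: rt; rewrite le_eqVlt => /predU1P[<-|rt]; first by right; exists n.
  exfalso; apply: nc.
  apply: (@near_eq_continuous R _ (pulse n) t (Num.min (t - rho n) (tau n.+1 -
    t))).
  - by rewrite lt_min !subr_gt0 rt.
  - move=> s; rewrite lt_min !ltr_norml => /andP[/andP[s1 s2] /andP[s3 s4]].
    rewrite (switching_inputE n s).2 //; apply/andP; split; lra.
  - exact: pulse_continuous.
- move=> t t0; have [a [g [at_ cg sg]]] := switching_left t0.
  exists (g t); apply: cvg_trans (cvg_at_left_filter (cg t)).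
  apply: near_eq_cvg; near=> s; rewrite sg //; apply/andP; split.
    by near: s; exact: nbhs_left_gt.
  by near: s; exact: nbhs_left_lt.
- by move=> t t0; exists (sw t); exact: switching_right_continuous.
Unshelve. all: by end_near. Qed.

(** On countably many half-open intervals the input is given by continuous formulas, so its
    preimages are even Borel. *)
Lemma switching_is_input : is_input sw.
Proof.
split; last first.
  move=> T T0; apply: le_lt_trans (ltry 36); apply: switching_ess_norm_le =>
    t /=.
  by rewrite in_itv /= => /andP[].
move=> _ Y mY.
have mg (g : R -> plane R) : continuous g -> measurable (g @^-1` Y : set R).
  move=> cg.
  have m1 : measurable_fun setT (fun t => (g t).1).
    apply: continuous_measurable_fun => t.
    by apply: (@cvg_comp _ _ _ _ fst _ _ _ (cg t)); exact: cvg_fst.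
  have m2 : measurable_fun setT (fun t => (g t).2).
    apply: continuous_measurable_fun => t.
    by apply: (@cvg_comp _ _ _ _ snd _ _ _ (cg t)); exact: cvg_snd.
  have m : measurable_fun setT g by apply/measurable_fun_pairP.
  by rewrite -[X in measurable X]setTI; exact: m.
apply: sub_caratheodory.
have -> : `[0, +oo[%classic `&` sw @^-1` Y = \bigcup_n
   ((`[tau n, rho n[%classic `&` ramp n @^-1` Y) `|` (`[rho n,
     tau n.+1[%classic `&` pulse n @^-1` Y)).
  apply/seteqP; split=> t.
    move=> []; rewrite /= in_itv /= andbT => t0 Yt.
    have [n /andP[h1 h2]] := tau_cover t0; exists n => //.
    have [tr|rt] := ltP t (rho n); [left|right]; rewrite /= in_itv /=.
      by rewrite h1 tr; split=> //; move: Yt;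
        rewrite (switching_inputE n t).1 // h1.
    by rewrite rt h2; split=> //; move: Yt; rewrite (switching_inputE n t).2 //
      rt.
  move=> [n _ []] [] /=; rewrite !in_itv /= andbT => tt Yt.
    split; last by rewrite /= (switching_inputE n t).1.
    by apply: le_trans (tau_ge0 n) _; case/andP: tt.
  split; last by rewrite /= (switching_inputE n t).2.
  by apply: le_trans (le_trans (tau_ge0 n) (ltW (tau_lt_rho R n))) _;
    case/andP: tt.
apply: bigcupT_measurable => n; apply: measurableU; apply: measurableI.
- exact: measurable_itv.
- by apply: mg; exact: ramp_continuous.
- exact: measurable_itv.
- by apply: mg; exact: pulse_continuous.
Qed.

End switching.

(** * Growth of the switching solution and failure of ISS *)

Section conclusion.
Variable R : realType.
Notation mu := (@lebesgue_measure R).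
Notation sw := (@switching_input R).

Lemma cst_history (v : plane R) : history (fun _ => v).
Proof. by apply: continuous_subspaceT => x; exact: cvg_cst. Qed.

Lemma switching_solution (x : R -> plane R) :
  is_solution (@f_ R) (fun _ => (2, -4)) sw x ->
  forall n : nat, 0 < eps_ n * (x (tau n)).1 /\
    Num.sqrt (20 + 12 * n%:R) <= enorm (x (tau n)) <= Num.sqrt (20 + 16 * n%:R).
Proof.
move=> sx; have [p [q [xE sol]]] := solution_solves_on (switching_is_input R)
  sx.
have [cp cq _ _ _] := sol 0 (lexx 0); have [P hP] := primitive_sq_ex cp.
have hs t : history (segment (trj p q) t) by exact: segment_history.
have x0 th : -1 <= th <= 0 -> trj p q th = (2, -4).
  move=> /[dup] tt /andP[h _]; rewrite -[LHS]xE //.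
  by case: sx => + _ _ _; apply; rewrite in_itv.
(* The upper bound on V is needed besides the lower bound on p^2: it limits p^2 during the next
   pulse, hence the memory lost there. *)
have inv n : [/\ q (tau n) = - 4 * eps_ n, 0 < eps_ n * p (tau n),
    4 + 12 * n%:R <= p (tau n) ^+ 2 & V_ (segment (trj p q) (tau n)) <= 10 + 8 *
      n%:R].
  elim: n => [|n [q0 p0 pn Vn]].
    have [p0 q0] : trj p q 0 = (2, -4) by apply: x0;
      rewrite lexx oppr_le0 ler01.
    rewrite tau0 p0 q0 /eps_ expr0 mulr0 !addr0; split; [by ring|
      by rewrite mul1r|lra|].
    have -> : V_ (segment (trj p q) 0) = V_ (fun _ : R => ((2, -4) : plane R)).
      by apply: eq_V => th tht; rewrite /segment add0r x0.
    (* For a constant history the two [g_] terms in q cancel, which leaves at most 2 + 8. *)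
    apply: V_le => s th hs' _; rewrite /F_ /= addrK.
    have := g_le 2 hs'.
    have : 0 <= \int[mu]_(r in `[th, 0]) ((2 : R) ^+ 2).
      by apply: Rintegral_ge0 => y _; exact: sqr_ge0.
    lra.
  pose N : R := n%:R; have N0 : 0 <= N by exact: ler0n.
  have he := @eps_cases R n.
  have t00 := @tau_ge0 R n.
  have rhoE : rho n = tau n + 1 / 4 :> R by [].
  have t2E : tau n.+1 = tau n + 1 / 4 + delta n :> R by rewrite tauS.
  have d0 := @delta_gt0 R n.
  have T0 : 0 <= (tau n.+1 : R) by exact: tau_ge0.
  have swle : {ae mu, forall t, 0 < t < tau n.+1 -> enorm (sw t) <= 36}.
    by apply: nearW => t /andP[t0 _]; apply: switching_input_le; exact: ltW.
  have solT := sol _ T0.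
  have [K K0 HK] := solves_on_p_growth T0 (ler0n R 36) solT swle.
  have [_ _ lp lq D] := solT.
  have lpn : lip (tau n) (tau n.+1) p by exact: lipS lp.
  have lqn : lip (tau n) (tau n.+1) q by exact: lipS lq.
  have D1 : {ae mu, forall t, tau n < t < tau n + 1 / 4 ->
    is_derive t 1 p (- p t - p t ^+ 5) /\
    is_derive t 1 q (- q t + eps_ n * (28 + 32 * (t - tau n)))}.
    refine (ae_imp D _) => t Dt /andP[t1 t2].
    have tT : 0 < t < tau n.+1 by apply/andP; split; lra.
    have /is_derive_pair := Dt tT.
    rewrite (switching_inputE n t).1; last by rewrite (ltW t1) rhoE.
    rewrite /f_ /= /segment /trj addr0 /= => -[h1 h2]; split=> //.
    by apply: (is_derive_eq h1); rewrite mulr0 mul0r addr0.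
  have lp1 : lip (tau n) (tau n + 1 / 4) p by apply: lipS lpn => //; lra.
  have lq1 : lip (tau n) (tau n + 1 / 4) q by apply: lipS lqn => //; lra.
  have [q1 p1 P1 V1] := ramp_phase cp cq hP t00 he lp1 lq1 D1 q0.
  have dE : delta n = (64 * (N + 1))^-1 by rewrite /delta /N natr1.
  have D2 : {ae mu, forall t, tau n + 1 / 4 < t < tau n + 1 / 4 + delta n ->
    [/\ is_derive t 1 p (- p t - p t ^+ 5 +
          16 * (1 + V_ (segment (trj p q) t)) ^+ 3 * - eps_ n * E_ (segment (trj
            p q) t)),
        is_derive t 1 q (- q t + 4 * eps_ n) &
        p t * (- p t - p t ^+ 5 +
          16 * (1 + V_ (segment (trj p q) t)) ^+ 3 * - eps_ n * E_ (segment (trj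
            p q) t)) <=
        K * E_ (segment (trj p q) t)]}.
    refine (ae_imp2 D HK _) => t Dt Kt /andP[t1 t2].
    have tT : 0 < t < tau n.+1 by apply/andP; split; lra.
    have swE : sw t = (4 * eps_ n, - eps_ n).
      by rewrite (switching_inputE n t).2 // rhoE (ltW t1) t2E.
    have fE : f_ (segment (trj p q) t) (sw t) = (- p t - p t ^+ 5 +
          16 * (1 + V_ (segment (trj p q) t)) ^+ 3 * - eps_ n * E_ (segment (trj
            p q) t),
          - q t + 4 * eps_ n).
      by rewrite swE /f_ {1 2 5}/segment /trj /= addr0.
    have /is_derive_pair[h1 h2] := Dt tT; have := Kt tT.
    by rewrite fE /= in h1 h2 *.
  have V2 : V_ (segment (trj p q) (tau n + 1 / 4)) <= 18 + 8 * N by rewrite /N;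
    lra.
  have lp2 : lip (tau n) (tau n + 1 / 4 + delta n) p by rewrite -t2E.
  have lq2 : lip (tau n) (tau n + 1 / 4 + delta n) q by rewrite -t2E.
  have := pulse_phase cp cq hP t00 he N0 dE lp2 lq2 K0 D2 q0 q1 p0 pn p1 P1 V2.
  rewrite -t2E => -[h1 h2 h3 h4].
  have eS : eps_ n.+1 = - eps_ n :> R by rewrite /eps_ exprS mulN1r.
  have nS : n.+1%:R = N + 1 :> R by rewrite /N natr1.
  rewrite eS nS; split=> //.
  - by rewrite h1; ring.
  - by move: pn; rewrite -/N => pn; lra.
  - lra.
move=> n; have [qn pn pn2 Vn] := inv n.
have xn : x (tau n) = (p (tau n), q (tau n)).
  by apply: xE; apply: le_trans (tau_ge0 R n); rewrite oppr_le0.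
rewrite xn; split=> //.
have q2 : q (tau n) ^+ 2 = 16.
  by rewrite qn; case: (eps_cases R n) => ->; ring.
have := C_le_V (hs (tau n)); rewrite /segment /trj addr0 /= -/(trj p q) => CV.
by rewrite /enorm /= !ler_wsqrtr // q2; [lra|move: CV; rewrite q2 => CV;
  have := le_trans CV Vn; lra].
Qed.

(** As beta decreases in time and mu is monotone, an ISS estimate would bound the switching solution
    by beta(h, 0) + mu(36) at all times, whereas its squared norm at tau_n is at least 20 + 12 n. *)
Lemma f_not_ISS : ~ ISS (@f_ R).
Proof.
move=> [beta [m [[_ _ bdec _] [m0 _ mmono] H]]].
have [[x sx] Hx] := H _ _ (@cst_history (2, -4)) (switching_is_input R).
pose h := hnorm (fun _ : R => (2, -4) : plane R).
have h0 : 0 <= h by apply: hnorm_ge0; exact: cst_history.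
pose B := beta h 0 + m 36.
have [n Bn] : exists n : nat, B ^+ 2 < n%:R.
  by exists (Num.bound (B ^+ 2)); apply: archi_boundP; exact: sqr_ge0.
have t0 := @tau_ge0 R n.
have xB : enorm (x (tau n)) <= B.
  apply: (le_trans (Hx x sx _ t0)); rewrite /B lerD ?bdec //.
  have e0 := ess_norm_ge0 `[0, tau n] sw.
  have e36 : (ess_norm `[0%R, tau n] sw <= 36%:E)%E.
    by apply: switching_ess_norm_le => t /=; rewrite in_itv /= => /andP[].
  have fe : fine (ess_norm `[0, tau n] sw) <= 36.
    by move: e0 e36; case: (ess_norm _ _) => [r| |] //=; rewrite lee_fin.
  by apply: mmono fe; exact: fine_ge0.
have [_ /andP[xn _]] := switching_solution sx n.
have n0 : 0 <= (n%:R : R) by exact: ler0n.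
have : 20 + 12 * n%:R <= B ^+ 2.
  rewrite -[leLHS]sqr_sqrtr; last by lra.
  have sB := le_trans xn xB.
  by rewrite ler_sqr // nnegrE ?sqrtr_ge0 // (le_trans (sqrtr_ge0 _) sB).
lra.
Qed.

End conclusion.

Theorem theorem1 (R : realType) :
  (* (i) *)
  [/\ lipschitz_functional (@V_ R),
      lipschitz_field (@f_ R),
      f_ (0 : R -> plane R) 0 = 0 &
      forall phi : R -> plane R, history phi ->
        enorm (phi 0) ^+ 2 / 2 <= V_ phi <= 3 / 2 * hnorm phi ^+ 2] /\
  (* (ii) *)
  (robustly_forward_complete (@f_ R) /\
   forall (phi : R -> plane R) (p q a b : R),
     history phi -> phi 0 = (p, q) ->
     (driver_derivative (@V_ R) phi (f_ phi (a, b)) <=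
        (- p ^+ 2 - q ^+ 2 / 2 + a ^+ 2)%:E)%E /\
     - p ^+ 2 - q ^+ 2 / 2 + a ^+ 2 <=
       - (enorm (phi 0) ^+ 2 / 2) + enorm (a, b) ^+ 2) /\
  (* (iii) *)
  ([/\ forall n : nat, tau n.+1 = rho n + delta n :> R,
       is_input (@switching_input R),
       bounded_input (@switching_input R) /\
       piecewise_continuous_input (@switching_input R),
       right_continuous_input (@switching_input R) &
       ess_norm `[0, +oo[ (@switching_input R) = 36%:E] /\
   (exists x : R -> plane R,
      is_solution (@f_ R) (fun _ => (2, -4)) (@switching_input R) x) /\
   forall x : R -> plane R,
     is_solution (@f_ R) (fun _ => (2, -4)) (@switching_input R) x ->
     forall n : nat,
       0 < eps_ n * (x (tau n)).1 /\
       Num.sqrt (20 + 12 * n%:R) <= enorm (x (tau n))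
         <= Num.sqrt (20 + 16 * n%:R)) /\
  (* consequence *)
  [/\ conjecture_hypotheses (@f_ R) (@V_ R), ~ ISS (@f_ R) & ~ conjecture R].
Proof.
split; [|split; [|split]].
- split; [exact: V_lipschitz_functional|exact: f_lipschitz_field|
  exact: f_zero|exact: V_bounds].
- split; first exact: f_robustly_forward_complete.
  move=> phi p q a b hp phi0; split; first exact: driver_derivative_le.
  exact: dissipation_le.
- split.
    split; [exact: tauS|exact: switching_is_input| |
      exact: switching_right_continuous|exact: switching_ess_norm].
    split; last exact: switching_piecewise_continuous.
    by exists 36; exact: switching_input_le.
  split; last exact: switching_solution.
  by apply: solution_exists; [exact: cst_history|exact: switching_is_input].
- split; [exact: f_V_conjecture_hypotheses|exact: f_not_ISS|].
  by move=> conj; apply: (@f_not_ISS R); apply: conj (f_V_conjecture_hypotheses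
    R).
Qed.
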